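(* Let $k$ have characteristic $p=2$. Then the class of $\sigma$ is the only quasi-isolated class in $\mathrm{GL}_r\cdot\sigma$, in $\mathrm{SL}_r\cdot\sigma$ and in $\mathrm{PGL}_r\cdot\sigma$. In these groups the group of points over $k$ of the centralizer of $\sigma$ is $\mathrm{Sp}_r(k)$ if $r$ is even and $\mathrm{Sp}_{r-1}(k)$ if $r$ is odd.
   Context: $k$ is an algebraically closed field of characteristic $p$. For $\mathbf G=\mathrm{GL}_r,\mathrm{SL}_r$ or $\mathrm{PGL}_r$ over $k$, $\sigma$ is the (quasi-central) automorphism $\sigma(g)=J\,{}^t(g^{-1})\,J^{-1}$ with $J=\mathrm{antidiag}(\underbrace{1,\ldots,1}_{\lfloor r/2\rfloor},\underbrace{-1,\ldots,-1}_{\lfloor (r+1)/2\rfloor})$, where $\mathrm{antidiag}(x_1,\ldots,x_r)$ is the antidiagonal matrix with coefficient $x_i$ in the $i$-th column; $\mathbf G\cdot\sigma$ is the corresponding coset in a (possibly disconnected) group with identity component $\mathbf G$ in which $\sigma$ is an element of finite order acting on $\mathbf G$ by the automorphism $g\mapsto J\,{}^t(g^{-1})\,J^{-1}$, and classes are $\mathbf G$-conjugacy classes. An element of $\mathbf G\cdot\sigma$ is quasi-semisimple if it stabilizes a pair consisting of a maximal torus of $\mathbf G$ and a Borel subgroup containing it. Let $\mathbf T$ be the diagonal torus. Every quasi-semisimple class has a representative $t\sigma$ with $t\in(\mathbf T^\sigma)^0$ (superscript $0$: identity component); $t\sigma$ (and its class) is called quasi-isolated if $\mathbf G^{t\sigma}$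 (the centralizer in $\mathbf G$) is not contained in a $\sigma$-stable Levi subgroup of a proper $\sigma$-stable parabolic subgroup of $\mathbf G$. Only elements of finite order are considered. *)

(* Defs.v *)
From HB Require Import structures.
From mathcomp Require Import all_boot all_order all_fingroup all_algebra.
From mathcomp Require Import mpoly.
From mathcomp Require Import mathcomp_extra boolp classical_sets functions.

Set Implicit Arguments.
Unset Strict Implicit.
Unset Printing Implicit Defensive.

Import GRing.Theory.

Local Open Scope classical_set_scope.
Local Open Scope ring_scope.

(* Linear algebraic groups are given by their k-points, as Zariski-closed      *)
(* subgroups of GL_n(k), with k algebraically closed.                          *)

(* The n * n coordinates of a matrix are those of mxvec. *)
Definition zeros (k : closedFieldType) n (S : set {mpoly k[n * n]}) :
    set 'M[k]_n :=
  [set A | forall q, S q -> q.@[fun i => mxvec A 0 i] = 0].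

Definition zclosed (k : closedFieldType) n (X : set 'M[k]_n) : Prop :=
  exists S, X = zeros S.

(* Connectedness for the induced topology. *)
Definition zconnected (k : closedFieldType) n (X : set 'M[k]_n) : Prop :=
  forall A B, zclosed A -> zclosed B -> X `<=` A `|` B ->
    X `&` (A `&` B) = set0 -> X `<=` A \/ X `<=` B.

Definition identity_component (k : closedFieldType) n (X : set 'M[k]_n) :
    set 'M[k]_n :=
  [set g | exists C, [/\ C `<=` X, zconnected C, C 1%:M & C g]].

Definition GL (k : closedFieldType) n : set 'M[k]_n := [set g | g \in unitmx].
Arguments GL : clear implicits.

Definition subgroup (k : closedFieldType) n (H : set 'M[k]_n) : Prop :=
  [/\ H `<=` GL k n, H 1%:M,
      forall g h, H g -> H h -> H (g *m h)
    & forall g, H g -> H (invmx g)].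

(* Closed in GL_n, not necessarily in the space of all matrices. *)
Definition closed_subgroup (k : closedFieldType) n (H : set 'M[k]_n) : Prop :=
  subgroup H /\ exists2 X, zclosed X & H = GL k n `&` X.

Definition normal_in (k : closedFieldType) n (P U : set 'M[k]_n) : Prop :=
  U `<=` P /\ forall g u, P g -> U u -> U (g *m u *m invmx g).

Definition generated (k : closedFieldType) n (X : set 'M[k]_n) : set 'M[k]_n :=
  [set g | forall H, subgroup H -> X `<=` H -> H g].

Definition derived_subgroup (k : closedFieldType) n (H : set 'M[k]_n) :
    set 'M[k]_n :=
  generated [set c | exists g h,
    [/\ H g, H h & c = g *m h *m invmx g *m invmx h]].

Definition solvable_subgroup (k : closedFieldType) n (H : set 'M[k]_n) : Prop :=
  exists d, iter d (@derived_subgroup k n) H `<=` [set 1%:M].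

Definition unipotent_subgroup (k : closedFieldType) n (H : set 'M[k]_n) : Prop :=
  forall g, H g -> exists m, (g - 1%:M) ^+ m = 0.

Definition torus (k : closedFieldType) n (S : set 'M[k]_n) : Prop :=
  [/\ closed_subgroup S, zconnected S
    & exists2 a, a \in unitmx &
        forall g, S g -> is_diag_mx (a *m g *m invmx a)].

Definition maximal_torus (k : closedFieldType) n (G S : set 'M[k]_n) : Prop :=
  [/\ torus S, S `<=` G
    & forall S', torus S' -> S' `<=` G -> S `<=` S' -> S' = S].

Definition borel (k : closedFieldType) n (G B : set 'M[k]_n) : Prop :=
  [/\ [/\ closed_subgroup B, zconnected B & solvable_subgroup B], B `<=` G
    & forall B', closed_subgroup B' -> zconnected B' -> solvable_subgroup B' ->
        B' `<=` G -> B `<=` B' -> B' = B].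

Definition parabolic (k : closedFieldType) n (G P : set 'M[k]_n) : Prop :=
  [/\ closed_subgroup P, P `<=` G & exists2 B, borel G B & B `<=` P].

Definition unipotent_radical (k : closedFieldType) n (P U : set 'M[k]_n) : Prop :=
  let good V := [/\ closed_subgroup V, zconnected V, unipotent_subgroup V
                  & normal_in P V] in
  good U /\ forall V, good V -> V `<=` U.

(* L is a complement to the unipotent radical: P = U \rtimes L. *)
Definition levi (k : closedFieldType) n (P L : set 'M[k]_n) : Prop :=
  [/\ closed_subgroup L, L `<=` P
    & exists U, [/\ unipotent_radical P U, L `&` U = [set 1%:M]
                  & P = [set g | exists u l, [/\ U u, L l & g = u *m l]]]].

Definition SL (k : closedFieldType) n : set 'M[k]_n := [set g | \det g = 1].
Arguments SL : clear implicits.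

(* PGL_r is realised as the image of GL_r in GL(M_r(k)) = GL_(r * r) by the    *)
(* adjoint representation, i.e. as the automorphism group of the algebra       *)
(* M_r(k). As lin_mx matrices act on row vectors on the right, it is           *)
(* X |-> g^-1 X g (rather than g X g^-1) that makes Ad multiplicative.         *)
Definition Ad (k : closedFieldType) r (g : 'M[k]_r) : 'M[k]_(r * r) :=
  lin_mx (fun X : 'M[k]_r => invmx g *m X *m g).

Definition sigmaJ (k : closedFieldType) r : 'M[k]_r :=
  \matrix_(i, j) if (i + j).+1 == r
                 then (if (j < r./2)%N then 1 else -1) else 0.

Definition sigma_aut (k : closedFieldType) r (g : 'M[k]_r) : 'M[k]_r :=
  sigmaJ k r *m (invmx g)^T *m invmx (sigmaJ k r).

(* G = rho(H), where H is GL_r or SL_r and rho is the identity or Ad, is       *)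
(* embedded by [incl] in a group containing an element [sigma] of finite order *)
(* that acts on G by the automorphism induced by sigma_aut. The coset G.sigma  *)
(* consists of the elements incl g * sigma.                                    *)
Record extension (k : closedFieldType) r n (rho : 'M[k]_r -> 'M[k]_n)
    (H : set 'M[k]_r) := Extension {
  ambient :> groupType;
  incl : 'M[k]_n -> ambient;
  sigma : ambient;
  inclM : forall g h, (rho @` H) g -> (rho @` H) h ->
    incl (g *m h) = (incl g * incl h)%g;
  incl_inj : set_inj (rho @` H) incl;
  sigmaE : forall g, H g ->
    (sigma * incl (rho g) * sigma^-1)%g = incl (rho (sigma_aut g));
  sigma_finite : exists2 m, (0 < m)%N & (sigma ^+ m)%g = 1%g }.

Section Coset.
Context {k : closedFieldType} {r n : nat} {rho : 'M[k]_r -> 'M[k]_n}.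
Context {H : set 'M[k]_r} (E : extension rho H).

Definition Gpts : set 'M[k]_n := rho @` H.

Definition diagonal_torus : set 'M[k]_n := rho @` (H `&` [set g | is_diag_mx g]).

Definition stabilizes (x : E) (X : set 'M[k]_n) : Prop :=
  [set (x * incl E g * x^-1)%g | g in X] = [set incl E g | g in X].

Definition centralizer (x : E) : set 'M[k]_n :=
  [set g | Gpts g /\ (incl E g * x)%g = (x * incl E g)%g].

Definition Gclass (x : E) : set E :=
  [set (incl E g * x * (incl E g)^-1)%g | g in Gpts].

Definition finite_order (x : E) : Prop :=
  exists2 m, (0 < m)%N & (x ^+ m)%g = 1%g.

Definition quasi_semisimple (x : E) : Prop :=
  exists S B, [/\ maximal_torus Gpts S, borel Gpts B, S `<=` B,
                  stabilizes x S & stabilizes x B].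

Definition quasi_isolated (x : E) : Prop :=
  ~ exists P L, [/\ parabolic Gpts P, P <> Gpts, stabilizes (sigma E) P,
                    levi P L & stabilizes (sigma E) L /\ centralizer x `<=` L].

(* (T^sigma)^0 *)
Definition torus_fixed0 : set 'M[k]_n :=
  identity_component (diagonal_torus `&` centralizer (sigma E)).

Definition quasi_isolated_class (C : set E) : Prop :=
  exists t, let x := (incl E t * sigma E)%g in
    [/\ torus_fixed0 t, finite_order x, quasi_semisimple x, C = Gclass x
      & quasi_isolated x].

End Coset.

(* Gram matrix of a nondegenerate alternating form when m is even. *)
Definition symplectic_form (k : closedFieldType) m : 'M[k]_m :=
  \matrix_(i, j) if (i + j).+1 == m
                 then (if (i < j)%N then 1 else -1) else 0.

(* Only meaningful for m even. *)
Definition Sp (k : closedFieldType) m : set 'M[k]_m :=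
  [set g | g^T *m symplectic_form k m *m g = symplectic_form k m].
Arguments Sp : clear implicits.

Definition group_isomorphic (k : closedFieldType) m n
    (A : set 'M[k]_m) (B : set 'M[k]_n) : Prop :=
  exists2 f : 'M[k]_m -> 'M[k]_n, set_bij A B f &
    forall g h, A g -> A h -> f (g *m h) = f g *m f h.

Definition sigma_only_quasi_isolated (k : closedFieldType) r n
    (rho : 'M[k]_r -> 'M[k]_n) (H : set 'M[k]_r) (E : extension rho H) : Prop :=
  forall C : set E, quasi_isolated_class C <-> C = Gclass (sigma E).

Definition sigma_centralizer_symplectic (k : closedFieldType) r n
    (rho : 'M[k]_r -> 'M[k]_n) (H : set 'M[k]_r) (E : extension rho H) : Prop :=
  group_isomorphic (Sp k (if odd r then r.-1 else r)) (centralizer (sigma E)).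

(* Main.v *)
Require Import Defs.
From mathcomp Require Import all_boot all_order all_fingroup all_algebra.
From mathcomp Require Import boolp classical_sets functions.
From mathcomp Require Import mpoly ring zify.

(** In characteristic 2 the matrix J is symmetric with square 1, and sigma is
    the involution g |-> J g^-T J. The three groups are treated together as G =
    rho(H), where H is GL or SL and rho is the identity or Ad
    (central_quotient).

    Only the class of sigma can be quasi-isolated. Let t = rho d be diagonal
    and fixed by sigma. If g is in the centralizer of t sigma up to a scalar,
    applying t sigma twice cancels the scalar, and shows that g commutes with
    d^2 (centralizer_commutes_square). In characteristic 2 squaring is
    injective, so g preserves the eigenspaces of d itself. If d is not scalar,
    it has distinct entries mu and mu' at mirror places; the splitting of the
    space into the eigenspaces of mu and mu' and the sum of the others defines
    a sigma-stable Levi subgroup, of a proper sigma-stable parabolic subgroup,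
    that contains the centralizer (quasi_isolated_trivial). If d is scalar, t =
    1.

    Conversely sigma is quasi-isolated (sigma_quasi_isolated). A parabolic
    subgroup P contains a Borel subgroup, hence all the transvections with some
    fixed direction f. If P is sigma-stable and contains the centralizer of
    sigma, which contains the transvections 1 + u u^T J for u isotropic, then
    the directions v all of whose transvections are in P form a subspace, and
    the orthogonality relation of J forces it to be the whole space
    (transvections_in). So P contains the image of SL, and P = G.

    The centralizer of sigma in G is the image of the isometry group of J,
    since a similitude becomes an isometry after division by a square root of
    its multiplier (sigma_centralizer_image). For r even this is Sp_r. For r
    odd, x^T J x is the square of the middle coordinate, so that isometries fix
    the middle basis vector and its dual, and the group is Sp_(r-1)
    (embed_bij).

    The notions of Borel subgroup, parabolic subgroup, unipotent radical and
    torus are the general ones, defined by maximality in the Zariski topology,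
    so their instances have to be identified. Borel subgroups are the
    conjugates of the triangular group by the Lie-Kolchin theorem
    (lie_kolchin), which rests on the connectedness of derived subgroups and on
    the fact that a regular function with finitely many values on a connected
    set is constant. The unipotent radical of a block triangular group is found
    by a computation of traces of commutators with transvections
    (commutators_unipotent_scalar). For PGL, closed and connected sets are
    carried through Ad by means of sets that are stable under scalars (Ad_push,
    Ad_pull) and of the Skolem-Noether theorem (Ad_image). *)

Set Implicit Arguments.
Unset Strict Implicit.
Unset Printing Implicit Defensive.

Import GRing.Theory.

Local Open Scope classical_set_scope.
Local Open Scope ring_scope.

(** * Polynomial and regular functions, and the Zariski topology *)

(** A property that passes to polynomial expressions. Polynomial functions are
    handled only through polyfun_ind, which says that they are generated by the
    entries. *)
Definition function_ring (k : closedFieldType) (T : Type)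
    (Q : (T -> k) -> Prop) : Prop :=
  [/\ forall c, Q (fun=> c),
      forall f g, Q f -> Q g -> Q (fun x => f x + g x)
    & forall f g, Q f -> Q g -> Q (fun x => f x * g x)].

Section FunctionRing.
Variables (k : closedFieldType) (T : Type) (Q : (T -> k) -> Prop).
Hypothesis ringQ : function_ring Q.

Lemma fring_sum (I : Type) (s : seq I) (P : pred I) (f : I -> T -> k) :
  (forall i, Q (f i)) -> Q (fun x => \sum_(i <- s | P i) f i x).
Proof.
have [Qc QD _] := ringQ => Qf; elim: s => [|i s IHs].
  by under eq_fun do rewrite big_nil.
under eq_fun do rewrite big_cons.
by case: (P i) => //; apply: QD.
Qed.

Lemma fring_prod (I : Type) (s : seq I) (P : pred I) (f : I -> T -> k) :
  (forall i, Q (f i)) -> Q (fun x => \prod_(i <- s | P i) f i x).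
Proof.
have [Qc _ QM] := ringQ => Qf; elim: s => [|i s IHs].
  by under eq_fun do rewrite big_nil.
under eq_fun do rewrite big_cons.
by case: (P i) => //; apply: QM.
Qed.

Lemma fring_opp f : Q f -> Q (fun x => - f x).
Proof.
have [Qc _ QM] := ringQ => Qf; under eq_fun do rewrite -mulN1r.
exact: QM.
Qed.

Lemma fring_exp f m : Q f -> Q (fun x => f x ^+ m).
Proof.
have [Qc _ QM] := ringQ => Qf; elim: m => [|m IHm]; first exact: Qc.
by under eq_fun do rewrite exprS; apply: QM.
Qed.

Definition entrywise m n (F : T -> 'M[k]_(m, n)) :=
  forall i j, Q (fun x => F x i j).

Lemma fring_mulmx m n p (F : T -> 'M[k]_(m, n)) (G : T -> 'M[k]_(n, p)) :
  entrywise F -> entrywise G -> entrywise (fun x => F x *m G x).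
Proof.
have [_ _ QM] := ringQ => QF QG i j.
by under eq_fun do rewrite mxE; apply: fring_sum => l; apply: QM.
Qed.

Lemma fring_addmx m n (F G : T -> 'M[k]_(m, n)) :
  entrywise F -> entrywise G -> entrywise (fun x => F x + G x).
Proof.
have [_ QD _] := ringQ => QF QG i j.
by under eq_fun do rewrite mxE; apply: QD.
Qed.

Lemma fring_cstmx m n (A : 'M[k]_(m, n)) : entrywise (fun=> A).
Proof. by have [Qc _ _] := ringQ => i j; apply: Qc. Qed.

Lemma fring_scalemx m n f (F : T -> 'M[k]_(m, n)) :
  Q f -> entrywise F -> entrywise (fun x => f x *: F x).
Proof.
have [_ _ QM] := ringQ => Qf QF i j.
by under eq_fun do rewrite mxE; apply: QM.
Qed.

Lemma fring_det n (F : T -> 'M[k]_n) :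
  entrywise F -> Q (fun x => \det (F x)).
Proof.
have [Qc _ QM] := ringQ => QF; apply: fring_sum => s.
by apply: QM; [exact: Qc | apply: fring_prod => i; apply: QF].
Qed.

Lemma fring_adj n (F : T -> 'M[k]_n) :
  entrywise F -> entrywise (fun x => \adj (F x)).
Proof.
have [Qc _ QM] := ringQ => QF i j.
under eq_fun do rewrite mxE /cofactor.
apply: QM; first exact: Qc.
by apply: fring_det => u v; under eq_fun do rewrite !mxE.
Qed.

End FunctionRing.

Section Topology.
Variable k : closedFieldType.

Definition polyfun n (f : 'M[k]_n -> k) : Prop :=
  exists q : {mpoly k[n * n]}, forall A, f A = q.@[fun i => mxvec A 0 i].

Lemma polyfun_ind n (T : Type) (F : T -> 'M[k]_n) (Q : (T -> k) -> Prop) :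
  function_ring Q -> entrywise Q F ->
  forall f, polyfun f -> Q (fun x => f (F x)).
Proof.
move=> ringQ QF f [q fq]; have [Qc QD QM] := ringQ.
rewrite (_ : (fun x => f (F x)) =
  fun x => q.@[fun i => mxvec (F x) 0 i]); last by apply: funext => x.
elim/mpolyind: q {f fq} => [|c m p _ _ IHp].
  by under eq_fun do rewrite meval0.
under eq_fun do rewrite mevalD mevalZ mevalX.
apply: QD => //; apply: QM => //; apply: fring_prod => // i.
apply: fring_exp => //; case/mxvec_indexP: i => i j.
by under eq_fun do rewrite mxvecE; apply: QF.
Qed.

Lemma polyfun_ring n : function_ring (@polyfun n).
Proof.
split=> [c|f g [p fp] [q gq]|f g [p fp] [q gq]].
- by exists c%:MP => A; rewrite mevalC.
- by exists (p + q) => A; rewrite mevalD fp gq.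
- by exists (p * q) => A; rewrite mevalM fp gq.
Qed.

Lemma polyfun_entry n : entrywise (@polyfun n) id.
Proof. by move=> i j; exists 'X_(mxvec_index i j) => A;
  rewrite mevalXU mxvecE. Qed.

Lemma polyfun_comp m n (F : 'M[k]_m -> 'M[k]_n) f :
  entrywise (@polyfun m) F -> polyfun f -> polyfun (fun A => f (F A)).
Proof. by move=> pF; apply: polyfun_ind => //; apply: polyfun_ring. Qed.

Lemma zclosedP n (X : set 'M[k]_n) :
  zclosed X <-> exists2 S : set ('M[k]_n -> k), S `<=` @polyfun n &
    X = [set A | forall f, S f -> f A = 0].
Proof.
split=> [[S ->]|[S Spoly ->]].
  exists [set f | exists2 q, S q & forall A, f A = q.@[fun i => mxvec A 0 i]].
    by move=> f [q _ fq]; exists q.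
  apply/seteqP; split=> A /= A0.
    by move=> f [q Sq ->]; apply: A0.
  by move=> q Sq; apply: (A0 (fun A => q.@[_])); exists q.
exists [set q | exists2 f, S f & forall A, f A = q.@[fun i => mxvec A 0 i]].
apply/seteqP; split=> A /= A0.
  by move=> q [f Sf <-]; apply: A0.
move=> f Sf; have [q fq] := Spoly _ Sf.
by rewrite fq; apply: A0; exists f.
Qed.

Lemma zclosed_zero n (f : 'M[k]_n -> k) :
  polyfun f -> zclosed [set A | f A = 0].
Proof.
move=> pf; apply/zclosedP; exists [set f] => [g -> //|].
by apply/seteqP; split=> A /= fA; [move=> g -> | apply: fA].
Qed.

Lemma zclosed_bigcap n (I : Type) (D : set I) (X : I -> set 'M[k]_n) :
  (forall i, D i -> zclosed (X i)) ->
  zclosed [set A | forall i, D i -> X i A].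
Proof.
move=> Xcl; apply/zclosedP.
exists [set f | polyfun f /\ exists2 i, D i & forall A, X i A -> f A = 0].
  by move=> f [].
apply/seteqP; split=> A /= XA.
  by move=> f [_ [i Di Xf]]; apply/Xf/XA.
move=> i Di; have /zclosedP[S Spoly eX] := Xcl i Di.
rewrite eX => f Sf; apply: XA; split; first exact: Spoly.
by exists i => // B; rewrite eX; apply.
Qed.

Lemma zclosedI n (X Y : set 'M[k]_n) :
  zclosed X -> zclosed Y -> zclosed (X `&` Y).
Proof.
move=> clX clY.
rewrite (_ : X `&` Y = [set A | forall b, setT b -> (if b then X else Y) A]).
  by apply: zclosed_bigcap; case.
apply/seteqP; split=> A /=; first by case=> ? ? [].
by move=> XY; split; [apply: (XY true) | apply: (XY false)].
Qed.

Lemma zclosed_preimage m n (F : 'M[k]_m -> 'M[k]_n) (X : set 'M[k]_n) :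
  entrywise (@polyfun m) F -> zclosed X -> zclosed [set A | X (F A)].
Proof.
move=> pF /zclosedP[S Spoly ->] /=.
by apply: zclosed_bigcap => f Sf; apply/zclosed_zero/polyfun_comp/Spoly.
Qed.

(** Regularity in the sense of algebraic geometry, except that one fraction is
    required to represent the function on all of X: all the functions below,
    which only involve inverses of determinants, are of this kind. *)
Definition regular n (X : set 'M[k]_n) (f : 'M[k]_n -> k) : Prop :=
  exists p q, [/\ polyfun p, polyfun q &
    forall A, X A -> q A != 0 /\ f A = p A / q A].

Lemma regular_poly n (X : set 'M[k]_n) f : polyfun f -> regular X f.
Proof.
have [c1 _ _] := polyfun_ring n.
by exists f, (fun=> 1); split=> // A _; rewrite divr1 oner_eq0.
Qed.

Lemma regular_ring n (X : set 'M[k]_n) : function_ring (regular X).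
Proof.
have [polyc polyD polyM] := polyfun_ring n.
split=> [c|f g [p [q [pp pq fE]]] [p' [q' [pp' pq' gE]]]
          |f g [p [q [pp pq fE]]] [p' [q' [pp' pq' gE]]]].
- exact/regular_poly/polyc.
- exists (fun A => p A * q' A + p' A * q A), (fun A => q A * q' A).
  split; [by apply: polyD; apply: polyM | exact: polyM | move=> A XA].
  have [q0 ->] := fE A XA; have [q'0 ->] := gE A XA.
  by rewrite mulf_neq0 // addf_div.
- exists (fun A => p A * p' A), (fun A => q A * q' A).
  split; [exact: polyM | exact: polyM | move=> A XA].
  have [q0 ->] := fE A XA; have [q'0 ->] := gE A XA.
  by rewrite mulf_neq0 // mulf_div.
Qed.

Lemma regular_inv n (X : set 'M[k]_n) f :
  regular X f -> (forall A, X A -> f A != 0) -> regular X (fun A => (f A)^-1).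
Proof.
move=> [p [q [pp pq fE]]] f0; exists q, p; split=> // A XA.
have [q0 fA] := fE A XA; move: (f0 A XA); rewrite fA.
by rewrite invf_div mulf_eq0 negb_or => /andP[-> _].
Qed.

Lemma regular_entry n (X : set 'M[k]_n) : entrywise (regular X) id.
Proof. by move=> i j; apply/regular_poly/polyfun_entry. Qed.

Lemma regular_invmx m n (X : set 'M[k]_m) (F : 'M[k]_m -> 'M[k]_n) :
  entrywise (regular X) F -> (forall A, X A -> F A \in unitmx) ->
  entrywise (regular X) (fun A => invmx (F A)).
Proof.
have [_ _ regM] := regular_ring X => regF unitF i j.
have regd : regular X (fun A => (\det (F A))^-1 * \adj (F A) i j).
  apply: regM; last exact: fring_adj (regular_ring X) _ _ regF i j.
  apply: regular_inv; first exact: fring_det (regular_ring X) _ _ regF.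
  by move=> A XA; rewrite -unitfE -unitmxE unitF.
have [p [q [pp pq fE]]] := regd; exists p, q; split=> // A XA.
by have [q0 <-] := fE A XA; rewrite /invmx unitF // mxE.
Qed.

Lemma regular_comp m n (X : set 'M[k]_m) (F : 'M[k]_m -> 'M[k]_n) f :
  entrywise (regular X) F -> polyfun f -> regular X (fun A => f (F A)).
Proof. by move=> rF; apply: polyfun_ind => //; apply: regular_ring. Qed.

Lemma regular_comp_regular m n (X : set 'M[k]_m) (Y : set 'M[k]_n)
    (F : 'M[k]_m -> 'M[k]_n) f :
  entrywise (regular X) F -> (forall A, X A -> Y (F A)) -> regular Y f ->
  regular X (fun A => f (F A)).
Proof.
have [_ _ regM] := regular_ring X.
move=> rF XY [p [q [pp pq fE]]].
have [|p' [q' [pp' pq' fE']]] :=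
    regM _ _ (regular_comp rF pp) (regular_inv (regular_comp rF pq) _).
  by move=> A /XY/fE[].
exists p', q'; split=> // A XA; have [q'0 <-] := fE' A XA.
by have [_ ->] := fE _ (XY A XA).
Qed.

Lemma regular_zero n (X : set 'M[k]_n) f : regular X f ->
  exists2 g, polyfun g & forall A, X A -> f A = 0 <-> g A = 0.
Proof.
move=> [p [q [pp _ fE]]]; exists p => // A XA.
have [q0 ->] := fE A XA; split=> [|->]; last by rewrite mul0r.
by move/eqP; rewrite mulf_eq0 invr_eq0 (negPf q0) orbF => /eqP.
Qed.

(** Regular maps are continuous. *)
Lemma regular_preimage m n (X : set 'M[k]_m) (F : 'M[k]_m -> 'M[k]_n) Z :
  entrywise (regular X) F -> zclosed Z ->
  exists2 Y, zclosed Y & forall A, X A -> Z (F A) <-> Y A.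
Proof.
move=> rF /zclosedP[S Spoly ->].
exists [set A | forall f, (polyfun f /\ exists2 g, S g &
    forall B, X B -> g (F B) = 0 <-> f B = 0) -> f A = 0].
  by apply: zclosed_bigcap => f [pf _]; apply: zclosed_zero.
move=> A XA; split=> /= SA.
  by move=> f [_ [g Sg gf]]; apply/(gf A XA)/SA.
move=> g Sg; have [f pf fE] := regular_zero (regular_comp rF (Spoly g Sg)).
by apply/(fE A XA)/SA; split=> //; exists g.
Qed.

Lemma zconnected_image m n (X : set 'M[k]_m) (F : 'M[k]_m -> 'M[k]_n) :
  entrywise (regular X) F -> zconnected X -> zconnected (F @` X).
Proof.
move=> rF conX A B clA clB XAB AB0.
have [A' clA' eA] := regular_preimage rF clA.
have [B' clB' eB] := regular_preimage rF clB.
have [||XA|XB] := conX A' B' clA' clB'.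
- move=> g Xg; have [Ag|Bg] := XAB _ (ex_intro2 _ _ g Xg erefl).
    by left; apply/eA.
  by right; apply/eB.
- apply/seteqP; split=> // g [Xg [A'g B'g]].
  rewrite -[set0 _]/False; have : (F @` X `&` (A `&` B)) (F g).
    by split; [exists g | split; [apply/eA | apply/eB]].
  by rewrite AB0.
- by left=> _ [g Xg <-]; apply/eA/XA.
- by right=> _ [g Xg <-]; apply/eB/XB.
Qed.

(** Whatever part of a disconnection contains the base point g0 contains all of
    the connected sets Y through it. *)
Lemma zconnected_union n (X : set 'M[k]_n) g0 :
  (forall g, X g -> exists2 Y, zconnected Y & [/\ Y `<=` X, Y g0 & Y g]) ->
  zconnected X.
Proof.
move=> Xcon A B clA clB XAB AB0.
have [Xg0|Xg0] := pselect (X g0); last first.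
  left=> g Xg; have [Y _ [YX Yg0 _]] := Xcon g Xg.
  by case: Xg0; apply: YX.
have sub C D : zclosed C -> zclosed D -> X `<=` C `|` D ->
    X `&` (C `&` D) = set0 -> C g0 -> X `<=` C.
  move=> clC clD XCD CD0 Cg0 g Xg; have [Y conY [YX Yg0 Yg]] := Xcon g Xg.
  have [||YC|YD] := conY C D clC clD; first exact: subset_trans XCD.
  - by rewrite -subset0 -CD0; apply: setSI.
  - exact: YC.
  - have : (X `&` (C `&` D)) g0 by split=> //; split=> //; apply: YD.
    by rewrite CD0.
have [Ag0|Bg0] := XAB g0 Xg0; first by left; apply: (sub A B).
by right; apply: (sub B A); rewrite // 1?setUC // [B `&` A]setIC.
Qed.

Lemma zconnected1 n (g : 'M[k]_n) : zconnected [set g].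
Proof.
by move=> A B _ _ /(_ g erefl)[Ag|Bg] _; [left|right]=> _ ->.
Qed.

Lemma polyfun_line (f : 'M[k]_1 -> k) : polyfun f ->
  exists p : {poly k}, forall s, f s%:M = p.[s].
Proof.
pose Q (h : k -> k) := exists p : {poly k}, forall s, h s = p.[s].
apply: (@polyfun_ind _ _ _ Q) => [|i j]; last first.
  by exists 'X => s; rewrite hornerX mxE !ord1.
split=> [c|f1 f2 [p1 e1] [p2 e2]|f1 f2 [p1 e1] [p2 e2]].
- by exists c%:P => s; rewrite hornerC.
- by exists (p1 + p2) => s; rewrite hornerD e1 e2.
- by exists (p1 * p2) => s; rewrite hornerM e1 e2.
Qed.

(** The punctured line is irreducible: no two nonempty basic open sets of it
    are disjoint. *)
Lemma zconnected_line (e : 'M[k]_1 -> k) :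
  polyfun e -> zconnected [set s | e s != 0].
Proof.
move=> pe A B /zclosedP[S Spoly ->] /zclosedP[S' S'poly ->] XAB _.
have [d ed] := polyfun_line pe.
apply: contrapT => /not_orP[/existsNP[x /not_implyP[Xx /existsNP[f]]]].
move=> /not_implyP[Sf fx] /existsNP[y /not_implyP[Xy /existsNP[g]]].
move=> /not_implyP[Sg gy].
have [p fp] := polyfun_line (Spoly f Sf).
have [q gq] := polyfun_line (S'poly g Sg).
have /closed_nonrootP[z] : d * (p * q) != 0.
  rewrite !mulf_neq0 //.
  - apply: contraTneq Xx => d0.
    by rewrite /= [x]mx11_scalar ed d0 horner0 eqxx.
  - by apply: contra_notN fx => /eqP p0; rewrite [x]mx11_scalar fp p0 horner0.
  - by apply: contra_notN gy => /eqP q0; rewrite [y]mx11_scalar gq q0 horner0.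
rewrite !rootM !negb_or => /and3P[ez pz qz].
have [|/(_ f Sf)|/(_ g Sg)] := XAB z%:M; first by rewrite /= ed.
  by rewrite fp; apply/eqP.
by rewrite gq; apply/eqP.
Qed.

(** The images of rational curves are connected because the punctured line is.
    The curves that are needed involve inverses of determinants, so they are
    only defined off the zeros of some e. *)
Lemma zconnected_curves r n (F : 'M[k]_r -> 'M[k]_n) (Y X : set 'M[k]_r) :
  entrywise (regular Y) F -> X `<=` Y ->
  (forall x, X x -> exists (e : 'M[k]_1 -> k) (c : 'M[k]_1 -> 'M[k]_r),
    [/\ polyfun e, entrywise (regular [set s | e s != 0]) c,
        forall s, e s != 0 -> X (c s)
      & [/\ e 0 != 0, e 1 != 0, c 0 = 1%:M & c 1 = x]]) ->
  zconnected (F @` X).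
Proof.
move=> rF XY Xcurve; apply: (@zconnected_union _ _ (F 1%:M)) => _ [x Xx <-].
have [e [c [pe rc cX [e0 e1 c0 c1]]]] := Xcurve x Xx.
exists ((fun s => F (c s)) @` [set s | e s != 0]).
  apply: zconnected_image (zconnected_line pe) => i j.
  by apply: regular_comp_regular (rF i j) => // s /cX/XY.
split=> [_ [s /cX Xs <-]||]; first by exists (c s).
  by exists 0; rewrite ?c0.
by exists 1; rewrite ?c1.
Qed.

(** The fibre of f over a value and the union of its other fibres are closed. *)
Lemma zconnected_constant n (X : set 'M[k]_n) f (rs : seq k) :
  zconnected X -> regular X f -> (forall A, X A -> f A \in rs) ->
  forall A B, X A -> X B -> f A = f B.
Proof.
move=> conX rf frs A B XA XB; have [Rc RD RM] := regular_ring X.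
have [g pg gE] := regular_zero (RD _ _ rf (Rc (- f A))).
have rprod : regular X (fun C => \prod_(c <- rs | c != f A) (f C - c)).
  by apply: fring_prod => // c; apply: RD.
have [h ph hE] := regular_zero rprod.
have prod0 C : X C -> f C != f A -> h C = 0.
  move=> XC fCA; apply/(hE C XC)/eqP; rewrite prodf_seq_eq0.
  by apply/hasP; exists (f C); rewrite ?frs // fCA subrr eqxx.
have [|| sub | sub] :=
    conX [set C | g C = 0] [set C | h C = 0]
      (zclosed_zero pg) (zclosed_zero ph).
- move=> C XC /=; have [fCA|fCA] := eqVneq (f C) (f A).
    by left; apply/(gE C XC); rewrite fCA subrr.
  by right; apply: prod0.
- apply/seteqP; split=> // C [XC [/= /(gE C XC)/eqP]].
  rewrite subr_eq0 => /eqP fCA /(hE C XC)/eqP.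
  rewrite prodf_seq_eq0 => /hasP[c _ /andP[cA]].
  by rewrite subr_eq0 fCA eq_sym (negPf cA).
- by move/(gE B XB)/eqP: (sub B XB); rewrite subr_eq0 => /eqP.
- move/(hE A XA)/eqP: (sub A XA).
  rewrite prodf_seq_eq0 => /hasP[c _ /andP[cA]].
  by rewrite subr_eq0 eq_sym (negPf cA).
Qed.

End Topology.

(** * Subgroups and the Lie-Kolchin theorem *)

Section Subgroups.
Variable k : closedFieldType.

Section Closure.
Variables (n : nat) (H : set 'M[k]_n).
Hypothesis sgH : subgroup H.

Lemma subgroup_unit g : H g -> g \in unitmx.
Proof. by case: sgH => HGL _ _ _ /HGL. Qed.

Lemma regular_inverse : entrywise (regular H) invmx.
Proof. exact: (regular_invmx (@regular_entry _ _ H) subgroup_unit). Qed.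

Lemma subgroup1 : H 1%:M. Proof. by case: sgH. Qed.

Lemma subgroupM g h : H g -> H h -> H (g *m h).
Proof. by case: sgH => _ _ HM _; apply: HM. Qed.

Lemma subgroupV g : H g -> H (invmx g).
Proof. by case: sgH => _ _ _; apply. Qed.

Lemma subgroupJ g h : H g -> H h -> H (g *m h *m invmx g).
Proof. by move=> Hg Hh; apply: subgroupM (subgroupV Hg); apply: subgroupM. Qed.

Lemma subgroupR g h : H g -> H h -> H (g *m h *m invmx g *m invmx h).
Proof. by move=> Hg Hh; apply: subgroupM (subgroupV Hh); apply: subgroupJ. Qed.

End Closure.

Lemma subgroup_GL n : subgroup (GL k n).
Proof.
split=> //= [|g h Hg Hh|g Hg]; rewrite /GL /=.
- exact: unitmx1.
- by rewrite unitmx_mul Hg.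
- by rewrite unitmx_inv.
Qed.

Lemma invmxM n (g h : 'M[k]_n) : g \in unitmx -> h \in unitmx ->
  invmx (g *m h) = invmx h *m invmx g.
Proof.
move=> Ug Uh; have Ugh : g *m h \in unitmx by rewrite unitmx_mul Ug.
apply: (can_inj (mulKmx Ugh)); rewrite mulmxV // !mulmxA.
by rewrite mulmxK // mulmxV.
Qed.

Lemma generated_subgroup n (X : set 'M[k]_n) :
  X `<=` GL k n -> subgroup (Defs.generated X).
Proof.
move=> XGL; split=> [g|H sgH _|g h Xg Xh H sgH XH|g Xg H sgH XH].
- by apply; [apply: subgroup_GL|].
- exact: subgroup1.
- by apply: subgroupM => //; [apply: Xg | apply: Xh].
- by apply: subgroupV => //; apply: Xg.
Qed.

Section Derived.
Variables (n : nat) (H : set 'M[k]_n).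
Hypothesis sgH : subgroup H.

Lemma derived_sub : derived_subgroup H `<=` H.
Proof. by move=> g; apply=> // _ [x [y [Hx Hy ->]]]; apply: subgroupR. Qed.

Lemma derived_subgroupP : subgroup (derived_subgroup H).
Proof.
apply: generated_subgroup => _ [x [y [Hx Hy ->]]].
by apply: (subgroup_unit sgH); apply: subgroupR.
Qed.

Lemma derivedR g h : H g -> H h ->
  derived_subgroup H (g *m h *m invmx g *m invmx h).
Proof. by move=> Hg Hh K _; apply; exists g, h. Qed.

Lemma derivedJ g x :
  H g -> derived_subgroup H x -> derived_subgroup H (g *m x *m invmx g).
Proof.
move=> Hg Dx; have Hx := derived_sub Dx.
rewrite -[_ *m invmx g](mulmxKV (subgroup_unit sgH Hx)).
by apply: subgroupM Dx; [exact: derived_subgroupP | exact: derivedR].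
Qed.

(** For fixed h the commutators of g and h, as g varies in H, form a connected
    set through 1, so right multiplication by a commutator cannot leave either
    part of a disconnection of the derived subgroup. *)
Lemma derived_connected : zconnected H -> zconnected (derived_subgroup H).
Proof.
move=> conH; apply: (@zconnected_union _ _ _ 1%:M) => x Dx.
exists (derived_subgroup H) => //; last first.
  by split=> //; apply: subgroup1 derived_subgroupP.
move=> A B clA clB DAB DAB0; have sgD := derived_subgroupP.
have slice C D y h : zclosed C -> zclosed D ->
    derived_subgroup H `<=` C `|` D ->
    derived_subgroup H `&` (C `&` D) = set0 ->
    derived_subgroup H y -> C y -> H h ->
    forall g, H g -> C (y *m (g *m h *m invmx g *m invmx h)).
  move=> clC clD DCD DCD0 Dy Cy Hh g Hg.
  pose F g' : 'M[k]_n := y *m (g' *m h *m invmx g' *m invmx h).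
  have FD : F @` H `<=` derived_subgroup H.
    by move=> _ [z Hz <-]; apply: (subgroupM sgD) => //; apply: derivedR.
  have conF : zconnected (F @` H).
    apply: zconnected_image conH; have R := regular_ring H.
    apply: fring_mulmx => //; first exact: fring_cstmx.
    apply: fring_mulmx => //; last exact: fring_cstmx.
    apply: fring_mulmx => //; last exact: regular_inverse sgH.
    by apply: fring_mulmx => //; [exact: regular_entry | exact: fring_cstmx].
  have [||FC|FD'] := conF C D clC clD; first exact: subset_trans DCD.
  - by rewrite -subset0 -DCD0; apply: setSI.
  - by apply: FC; exists g.
  - have : (derived_subgroup H `&` (C `&` D)) y; last by rewrite DCD0.
    split=> //; split=> //; apply: FD'; exists 1%:M; first exact: subgroup1.
    by rewrite /F mul1mx invmx1 mulmx1 mulmxV ?mulmx1 // (subgroup_unit sgH).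
have stable C D : zclosed C -> zclosed D ->
    derived_subgroup H `<=` C `|` D ->
    derived_subgroup H `&` (C `&` D) = set0 ->
    C 1%:M -> derived_subgroup H `<=` C.
  move=> clC clD DCD DCD0 C1 g Dg.
  pose K : set 'M[k]_n := [set g | [/\ derived_subgroup H g,
    forall y, derived_subgroup H y -> C y -> C (y *m g)
    & forall y, derived_subgroup H y -> C y -> C (y *m invmx g)]].
  have [|_ [x1 [y1 [Hx1 Hy1 ->]]]|] := Dg K; last first.
  - by move=> _ /(_ _ (subgroup1 sgD) C1); rewrite mul1mx.
  - split=> [|y Dy Cy|y Dy Cy]; first exact: derivedR.
      exact: (slice C D).
    have [Ux Uy] := (subgroup_unit sgH Hx1, subgroup_unit sgH Hy1).
    have [Vx Vy] : invmx x1 \in unitmx /\ invmx y1 \in unitmx.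
      by rewrite !unitmx_inv.
    rewrite !invmxM ?unitmx_mul ?Ux ?Uy ?Vx ?Vy // !invmxK.
    rewrite (mulmxA y1) (mulmxA (y1 *m x1)).
    exact: (slice C D).
  - split=> [u [Du _ _]|||u [Du u1 u2]].
    + exact: (subgroup_unit sgD).
    + split=> [|y Dy Cy|y Dy Cy]; first exact: subgroup1.
        by rewrite mulmx1.
      by rewrite invmx1 mulmx1.
    + move=> u v [Du u1 u2] [Dv v1 v2].
      split=> [|y Dy Cy|y Dy Cy]; first exact: (subgroupM sgD).
        by rewrite mulmxA; apply: v1; [apply: (subgroupM sgD) | apply: u1].
      rewrite invmxM ?(subgroup_unit sgD) // mulmxA.
      apply: u2; last exact: v2.
      by apply: (subgroupM sgD) => //; apply: (subgroupV sgD).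
    + split=> // [|y Dy Cy]; first exact: (subgroupV sgD).
      by rewrite invmxK; apply: u1.
have [A1|B1] := DAB _ (subgroup1 sgD); first by left; apply: (stable A B).
by right; apply: (stable B A); rewrite // 1?setUC // [B `&` A]setIC.
Qed.

End Derived.

Lemma iter_derived_subgroup n (H : set 'M[k]_n) d :
  subgroup H -> subgroup (iter d (@derived_subgroup k n) H).
Proof. by move=> sgH; elim: d => //= d IHd; exact: derived_subgroupP. Qed.

Lemma generated_mono n (X Y : set 'M[k]_n) :
  X `<=` Y -> Defs.generated X `<=` Defs.generated Y.
Proof. by move=> XY g Xg K sgK YK; apply: Xg => // x /XY/YK. Qed.

Lemma derived_mono n (H K : set 'M[k]_n) :
  H `<=` K -> derived_subgroup H `<=` derived_subgroup K.
Proof.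
move=> HK; apply: generated_mono => _ [g [h [/HK Hg /HK Hh ->]]].
by exists g, h.
Qed.

Lemma iter_derived_mono n (H K : set 'M[k]_n) d : H `<=` K ->
  iter d (@derived_subgroup k n) H `<=` iter d (@derived_subgroup k n) K.
Proof. by move=> HK; elim: d => //= d; apply: derived_mono. Qed.

Lemma solvable_sub n (H K : set 'M[k]_n) :
  H `<=` K -> solvable_subgroup K -> solvable_subgroup H.
Proof.
move=> HK [d Kd]; exists d.
by move=> g /(iter_derived_mono HK)/Kd.
Qed.

Definition multiplicative_on m n (H : set 'M[k]_m) (f : 'M[k]_m -> 'M[k]_n) :=
  [/\ f 1%:M = 1%:M, forall g, H g -> f g \in unitmx
    & forall g h, H g -> H h -> f (g *m h) = f g *m f h].

Section Morphism.
Variables (m n : nat) (f : 'M[k]_m -> 'M[k]_n).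

Lemma morphV H g : subgroup H -> multiplicative_on H f -> H g ->
  f (invmx g) = invmx (f g).
Proof.
move=> sgH [f1 fU fM] Hg; apply: (can_inj (mulKmx (fU g Hg))).
rewrite -fM //; last exact: subgroupV.
by rewrite !mulmxV ?fU ?(subgroup_unit sgH).
Qed.

Lemma morph_sub (H K : set 'M[k]_m) :
  K `<=` H -> multiplicative_on H f -> multiplicative_on K f.
Proof.
move=> KH [f1 fU fM]; split=> // [g /KH|g h /KH Hg /KH Hh]; first exact: fU.
exact: fM.
Qed.

Lemma subgroup_image H :
  subgroup H -> multiplicative_on H f -> subgroup (f @` H).
Proof.
move=> sgH fH; have [f1 fU fM] := fH; split.
- by move=> _ [g Hg <-]; apply: fU.
- by exists 1%:M; [apply: subgroup1|].
- by move=> _ _ [g Hg <-] [h Hh <-]; exists (g *m h);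
  [apply: subgroupM|apply: fM].
- move=> _ [g Hg <-]; exists (invmx g); first exact: subgroupV.
  exact: morphV fH Hg.
Qed.

Lemma subgroup_preimage H (K : set 'M[k]_n) :
  subgroup H -> multiplicative_on H f -> subgroup K ->
  subgroup [set g | H g /\ K (f g)].
Proof.
move=> sgH fH sgK; have [f1 fU fM] := fH;
  split=> [g [Hg _]||g h [Hg Kg] [Hh Kh]|g [Hg Kg]].
- exact: (subgroup_unit sgH).
- by split; [apply: subgroup1 | rewrite f1; apply: subgroup1].
- by split; [apply: subgroupM | rewrite fM //; apply: subgroupM].
- split; [exact: subgroupV | rewrite (morphV sgH fH Hg); exact: subgroupV].
Qed.

Lemma derived_image H : subgroup H -> multiplicative_on H f ->
  derived_subgroup (f @` H) = f @` derived_subgroup H.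
Proof.
move=> sgH fH; have [f1 fU fM] := fH; have sgD := derived_subgroupP sgH.
have fD := morph_sub (derived_sub sgH) fH.
have fR g h : H g -> H h -> f (g *m h *m invmx g *m invmx h) =
    f g *m f h *m invmx (f g) *m invmx (f h).
  move=> Hg Hh; rewrite !fM ?(morphV sgH fH) //; do ?exact: subgroupV.
    exact: subgroupM.
  exact: subgroupJ.
apply/seteqP; split.
  move=> g; apply; first exact: subgroup_image.
  move=> _ [_ [_ [[x Hx <-] [y Hy <-] ->]]].
  by exists (x *m y *m invmx x *m invmx y); [apply: derivedR | apply: fR].
move=> _ [g Dg <-].
have [|_ [x [y [Hx Hy ->]]]|//] :=
  Dg [set g | H g /\ derived_subgroup (f @` H) (f g)].
- by apply: subgroup_preimage => //; apply/derived_subgroupP/subgroup_image.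
- split; first exact: subgroupR.
  by rewrite fR //; apply: derivedR; [exists x | exists y].
Qed.

Lemma iter_derived_image H d : subgroup H -> multiplicative_on H f ->
  iter d (@derived_subgroup k n) (f @` H) =
  f @` iter d (@derived_subgroup k m) H.
Proof.
move=> sgH fH; elim: d => //= d ->; apply: derived_image.
  exact: iter_derived_subgroup.
apply: morph_sub fH; elim: d => //= d IHd g.
by move/(derived_sub (iter_derived_subgroup d sgH))/IHd.
Qed.

Lemma solvable_image H : subgroup H -> multiplicative_on H f ->
  solvable_subgroup H -> solvable_subgroup (f @` H).
Proof.
move=> sgH fH [d Hd]; exists d; rewrite iter_derived_image //.
by move=> _ [g /Hd -> <-]; have [-> _ _] := fH.
Qed.

End Morphism.

(** Take M of maximal rank among the matrices with row space inside S. *)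
Lemma subspace_mx n (S : 'rV[k]_n -> Prop) :
  S 0 -> (forall a u v, S u -> S v -> S (a *: u + v)) ->
  exists M : 'M[k]_n, forall w, S w <-> (w <= M)%MS.
Proof.
move=> S0 Slin.
pose P m := `[< exists2 M : 'M[k]_n, \rank M = m & forall w,
  (w <= M)%MS -> S w >].
have exP : exists m, P m.
  exists 0%N; apply/asboolP; exists 0 => [|w]; first exact: mxrank0.
  by rewrite submx0 => /eqP->.
have leP m : P m -> (m <= n)%N.
  by move=> /asboolP[M <- _]; apply: rank_leq_row.
have [_ /asboolP[M <- MS] maxM] := ex_maxnP exP leP.
exists M => w; split=> [Sw|]; last exact: MS.
have : P (\rank (M + w)%MS).
  apply/asboolP; exists (M + w)%MS => // u /sub_addsmxP[[a b] /= ->].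
  rewrite [b]mx11_scalar mul_scalar_mx addrC; apply: Slin => //.
  by apply/MS/submxMl.
move/maxM; rewrite (geq_leqif (mxrank_leqif_sup (addsmxSl M w))) => leM.
by apply: submx_trans leM; apply: addsmxSr.
Qed.

Lemma eigenvector_in n (M h : 'M[k]_n) : M != 0 -> (M *m h <= M)%MS ->
  exists v c, [/\ v != 0 :> 'rV_n, (v <= M)%MS & v *m h = c *: v].
Proof.
move=> M0 Mh; set R := row_base M.
pose f := R *m h *m pinvmx R.
have Rh : R *m h = f *m R.
  rewrite mulmxKpV // eq_row_base; apply: submx_trans Mh.
  by apply: submxMr; rewrite eq_row_base.
have /closed_rootP[c] : size (char_poly f) != 1%N.
  by rewrite size_char_poly eqSS mxrank_eq0.
rewrite -eigenvalue_root_char => /eigenvalueP[u uf u0].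
exists (u *m R), c; split.
- apply: contraNneq u0 => uR0; apply/eqP.
  by apply: (row_free_inj (row_base_free M)); rewrite uR0 mul0mx.
- by rewrite -(eq_row_base M) submxMl.
- by rewrite -mulmxA Rh mulmxA uf scalemxAl.
Qed.

(** A common eigenvector, by induction on the derived length. The derived
    subgroup D acts by a character chi on a nonzero G-stable space M:
    conjugation by G moves chi within a finite set, the eigenvalues of an
    element of D, so it is constant by connectedness. Take M minimal. If v in M
    is an eigenvector of h for c, then v g is one for chi [g, h] c, so that
    again by connectedness chi [g, h] is its value at g = 1. Hence G acts on M
    by commuting operators, and, M being minimal, by scalars. *)
Lemma common_eigenvector n (G : set 'M[k]_n) d :
  (0 < n)%N -> subgroup G -> zconnected G ->
  iter d (@derived_subgroup k n) G `<=` [set 1%:M] ->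
  exists2 v : 'rV[k]_n, v != 0 & forall g, G g -> exists c, v *m g = c *: v.
Proof.
move=> n_gt0; elim: d G => [|d IHd] G sgG conG Gd.
  exists (const_mx 1) => [|g /Gd->]; last by exists 1; rewrite mulmx1 scale1r.
  by apply/eqP => /rowP/(_ (Ordinal n_gt0))/eqP; rewrite !mxE oner_eq0.
have sgD := derived_subgroupP sgG; set D := derived_subgroup G in sgD.
have [||v0 v0n0 v0D] := IHd D sgD; [exact: derived_connected|by move: Gd;
  rewrite iterSr|].
have [j v0j] : exists j, v0 0 j != 0.
  apply: contrapT => /forallNP v00; case/eqP: v0n0; apply/rowP => j.
  by rewrite mxE; apply/eqP/negP => /negP /v00.
pose chi x := (v0 *m x) 0 j * (v0 0 j)^-1.
have v0chi x : D x -> v0 *m x = chi x *: v0.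
  by move=> /v0D[c xc]; rewrite /chi xc mxE mulfK.
have Gunit := subgroup_unit sgG; have R := regular_ring G.
have [Rc RD RM] := R.
have reg_chi (F : 'M[k]_n -> 'M[k]_n) : entrywise (regular G) F ->
    regular G (fun g => chi (F g)).
  move=> rF; apply: RM; last exact: Rc.
  by apply: fring_mulmx => //; apply: fring_cstmx.
have reg_inv := regular_inverse sgG.
have eigen_root (x : 'M[k]_n) : exists rs : seq k,
    forall (v : 'rV[k]_n) c, v != 0 -> v *m x = c *: v -> c \in rs.
  have [rs] := closed_field_poly_normal (char_poly x).
  rewrite (monicP (char_poly_monic x)) scale1r => xrs; exists rs => v c nzv vx.
  rewrite -root_prod_XsubC -xrs -eigenvalue_root_char.
  by apply/eigenvalueP; exists v.
have chiJ g x : G g -> D x -> chi (g *m x *m invmx g) = chi x.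
  move=> Gg Dx; have [rs rsP] := eigen_root x.
  have := @zconnected_constant _ _ G (fun g => chi (g *m x *m invmx g)) rs conG.
  move=> /(_ _ _ g 1%:M Gg (subgroup1 sgG)) ->; last first.
  - move=> h Gh; apply: (rsP (v0 *m h)).
      apply: contraNneq v0n0 => v0h; apply/eqP.
      by apply: (can_inj (mulmxK (Gunit h Gh))); rewrite v0h mul0mx.
    rewrite scalemxAl -v0chi; last exact: derivedJ.
    by rewrite -!mulmxA mulVmx ?Gunit // mulmx1.
  - apply: reg_chi; apply: fring_mulmx => //; apply: fring_mulmx => //.
    exact: regular_entry.
  - by rewrite mul1mx invmx1 mulmx1.
have [W WP] : exists W : 'M[k]_n, forall w : 'rV[k]_n,
    (forall x, D x -> w *m x = chi x *: w) <-> (w <= W)%MS.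
  apply: subspace_mx => [x _|a u v uD vD x Dx]; first by rewrite mul0mx scaler0.
  rewrite mulmxDl -scalemxAl uD // vD // scalerDr !scalerA.
  by rewrite [a * _]mulrC.
pose stable (M : 'M[k]_n) := forall g, G g -> (M *m g <= M)%MS.
have Wstable : stable W.
  move=> g Gg; apply/row_subP => i; rewrite row_mul; apply/WP => x Dx.
  have /WP rowW := row_sub i W.
  rewrite -mulmxA -[g *m x](mulmxKV (Gunit g Gg)) mulmxA rowW;
    last exact: derivedJ.
  by rewrite chiJ // scalemxAl.
(* M is a nonzero G-stable subspace of W of minimal dimension. *)
pose P m := `[< exists M : 'M[k]_n, [/\ \rank M = m, M != 0,
  (M <= W)%MS & stable M] >].
have exP : exists m, P m.
  exists (\rank W); apply/asboolP; exists W; split=> //.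
  have /WP v0W := v0chi.
  by apply: contraNneq v0n0 => W0; rewrite W0 submx0 in v0W.
have [_ /asboolP[M [<- M0 MW Mstable]] minM] := ex_minnP exP.
have MD x (w : 'rV[k]_n) : D x -> (w <= M)%MS -> w *m x = chi x *: w.
  by move=> Dx wM; move: x Dx; apply/WP/(submx_trans wM).
have Mg (w : 'rV[k]_n) g : (w <= M)%MS -> G g -> (w *m g <= M)%MS.
  by move=> wM Gg; apply: submx_trans (Mstable g Gg); apply: submxMr.
have swap (w : 'rV[k]_n) g h : (w <= M)%MS -> G g -> G h ->
    w *m g *m h = chi (g *m h *m invmx g *m invmx h) *: (w *m h *m g).
  move=> wM Gg Gh; rewrite !scalemxAl -MD //; last exact: derivedR.
  by rewrite -!mulmxA mulKmx ?Gunit // mulVmx ?Gunit // mulmx1.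
have chiR g h : G g -> G h -> chi (g *m h *m invmx g *m invmx h) = 1.
  move=> Gg Gh; have [rs rsP] := eigen_root h.
  have [v [c [v1 vM vh]]] := eigenvector_in M0 (Mstable h Gh).
  have c0 : c != 0.
    apply: contraNneq v1 => c0; apply/eqP;
      apply: (can_inj (mulmxK (Gunit h Gh))).
    by rewrite vh c0 scale0r mul0mx.
  apply: (mulIf c0).
  have := @zconnected_constant _ _ G
    (fun g => chi (g *m h *m invmx g *m invmx h) * c) rs conG.
  move=> /(_ _ _ g 1%:M Gg (subgroup1 sgG)) ->; last first.
  - move=> g' Gg'; apply: (rsP (v *m g')).
      apply: contraNneq v1 => vg; apply/eqP.
      by apply: (can_inj (mulmxK (Gunit g' Gg'))); rewrite vg mul0mx.
    by rewrite swap // vh -!scalemxAl scalerA.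
  - apply: RM; last exact: Rc.
    apply: reg_chi; do 3!apply: fring_mulmx => //.
    exact: regular_entry.
  congr (_ * c); rewrite mul1mx invmx1 mulmx1 mulmxV ?Gunit //.
  by rewrite /chi mulmx1 mulfV.
exists (nz_row M) => [|h Gh]; first by rewrite nz_row_eq0.
have [v [c [v1 vM vh]]] := eigenvector_in M0 (Mstable h Gh); exists c.
apply/eigenspaceP; apply: submx_trans (nz_row_sub M) _.
suff: (M <= M :&: eigenspace h c)%MS by rewrite sub_capmx => /andP[].
have capM : (M :&: eigenspace h c <= M)%MS by apply: capmxSl.
rewrite -(geq_leqif (mxrank_leqif_sup capM)); apply: minM; apply/asboolP.
exists (M :&: eigenspace h c)%MS; split=> //.
- apply: contraNneq v1 => cap0; rewrite -submx0 -cap0 sub_capmx vM.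
  exact/eigenspaceP.
- exact: submx_trans MW.
- move=> g Gg; apply/row_subP => i; rewrite row_mul.
  have := row_sub i (M :&: eigenspace h c)%MS; rewrite !sub_capmx => /andP[rM].
  move=> /eigenspaceP rh; rewrite Mg //=; apply/eigenspaceP.
  by rewrite swap // chiR // scale1r rh scalemxAl.
Qed.

End Subgroups.

Section LieKolchin.
Variable k : closedFieldType.

Lemma conj_is_mult n (a : 'M[k]_n) : a \in unitmx ->
  multiplicative_on (GL k n) (fun g => a *m g *m invmx a).
Proof.
move=> Ua; split=> [|g Ug|g h _ _]; first by rewrite mulmx1 mulmxV.
  by rewrite !unitmx_mul Ua unitmx_inv Ua andbT.
by rewrite !mulmxA mulmxKV.
Qed.

(** By induction on n: a common eigenvector is the first vector of a flag of
    rows stable under G, and the induction hypothesis applies to the action of G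
    on the quotient by its line. *)
Theorem lie_kolchin n (G : set 'M[k]_n) :
  subgroup G -> zconnected G -> solvable_subgroup G ->
  exists2 a, a \in unitmx & forall g, G g -> is_trig_mx (a *m g *m invmx a).
Proof.
elim: n G => [|n IHn].
  move=> G _ _ _; exists 1%:M => [|g _]; first exact: unitmx1.
  by apply/is_trig_mxP; case.
change (forall G : set 'M[k]_(1 + n), subgroup G -> zconnected G ->
  solvable_subgroup G -> exists2 a : 'M[k]_(1 + n), a \in unitmx &
    forall g, G g -> is_trig_mx (a *m g *m invmx a)).
move=> G sgG conG solG.
have [d Gd] := solG.
have [v v0 vG] := common_eigenvector (ltn0Sn n) sgG conG Gd.
have Gunit := subgroup_unit sgG.
pose b : 'M[k]_(1 + n) := row_ebase v.
have Ub : b \in unitmx by apply: row_ebase_unit.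
pose e : 'rV[k]_(1 + n) := row_mx 1%:M 0.
have ev : exists2 c, c != 0 & v = c *: (e *m b).
  exists (col_ebase v 0 0).
    have := col_ebase_unit v; rewrite unitmxE det_mx11 unitfE; exact.
  rewrite -{1}(mulmx_ebase v) {1}[col_ebase v]mx11_scalar -mulmxA mul_scalar_mx.
  rewrite (_ : pid_mx _ = e) //; have -> : \rank v = 1%N.
    by apply/eqP; rewrite rank_rV v0.
  apply/rowP => j; rewrite /e !mxE; case: splitP => i ->; rewrite !mxE ?ord1 //.
have eb g : G g -> exists c, e *m (b *m g *m invmx b) = c *: e.
  move=> /vG[c vgc]; have [z z0 vE] := ev; exists c.
  have -> : e *m (b *m g *m invmx b) = (e *m b *m g) *m invmx b by rewrite
    !mulmxA.
  have -> : e *m b *m g = c *: (e *m b).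
    apply: (scalerI z0); rewrite [LHS]scalemxAl -vE vgc.
    by rewrite [in LHS]vE !scalerA mulrC.
  by rewrite -scalemxAl mulmxK.
have block g : G g -> exists c A B,
    b *m g *m invmx b = block_mx c 0 A B :> 'M_(1 + n).
  move=> Gg; have [c ec] := eb g Gg.
  exists (ulsubmx (b *m g *m invmx b)), (dlsubmx (b *m g *m invmx b)),
    (drsubmx (b *m g *m invmx b)).
  rewrite -[LHS]submxK; congr block_mx.
  move: ec; rewrite -{1}[b *m g *m invmx b]submxK mul_row_block.
  rewrite !mul1mx !mul0mx !addr0 scale_row_mx scaler0.
  by case/eq_row_mx.
have [c1 cU cM] := conj_is_mult Ub.
pose f g : 'M[k]_n := drsubmx (b *m g *m invmx b : 'M_(1 + n)).
have fG : multiplicative_on G f.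
  split=> [|g Gg|g h Gg Gh].
  - by rewrite /f c1 scalar_mx_block block_mxKdr.
  - have := cU g (Gunit g Gg); have [c [A [B gE]]] := block g Gg.
    rewrite /f gE block_mxKdr !unitmxE det_lblock unitrM.
    by case/andP.
  - rewrite /f cM; do ?exact: Gunit.
    have [c [A [B ->]]] := block g Gg; have [c' [A' [B' ->]]] := block h Gh.
    by rewrite mulmx_block !block_mxKdr mulmx0 add0r.
have [||| a Ua aP] := IHn (f @` G).
- exact: subgroup_image sgG fG.
- apply: zconnected_image conG => i j.
  have fE g : f g i j =
      (b *m g *m invmx b : 'M_(1 + n)) (rshift 1 i) (rshift 1 j).
    by rewrite /f mxE mxE.
  under eq_fun do rewrite fE.
  have R := regular_ring G; apply: fring_mulmx => //; last exact: fring_cstmx.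
  by apply: fring_mulmx; [|apply: fring_cstmx | apply: regular_entry].
- exact: solvable_image sgG fG solG.
pose a1 : 'M[k]_(1 + n) := block_mx 1%:M 0 0 a.
have Ublock : a1 \in unitmx.
  by rewrite unitmxE det_lblock det1 mul1r -unitmxE.
exists (a1 *m b) => [|g Gg]; first by rewrite unitmx_mul Ub andbT.
rewrite invmxM // (_ : invmx a1 = block_mx 1%:M 0 0 (invmx a)).
  rewrite -!mulmxA (mulmxA b) (mulmxA (b *m g)).
  have := aP (f g) (ex_intro2 _ _ g Gg erefl).
  rewrite /f; have [c [A [B ->]]] := block g Gg; rewrite block_mxKdr.
  rewrite /a1 !mulmx_block !mul1mx !mul0mx !mulmx0 !mulmx1 !addr0 !add0r =>
    trig.
  rewrite mulmxA is_trig_block_mx // eqxx trig andbT /=.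
  by apply/is_trig_mxP => i j; rewrite !ord1.
apply: (can_inj (mulKmx Ublock)); rewrite mulmxV //.
rewrite /a1 mulmx_block !mul1mx !mul0mx !mulmx0 !addr0 !add0r mulmxV //.
by rewrite scalar_mx_block.
Qed.

End LieKolchin.

(** * Matrices with prescribed support *)

Section Support.
Variables (k : closedFieldType) (r : nat).
Implicit Types (g h x y : 'M[k]_r) (R S : rel 'I_r).

Definition supported R : set 'M[k]_r := [set g | forall i j,
  g i j != 0 -> R i j].

Lemma supported0 R i j g : supported R g -> ~~ R i j -> g i j = 0.
Proof. by move=> Rg; apply: contraNeq => /Rg. Qed.

Lemma supported_sub R S g : subrel R S -> supported R g -> supported S g.
Proof. by move=> RS Rg i j /Rg/RS. Qed.

Lemma supported1 R : reflexive R -> supported R 1%:M.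
Proof.
move=> Rr i j; rewrite mxE.
by case: (eqVneq i j) => [->|_]; rewrite ?Rr // eqxx.
Qed.

Lemma supportedD R x y : supported R x -> supported R y -> supported R (x + y).
Proof.
move=> Rx Ry i j; apply: contraNT => nR.
by rewrite mxE (supported0 Rx nR) (supported0 Ry nR) addr0.
Qed.

Lemma supportedZ R c x : supported R x -> supported R (c *: x).
Proof.
move=> Rx i j; apply: contraNT => nR.
by rewrite mxE (supported0 Rx nR) mulr0.
Qed.

Lemma supportedB R x y : supported R x -> supported R y -> supported R (x - y).
Proof.
move=> Rx Ry; rewrite -scaleN1r; apply: supportedD => //; exact: supportedZ.
Qed.

Lemma supportedM R S (T : rel 'I_r) x y : (forall i j l,
  R i j -> S j l -> T i l) ->
  supported R x -> supported S y -> supported T (x *m y).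
Proof.
move=> RST Rx Sy i l; apply: contraNT => nT; rewrite mxE big1 // => j _.
apply: contraNeq nT; rewrite mulf_eq0 negb_or => /andP[/Rx Rij /Sy Sjl].
exact: RST Rij Sjl.
Qed.

(** For a preorder R, g is supported on R when it stabilizes the coordinate
    subspaces of the up-sets of R, which by finite dimension passes to the
    inverse. *)
Lemma supportedV R g : reflexive R -> transitive R ->
  g \in unitmx -> supported R g -> supported R (invmx g).
Proof.
move=> Rr Rt Ug Rg i j.
pose p : 'M[k]_r := diag_mx (\row_l (R i l)%:R).
have pE x a b : (p *m x) a b = (R i a)%:R * x a b.
  by rewrite mul_diag_mx !mxE.
have pE' x a b : (x *m p) a b = x a b * (R i b)%:R.
  by rewrite mul_mx_diag !mxE.
have pgp : p *m g = p *m g *m p.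
  apply/matrixP => a b; rewrite pE' pE.
  have [Ria|] := boolP (R i a); last by rewrite !mul0r.
  have [->|/Rg Rab] := eqVneq (g a b) 0; first by rewrite mulr0 mul0r.
  by rewrite (Rt _ _ _ Ria Rab) mulr1.
have pp : p *m p = p.
  apply/matrixP => a b; rewrite pE.
  have -> : p a b = (R i a)%:R *+ (a == b) by rewrite !mxE.
  by case: (R i a); rewrite ?mul1r ?mul0r ?mul0rn.
have sub : (p *m g <= p)%MS by rewrite pgp submxMl.
have : (p <= p *m g)%MS.
  by rewrite -(geq_leqif (mxrank_leqif_sup sub)) mxrankMfree // row_free_unit.
move=> /(submxMr (invmx g)); rewrite mulmxK // => /submxP[D pgD].
move=> nz; apply: contraNT nz => nR.
have := congr1 (fun x : 'M_r => x i j) (congr1 (mulmx^~ p) pgD).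
by rewrite /= -(mulmxA D) pp -pgD pE' !pE Rr mul1r (negPf nR) mulr0 => <-.
Qed.

Lemma supported_diagM R x y i : antisymmetric R ->
  supported R x -> supported R y -> (x *m y) i i = x i i * y i i.
Proof.
move=> Ra Rx Ry; rewrite mxE (bigD1 i) //= big1 ?addr0 // => j ji.
apply/eqP; rewrite mulf_eq0; apply: contraNT ji.
rewrite negb_or => /andP[/Rx Rij /Ry Rji].
by rewrite (Ra i j) ?eqxx // Rij.
Qed.

(** Block triangular and block diagonal shape, for the blocks that are the
    fibres of the level function l. *)
Definition below (l : 'I_r -> nat) : rel 'I_r := fun i j => (l j <= l i)%N.
Definition same (l : 'I_r -> nat) : rel 'I_r := fun i j => l i == l j.
Definition deeper (l : 'I_r -> nat) m : rel 'I_r := fun i j =>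
  (l j + m <= l i)%N.

Lemma below_refl l : reflexive (below l). Proof. by move=> i; apply: leqnn. Qed.
Lemma below_trans l : transitive (below l).
Proof. by move=> j i m ij jm; apply: leq_trans jm ij. Qed.
Lemma same_refl l : reflexive (same l). Proof. by move=> i; apply: eqxx. Qed.
Lemma same_trans l : transitive (same l).
Proof. by move=> j i m; rewrite /same => /eqP->. Qed.
Lemma same_below l : subrel (same l) (below l).
Proof. by move=> i j /eqP; rewrite /below => ->. Qed.
Lemma deeper0 l : deeper l 0 =2 below l.
Proof. by move=> i j; rewrite /deeper addn0. Qed.
Lemma deeper_below l m : subrel (deeper l m) (below l).
Proof. by move=> i j; apply: leq_trans; rewrite leq_addr. Qed.
Hint Resolve below_refl same_refl below_trans same_trans : core.

Definition lower : rel 'I_r := below val.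

Lemma is_trigP g : is_trig_mx g <-> supported lower g.
Proof.
split=> [/is_trig_mxP trig i j|low].
  by apply: contraNT; rewrite -ltnNge => /trig/eqP.
by apply/is_trig_mxP => i j ij; apply: (supported0 low); rewrite -ltnNge.
Qed.

Lemma lower_anti : antisymmetric lower.
Proof. by move=> i j; rewrite andbC -eqn_leq => /eqP/val_inj. Qed.

Lemma deeperM l a b c : (c <= a + b)%N -> forall x y,
  supported (deeper l a) x -> supported (deeper l b) y ->
  supported (deeper l c) (x *m y).
Proof.
move=> cab x y; apply: supportedM => i j m ji mj.
apply: leq_trans ji; rewrite addnC; apply: leq_trans (leq_add mj (leqnn a)).
by rewrite -addnA [(b + a)%N]addnC addnC leq_add2l.
Qed.

Lemma below_deeper l x : supported (below l) x <-> supported (deeper l 0) x.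
Proof. by split; apply: supported_sub => i j; rewrite deeper0. Qed.

(** The block triangular group for m = 0, its unipotent radical for m = 1. When
    the blocks have size 1, commutators of elements of depth m have depth m + 1,
    which is why triangular groups are solvable. *)
Definition congruence l m : set 'M[k]_r :=
  [set g | g \in unitmx /\ supported (deeper l m) (g - 1%:M)].

Lemma congruence_below l m g : congruence l m g -> supported (below l) g.
Proof.
case=> _ /(supported_sub (@deeper_below l m)) low.
by rewrite -(subrK 1%:M g); apply: supportedD low (supported1 (below_refl l)).
Qed.

Lemma congruence0 l g : g \in unitmx -> supported (below l) g -> congruence l
  0 g.
Proof.
move=> Ug low; split=> //; apply/below_deeper.
by apply: supportedB => //; apply: supported1.
Qed.

Lemma congruence_subgroup l m : subgroup (congruence l m).
Proof.
split=> [g [//]||g h Ug Uh|g Ug].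
- split; first exact: unitmx1.
  by move=> i j; rewrite subrr mxE eqxx.
- have [[ug sg] [uh sh]] := (Ug, Uh).
  split; first by rewrite unitmx_mul ug.
  have -> : g *m h - 1%:M = (g - 1%:M) *m h + (h - 1%:M).
    by rewrite mulmxBl mul1mx addrA subrK.
  apply: supportedD => //; apply: (deeperM (b := 0)) sg _;
    first by rewrite addn0.
  exact/below_deeper/(congruence_below Uh).
- have [ug sg] := Ug; split; first by rewrite unitmx_inv.
  have -> : invmx g - 1%:M = - 1 *: ((g - 1%:M) *m invmx g).
    by rewrite mulmxBl mulmxV // mul1mx scaleN1r opprB.
  apply: supportedZ; apply: (deeperM (b := 0)) sg _; first by rewrite addn0.
  by apply/below_deeper/supportedV => //; apply: congruence_below Ug.
Qed.

Lemma commutator_sub1 g h : g \in unitmx -> h \in unitmx ->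
  g *m h *m invmx g *m invmx h - 1%:M =
  (g *m h - h *m g) *m invmx (h *m g).
Proof.
move=> Ug Uh; rewrite mulmxBl mulmxV ?unitmx_mul ?Uh //.
by rewrite invmxM // !mulmxA.
Qed.

Lemma congruence_derived m :
  derived_subgroup (congruence val m) `<=` congruence val m.+1.
Proof.
move=> c; apply; first exact: congruence_subgroup.
move=> _ [g [h [Ug Uh ->]]].
have [[ug sg] [uh sh]] := (Ug, Uh).
have [lg lh] := (congruence_below Ug, congruence_below Uh).
split; first by rewrite !unitmx_mul !unitmx_inv ug uh.
rewrite commutator_sub1 //.
have : supported (deeper val m.+1) (g *m h - h *m g).
  case: m sg sh {Ug Uh} => [|m] sg sh; last first.
    have -> : g *m h - h *m g =
        (g - 1%:M) *m (h - 1%:M) - (h - 1%:M) *m (g - 1%:M).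
      rewrite !mulmxBl !mulmxBr !mul1mx !mulmx1.
      move: (g *m h) (h *m g) => A B.
      by apply/matrixP => i j; rewrite !mxE; ring.
    apply: supportedB; [apply: deeperM sg sh | apply: deeperM sh sg];
      by rewrite addSn ltnS leq_addl.
  move=> i j nz; rewrite /deeper addn1 ltn_neqAle.
  have lowgh : supported lower (g *m h - h *m g).
    have comp i' j' l' : lower i' j' -> lower j' l' -> lower i' l'.
      by move=> ij jl; apply: below_trans ij jl.
    by apply: supportedB;
      [apply: supportedM comp lg lh | apply: supportedM comp lh lg].
  have ji : lower i j by apply: lowgh.
  rewrite -[(j <= i)%N]/(lower i j) ji andbT.
  apply: contraNneq nz => /val_inj ->; rewrite mxE [X in _ + X]mxE.
  rewrite (supported_diagM i lower_anti lg lh).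
  by rewrite (supported_diagM i lower_anti lh lg) mulrC subrr.
move=> s; apply: (deeperM (b := 0)) s _; first by rewrite addn0.
apply/below_deeper/supportedV => //; first by rewrite unitmx_mul uh.
by apply: supportedM lh lg => i j l ij jl; apply: below_trans ij jl.
Qed.

Lemma lower_solvable : solvable_subgroup [set g |
  g \in unitmx /\ supported lower g].
Proof.
exists r => g.
have low m : iter m (@derived_subgroup k r)
    [set g | g \in unitmx /\ supported lower g] `<=` congruence val m.
  elim: m => [|m IHm] x; first by case=> Ux lx; apply: congruence0.
  by rewrite iterS => /(derived_mono IHm)/congruence_derived.
move=> /low[_ deep]; apply/eqP; rewrite -subr_eq0; apply/eqP/matrixP => i j.
rewrite [RHS]mxE; apply: (supported0 deep).
by rewrite /deeper -ltnNge (leq_trans (ltn_ord i)) // leq_addl.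
Qed.

(** This gives the uniqueness of the flag stabilized by a triangular group. A
    nonzero entry c i j with i < j would make the entries (y, q) of the inverse
    with y <= i < q vanish; then c, as the inverse of its inverse, would have no
    such entry either. *)
Lemma lower_selfconj c : c \in unitmx ->
  (forall x y : 'I_r, (y < x)%N ->
     supported lower (c *m (1%:M + delta_mx x y) *m invmx c)) ->
  supported lower c.
Proof.
move=> Uc Hc i j cij; rewrite /lower /below leqNgt; apply/negP => ij.
have zero (y q : 'I_r) : (y <= i)%N -> (i < q)%N -> invmx c y q = 0.
  move=> yi iq; have := Hc j y (leq_ltn_trans yi ij).
  rewrite mulmxDr mulmx1 mulmxDl mulmxV // => low.
  have := supported0 (i := i) (j := q) low; rewrite -ltnNge => /(_ iq).
  rewrite [LHS]mxE [1%:M _ _]mxE (ltn_eqF iq : (i == q) = false) add0r.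
  rewrite mxE (bigD1 y) //= big1 => [|z zy]; last first.
    rewrite mxE big1 ?mul0r // => w _.
    by rewrite mxE (negPf zy) andbF mulr0.
  rewrite addr0 mxE (bigD1 j) //= big1 => [|w wj]; last first.
    by rewrite mxE (negPf wj) mulr0.
  rewrite addr0 mxE !eqxx mulr1 => /eqP.
  by rewrite mulf_eq0 (negPf cij) => /eqP.
pose R : rel 'I_r := fun p q => (p <= i)%N ==> (q <= i)%N.
have Rr : reflexive R by move=> p; apply/implyP.
have Rt : transitive R.
  by move=> q p s /implyP pq /implyP qs; apply/implyP => /pq/qs.
have Uc' : invmx c \in unitmx by rewrite unitmx_inv.
have := supportedV Rr Rt Uc' _; rewrite invmxK => Rc.
have: R i j.
  apply: Rc cij => p q; apply: contraNT; rewrite negb_imply -ltnNge.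
  by case/andP=> pi iq; rewrite zero.
by rewrite /R leqnn /= leqNgt ij.
Qed.

End Support.

(** * Transvections *)

Section Transvections.
Variable k : closedFieldType.

Lemma separating n m (M : 'M[k]_(m, n)) (v : 'rV[k]_n) : ~~ (v <= M)%MS ->
  exists2 c : 'cV[k]_n, M *m c = 0 & v *m c = 1%:M.
Proof.
rewrite submxE => vM; have [j vj] : exists j, (v *m cokermx M) 0 j != 0.
  apply: contrapT => /forallNP v0; case/eqP: vM; apply/rowP => j.
  by rewrite [RHS]mxE; apply/eqP/negP => /negP/v0.
exists (((v *m cokermx M) 0 j)^-1 *: col j (cokermx M)).
  have Mcol : M *m col j (cokermx M) = 0.
    by rewrite colE mulmxA mulmx_coker mul0mx.
  by rewrite -scalemxAr Mcol scaler0.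
have vcol : v *m col j (cokermx M) = col j (v *m cokermx M).
  by rewrite !colE mulmxA.
rewrite -scalemxAr vcol; apply/matrixP => a b.
by rewrite !ord1 [LHS]mxE [X in _ * X]mxE mulVf // mxE.
Qed.

(** Every matrix of determinant 1 is a product of transvections: one clears the
    first column and the first row once the entry in their corner is 1, which
    one more transvection achieves as soon as the first column has another
    nonzero entry. *)
Lemma transvections_generate n (K : set 'M[k]_n) :
  (forall g h, K g -> K h -> K (g *m h)) ->
  (forall (v : 'cV_n) (phi : 'rV_n), phi *m v = 0 -> K (1%:M + v *m phi)) ->
  forall g, \det g = 1 -> K g.
Proof.
elim: n K => [|n IHn].
  move=> K _ Kt g _; have := Kt 0 0 (mul0mx _ _).
  by congr K; apply/matrixP; case.
change (forall K : set 'M[k]_(1 + n),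
  (forall g h, K g -> K h -> K (g *m h)) ->
  (forall (v : 'cV_(1 + n)) (phi : 'rV_(1 + n)),
     phi *m v = 0 -> K (1%:M + v *m phi)) ->
  forall g : 'M_(1 + n), \det g = 1 -> K g).
move=> K KM Kt.
have Kblock g : \det g = 1 -> K (block_mx 1%:M 0 0 g : 'M_(1 + n)).
  apply: (IHn [set g | K (block_mx 1%:M 0 0 g : 'M_(1 + n))]) => {g}
    [g h Kg Kh|v phi phiv] /=.
    have := KM _ _ Kg Kh; rewrite mulmx_block.
    by rewrite !mul1mx !mul0mx !mulmx0 !addr0 add0r.
  have := Kt (col_mx 0 v) (row_mx 0 phi).
  rewrite mul_row_col mul0mx add0r => /(_ phiv).
  by rewrite mul_col_row !mul0mx !mulmx0 scalar_mx_block add_block_mx !(addr0,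
    add0r).
have Kdown (c : 'cV_n) : K (block_mx 1%:M 0 c 1%:M : 'M_(1 + n)).
  have := Kt (col_mx 0 c) (row_mx 1%:M 0).
  rewrite mul_row_col mulmx0 mul0mx addr0 => /(_ erefl).
  by rewrite mul_col_row !mul0mx !mulmx0 mulmx1 scalar_mx_block add_block_mx
    !(addr0, add0r).
have Kright (b : 'rV_n) : K (block_mx 1%:M b 0 1%:M : 'M_(1 + n)).
  have := Kt (col_mx 1%:M 0) (row_mx 0 b).
  rewrite mul_row_col mulmx0 mul0mx addr0 => /(_ erefl).
  by rewrite mul_col_row !mul0mx !mulmx0 mul1mx scalar_mx_block add_block_mx
    !(addr0, add0r).
have Kone (b : 'rV_n) (c : 'cV_n) d :
    \det (block_mx 1%:M b c d : 'M_(1 + n)) = 1 ->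
    K (block_mx 1%:M b c d : 'M_(1 + n)).
  have -> : block_mx 1%:M b c d = (block_mx 1%:M 0 c 1%:M : 'M_(1 + n)) *m
      block_mx 1%:M 0 0 (d - c *m b) *m block_mx 1%:M b 0 1%:M.
    rewrite !mulmx_block !mul1mx !mul0mx !mulmx0 !mulmx1 !addr0 !add0r.
    by rewrite mul1mx addrC subrK.
  rewrite !det_mulmx !det_lblock det_ublock !det1 !mul1r !mulr1 => detd.
  by apply: (KM) => //; apply: (KM) => //; apply: Kblock.
have Kcol g : \det g = 1 -> dlsubmx g != 0 :> 'cV_n -> K g.
  move=> detg c0; have [i ci] : exists i, dlsubmx g i 0 != 0.
    apply: contrapT => /forallNP cz; case/eqP: c0; apply/colP => i.
    by rewrite [RHS]mxE; apply/eqP/negP => /negP/cz.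
  pose b : 'rV[k]_n := ((1 - ulsubmx g 0 0) / dlsubmx g i 0) *: delta_mx 0 i.
  have -> : g = (block_mx 1%:M (- b) 0 1%:M : 'M_(1 + n)) *m
      ((block_mx 1%:M b 0 1%:M : 'M_(1 + n)) *m g).
    rewrite mulmxA mulmx_block !mul1mx !mul0mx !mulmx0 !mulmx1 !addr0 !add0r.
    by rewrite subrr -scalar_mx_block mul1mx.
  apply: KM => //; have : \det ((block_mx 1%:M b 0 1%:M : 'M_(1 + n)) *m g) = 1.
    by rewrite det_mulmx detg det_ublock !det1 !mulr1.
  rewrite -{1 2}[g]submxK mulmx_block.
  set ul := 1%:M *m _ + _; suff -> : ul = 1%:M by apply: Kone.
  apply/matrixP => x y; rewrite !ord1 /ul mul1mx -scalemxAl -rowE.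
  rewrite [LHS]mxE [X in _ + X]mxE [X in _ * X]mxE divfK //.
  by rewrite addrC subrK mxE.
move=> g detg; have [c0|] := eqVneq (dlsubmx g : 'cV_n) 0; last exact: Kcol.
have a0 : ulsubmx g 0 0 != 0.
  apply: contra_eq_neq detg => a0; rewrite -[g]submxK c0 det_ublock det_mx11 a0.
  by rewrite mul0r eq_sym oner_eq0.
have [n0|n_gt0] := posnP n.
  rewrite -[g]submxK; move: detg; rewrite -{1}[g]submxK c0 det_ublock.
  rewrite (_ : \det (drsubmx g) = 1); last first.
    by move: (drsubmx g); rewrite n0 => B; rewrite det_mx00.
  rewrite mulr1 det_mx11 => ul1; have -> : ulsubmx g = 1%:M.
    by rewrite [LHS]mx11_scalar ul1.
  apply: Kone; rewrite det_ublock det1 mul1r.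
  by move: (drsubmx g); rewrite n0 => B; rewrite det_mx00.
pose c : 'cV[k]_n := const_mx 1.
have -> : g = (block_mx 1%:M 0 (- c) 1%:M : 'M_(1 + n)) *m
    ((block_mx 1%:M 0 c 1%:M : 'M_(1 + n)) *m g).
  rewrite mulmxA mulmx_block !mul1mx !mul0mx !mulmx0 !mulmx1 !addr0 !add0r.
  by rewrite addrC subrr -scalar_mx_block mul1mx.
apply: KM => //; apply: Kcol.
  by rewrite det_mulmx detg det_lblock !det1 !mulr1.
rewrite -[g]submxK mulmx_block block_mxKdl c0 mulmx0 addr0.
rewrite [ulsubmx g]mx11_scalar mul_mx_scalar.
apply/eqP => /colP/(_ (Ordinal n_gt0))/eqP.
by move: (ulsubmx g 0 0) a0 => u u0; rewrite !mxE mulr1 (negPf u0).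
Qed.

(** All the roots of the characteristic polynomial vanish. *)
Lemma mxtrace_nilpotent n (N : 'M[k]_n) m : N ^+ m = 0 -> \tr N = 0.
Proof.
case: n N => [|n] N N0; first by rewrite /mxtrace big_ord0.
have [rs rsE] := closed_field_poly_normal (char_poly N).
move: rsE; rewrite (monicP (char_poly_monic N)) scale1r => charE.
have rs0 z : z \in rs -> z = 0.
  rewrite -root_prod_XsubC -charE -eigenvalue_root_char =>
    /eigenvalueP[v vN v0].
  have vNm j : v *m (N ^+ j) = z ^+ j *: v.
    elim: j => [|j IHj]; first by rewrite mulmx1 scale1r.
    by rewrite exprS mulmxA vN -scalemxAl IHj scalerA -exprS.
  have /esym/eqP := vNm m; rewrite N0 mulmx0 scaler_eq0 (negPf v0) orbF.
  by rewrite expf_eq0 => /andP[_ /eqP].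
have := @char_poly_trace _ _ N (ltn0Sn n).
rewrite charE (eq_big_seq (fun=> 'X)); last by move=> z /rs0 ->; rewrite subr0.
rewrite big_const_seq count_predT iter_mulr_1.
have -> : size rs = n.+1.
  by have := size_char_poly N; rewrite charE size_prod_XsubC => -[].
rewrite coefXn (ltn_eqF (ltnSn n)) => /esym/eqP; rewrite oppr_eq0.
by move/eqP.
Qed.

End Transvections.

(** * The automorphism sigma in characteristic 2 *)

Section Characteristic2.
Variables (k : closedFieldType).
Hypothesis char2 : 2%N \in [pchar k].

Lemma addxx (x : k) : x + x = 0. Proof. exact: addrr_pchar2. Qed.

Lemma addmm m n (A : 'M[k]_(m, n)) : A + A = 0.
Proof. by apply/matrixP => i j; rewrite !mxE addxx. Qed.

Lemma oppm m n (A : 'M[k]_(m, n)) : - A = A.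
Proof. by apply/esym/eqP; rewrite -addr_eq0 addmm. Qed.

Lemma sqr_inj (x y : k) : x ^+ 2 = y ^+ 2 -> x = y.
Proof.
move/eqP; rewrite eqf_sqr (oppr_pchar2 char2) orbb; exact: eqP.
Qed.

Lemma exp2_inj m (x y : k) : x ^+ (2 ^ m) = y ^+ (2 ^ m) -> x = y.
Proof.
elim: m x y => [|m IHm] x y; first by rewrite !expr1.
by rewrite expnS !exprM => /IHm/sqr_inj.
Qed.

Lemma root_exists m (x : k) : (0 < m)%N -> exists y, y ^+ m = x.
Proof.
move=> m0; have [y] := solve_monicpoly (fun i => if i == 0%N then x else 0) m0.
case: m m0 => // m _; rewrite big_ord_recl big1 => [|i _] /=.
  by rewrite expr0 mulr1 addr0; exists y.
by rewrite mul0r.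
Qed.

Lemma exp2_sub1 n (A : 'M[k]_n) m : (A - 1) ^+ (2 ^ m) = A ^+ (2 ^ m) - 1.
Proof.
elim: m => [|m IHm]; first by rewrite !expr1.
rewrite expnSr !exprM IHm; set B := A ^+ _.
rewrite !(oppm (1%:M : 'M[k]_n)) !expr2 mulrDl !mulrDr !mulr1 !mul1r.
by rewrite addrA -(addrA (B * B)) addmm addr0.
Qed.

Lemma unipotent_exp2 n (A : 'M[k]_n) :
  (exists m, (A - 1%:M) ^+ m = 0) <-> exists m, A ^+ (2 ^ m) = 1%:M.
Proof.
split=> [[m Am]|[m Am]]; last by exists (2 ^ m)%N; rewrite exp2_sub1 Am subrr.
exists m; apply/eqP; rewrite -subr_eq0 -exp2_sub1.
by rewrite -(subnK (ltnW (ltn_expl m (ltnSn 1)))) exprD Am mulr0.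
Qed.

Lemma mulmx1_add n (v : 'cV[k]_n) (phi : 'rV[k]_n) : phi *m v = 0 ->
  (1%:M + v *m phi) *m (1%:M + v *m phi) = 1%:M.
Proof.
move=> phiv; rewrite mulmxDl !mulmxDr !mul1mx !mulmx1.
rewrite mulmxA -(mulmxA v phi v) phiv mulmx0 mul0mx addr0.
by rewrite -addrA addmm addr0.
Qed.

Lemma transvection_unit n (v : 'cV[k]_n) (phi : 'rV[k]_n) : phi *m v = 0 ->
  1%:M + v *m phi \in unitmx.
Proof. by move/mulmx1_add/mulmx1_unit => []. Qed.

Lemma transvectionV n (v : 'cV[k]_n) (phi : 'rV[k]_n) : phi *m v = 0 ->
  invmx (1%:M + v *m phi) = 1%:M + v *m phi.
Proof.
move=> phiv; apply: (can_inj (mulKmx (transvection_unit phiv))).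
by rewrite mulmxV ?transvection_unit // mulmx1_add.
Qed.

Lemma transvection_det n (v : 'cV[k]_n) (phi : 'rV[k]_n) : phi *m v = 0 ->
  \det (1%:M + v *m phi) = 1.
Proof.
move/mulmx1_add/(congr1 determinant); rewrite det_mulmx det1 => det2.
by apply: sqr_inj; rewrite expr2 det2 expr1n.
Qed.

Section Sigma.
Variable r : nat.
Local Notation J := (sigmaJ k r).
Implicit Types g h : 'M[k]_r.

Lemma rev_ordE (i j : 'I_r) : ((i + j).+1 == r)%N = (j == rev_ord i).
Proof.
rewrite -val_eqE /=; move: (val i) (val j) (ltn_ord i) => a b ar.
by rewrite -addSn -{1}(subnKC ar) eqn_add2l.
Qed.

Lemma sigmaJE i j : J i j = (j == rev_ord i)%:R.
Proof. by rewrite mxE rev_ordE; case: eqP => //;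
  rewrite (oppr_pchar2 char2) if_same. Qed.

Lemma mulJmx n (A : 'M[k]_(r, n)) i j : (J *m A) i j = A (rev_ord i) j.
Proof.
rewrite mxE (bigD1 (rev_ord i)) //= sigmaJE eqxx mul1r big1 ?addr0 // => l li.
by rewrite sigmaJE (negPf li) mul0r.
Qed.

Lemma trJ : J^T = J.
Proof.
apply/matrixP => i j; rewrite mxE !sigmaJE; congr (_%:R).
by rewrite -(inj_eq rev_ord_inj) rev_ordK eq_sym.
Qed.

Lemma mulmxJ n (A : 'M[k]_(n, r)) i j : (A *m J) i j = A i (rev_ord j).
Proof. by rewrite -[A *m J]trmxK trmx_mul trJ mxE mulJmx mxE. Qed.

Lemma mulJJ : J *m J = 1%:M.
Proof. by apply/matrixP => i j; rewrite mulJmx sigmaJE rev_ordK mxE eq_sym. Qed.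

Lemma unitJ : J \in unitmx. Proof. by have [] := mulmx1_unit mulJJ. Qed.

Lemma invJ : invmx J = J.
Proof. by apply: (can_inj (mulKmx unitJ)); rewrite mulmxV ?unitJ // mulJJ. Qed.

Lemma sigma_autE g i j : sigma_aut g i j = invmx g (rev_ord j) (rev_ord i).
Proof. by rewrite /sigma_aut invJ mulmxJ mulJmx mxE. Qed.

Lemma sigma_aut_mult : multiplicative_on (GL k r) (@sigma_aut k r).
Proof.
split=> [|g Ug|g h Ug Uh]; rewrite /sigma_aut.
- by rewrite invmx1 trmx1 mulmx1 mulmxV ?unitJ.
- by rewrite !unitmx_mul unitJ unitmx_inv unitJ unitmx_tr unitmx_inv Ug.
- by rewrite invmxM // trmx_mul !mulmxA mulmxKV ?unitJ.
Qed.

Lemma sigma_autV g : g \in unitmx -> sigma_aut (invmx g) = J *m g^T *m J.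
Proof. by move=> Ug; rewrite /sigma_aut invmxK invJ. Qed.

Lemma sigma_autK g : g \in unitmx -> sigma_aut (sigma_aut g) = g.
Proof.
move=> Ug; rewrite {1}/sigma_aut -(morphV (subgroup_GL k r) sigma_aut_mult) //.
rewrite sigma_autV // !trmx_mul trmxK !trJ invJ !mulmxA mulJJ mul1mx.
by rewrite -mulmxA mulJJ mulmx1.
Qed.

Lemma sigma_aut_det g : \det (sigma_aut g) = (\det g)^-1.
Proof.
rewrite /sigma_aut invJ !det_mulmx det_tr det_inv mulrAC -det_mulmx mulJJ.
by rewrite det1 mul1r.
Qed.

Lemma sigma_aut_fixed g : g \in unitmx ->
  sigma_aut g = g <-> g^T *m J *m g = J.
Proof.
move=> Ug; split=> [fixg|gJg].
  have := sigma_autV Ug.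
  rewrite (morphV (subgroup_GL k r) sigma_aut_mult) // fixg => gV.
  have : J *m (J *m g^T *m J) *m g = J.
    by rewrite -gV -mulmxA mulVmx // mulmx1.
  by rewrite !mulmxA mulJJ mul1mx.
have gV : sigma_aut (invmx g) = invmx g.
  have gVg : J *m g^T *m J *m g = 1%:M.
    by rewrite -!mulmxA (mulmxA g^T) gJg mulJJ.
  by rewrite sigma_autV // -[LHS](mulmxK Ug) gVg mul1mx.
have Ug' : invmx g \in unitmx by rewrite unitmx_inv.
rewrite -[in LHS](invmxK g).
by rewrite (morphV (subgroup_GL k r) sigma_aut_mult) // gV invmxK.
Qed.

Lemma scalar11_eq0 (c : k) : (c%:M == 0 :> 'M_1) = (c == 0).
Proof.
apply/eqP/eqP => [/matrixP/(_ 0 0)|->]; last exact: raddf0.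
by rewrite !mxE eqxx mulr1n.
Qed.

(** The isotropic vectors meet their orthogonal trivially: e_j with j away from
    the middle is isotropic, and detects the mirror coordinate of f; a vector
    with only a middle coordinate is not isotropic. *)
Lemma isotropic_pairing (f : 'cV[k]_r) : f != 0 -> f^T *m J *m f = 0 ->
  exists2 u : 'cV[k]_r, u^T *m J *m u = 0 & u^T *m J *m f != 0.
Proof.
move=> f0 ff; have [i fi] : exists i, f i 0 != 0.
  apply: contrapT => /forallNP fz; case/eqP: f0; apply/colP => i.
  by rewrite [RHS]mxE; apply/eqP/negP => /negP/fz.
have deltaE (h : 'cV[k]_r) j : (delta_mx j 0 : 'cV[k]_r)^T *m J *m h =
    (h (rev_ord j) 0)%:M.
  rewrite trmx_delta -mulmxA -rowE; apply/matrixP => a b.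
  by rewrite !ord1 mxE mulJmx mxE.
have [[j [fj rj]]|fixed] :=
  pselect (exists j, f j 0 != 0 /\ rev_ord j != j).
  exists (delta_mx (rev_ord j) 0).
    by apply/eqP; rewrite deltaE rev_ordK scalar11_eq0 mxE [j == _]eq_sym
      (negPf rj) eqxx.
  by rewrite deltaE rev_ordK scalar11_eq0.
have fix_eq j : f j 0 != 0 -> rev_ord j = j.
  by move=> fj; apply/eqP/negP => /negP rj; apply: fixed; exists j.
move/matrixP/(_ 0 0): ff;
  rewrite -mulmxA [RHS]mxE mxE (bigD1 i) //= big1 ?addr0 => [|j ji].
  by rewrite mulJmx mxE fix_eq // => /eqP; rewrite mulf_eq0 orbb (negPf fi).
have [fj|/eqP] := boolP (f j 0 == 0); first by rewrite mxE (eqP fj) mul0r.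
move=> /eqP fj; case/eqP: ji; apply: val_inj.
have mid l : f l 0 != 0 -> (l + l).+1 = r.
  by move=> fl; apply/eqP; rewrite rev_ordE fix_eq.
by apply/double_inj; rewrite -!addnn; apply: succn_inj; rewrite !mid.
Qed.

Lemma conj_transvection (g : 'M[k]_r) (v : 'cV[k]_r) (phi : 'rV[k]_r) :
  g \in unitmx -> g *m (1%:M + v *m phi) *m invmx g =
  1%:M + (g *m v) *m (phi *m invmx g).
Proof.
by move=> Ug; rewrite mulmxDr mulmx1 mulmxDl mulmxV // !mulmxA.
Qed.

(** The vectors v all of whose transvections are in K form a K-stable subspace
    V that contains f. If V were proper, its orthogonal for the form J, which is
    nonzero and, K being stable under sigma, also K-stable, would contain f too,
    because it is moved by the transvections of f. So f would be isotropic and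
    u^T J f nonzero for some isotropic u; but then the transvection of u in K
    carries f into f + c u with c nonzero, whence u is in V, and u^T J f = 0. *)
Lemma transvections_in (K : set 'M[k]_r) (f : 'cV[k]_r) :
  subgroup K -> (forall g, K g -> K (sigma_aut g)) -> f != 0 ->
  (forall phi : 'rV_r, phi *m f = 0 -> K (1%:M + f *m phi)) ->
  (forall u : 'cV_r, u^T *m J *m u = 0 -> K (1%:M + u *m (u^T *m J))) ->
  forall (v : 'cV_r) (phi : 'rV_r), phi *m v = 0 -> K (1%:M + v *m phi).
Proof.
move=> sgK sigK f0 Kf Ku; have Kunit := subgroup_unit sgK.
pose full (v : 'cV[k]_r) := forall phi : 'rV_r,
  phi *m v = 0 -> K (1%:M + v *m phi).
have fullZ c v : full v -> full (c *: v).
  move=> fv phi phiv; have [c0|c0] := eqVneq c 0.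
    by rewrite c0 scale0r mul0mx addr0; apply: subgroup1.
  rewrite -scalemxAl scalemxAr; apply: fv; rewrite -scalemxAl scalemxAr //.
have fullK g v : K g -> full v -> full (g *m v).
  move=> Kg fv phi phigv.
  have -> : 1%:M + g *m v *m phi = g *m (1%:M + v *m (phi *m g)) *m invmx g.
    by rewrite conj_transvection ?Kunit // mulmxK ?Kunit.
  by apply: (subgroupJ sgK) => //; apply: fv; rewrite -mulmxA.
have fullD v w : full v -> full w -> full (v + w).
  move=> fv fw; have [/submxP[D vD]|] := boolP (v^T <= w^T)%MS.
    suff -> : v = D 0 0 *: w by rewrite -{2}[w]scale1r -scalerDl; apply: fullZ.
    by rewrite -[v]trmxK vD [D]mx11_scalar mul_scalar_mx linearZ /= trmxK !mxE
      mulr1n.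
  case/separating => c wc vc.
  have cw : c^T *m w = 0 by rewrite -[w]trmxK -trmx_mul wc trmx0.
  have cv : c^T *m v = 1%:M by rewrite -[v]trmxK -trmx_mul vc trmx1.
  have -> : v + w = (1%:M + w *m c^T) *m v.
    by rewrite mulmxDl mul1mx -mulmxA cv mulmx1.
  by apply: fullK => //; apply: fw.
suff fullT v : full v by move=> v phi; apply: fullT.
have full0 : full 0.
  by move=> phi _; rewrite mul0mx addr0; apply: subgroup1.
have [W WP] : exists W : 'M[k]_r, forall w : 'rV[k]_r, full w^T <-> (w <= W)%MS.
  apply: subspace_mx => [|a x y fx fy]; first by rewrite trmx0.
  by rewrite linearP /=; apply: fullD => //; apply: fullZ.
apply: contrapT => nfv; have /negP : ~ (v^T <= W)%MS.
  by move/WP; rewrite trmxK.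
case/separating => c Wc vc.
pose perp (z : 'cV[k]_r) := forall w, full w -> w^T *m J *m z = 0.
pose z := J *m c.
have perpz : perp z.
  move=> w fw; rewrite /z mulmxA -[w^T *m J *m J]mulmxA mulJJ mulmx1.
  have /WP/submxP[D ->] : full (w^T)^T by rewrite trmxK.
  by rewrite -mulmxA Wc mulmx0.
have z0 : z != 0.
  apply/eqP => zz; have : v^T *m (J *m (J *m c)) = 0 by rewrite -/z zz !mulmx0.
  rewrite !mulmxA -[v^T *m J *m J]mulmxA mulJJ mulmx1 vc => /eqP.
  by rewrite scalar11_eq0 oner_eq0.
have perpK g y : K g -> perp y -> perp (g *m y).
  move=> Kg py w fw.
  have Kg' : K (sigma_aut (invmx g)) by apply: sigK; apply: (subgroupV sgK).
  have := py _ (fullK _ _ Kg' fw); rewrite sigma_autV ?Kunit //.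
  rewrite !trmx_mul trmxK !trJ -!mulmxA => <-.
  by rewrite (mulmxA J J) mulJJ mul1mx.
have perpf : perp f.
  have [/submxP[D zD]|] := boolP (z^T <= f^T)%MS.
    have zE : z = D 0 0 *: f.
      by rewrite -[z]trmxK zD {1}[D]mx11_scalar mul_scalar_mx linearZ /= trmxK.
    have D0 : D 0 0 != 0 by apply: contraNneq z0 => D0; rewrite zE D0 scale0r.
    move=> w /perpz; rewrite zE -scalemxAr => /eqP.
    by rewrite scaler_eq0 (negPf D0) => /eqP.
  case/separating => d fd zd.
  have df : d^T *m f = 0 by rewrite -[f]trmxK -trmx_mul fd trmx0.
  have dz : d^T *m z = 1%:M by rewrite -[z]trmxK -trmx_mul zd trmx1.
  move=> w fw; have := perpK _ _ (Kf _ df) perpz w fw.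
  have -> : (1%:M + f *m d^T) *m z = z + f.
    by rewrite mulmxDl mul1mx -mulmxA dz mulmx1.
  by rewrite mulmxDr perpz // add0r.
have [u uu uf] := isotropic_pairing f0 (perpf f Kf).
have : full ((1%:M + u *m (u^T *m J)) *m f).
  by apply: fullK => //; apply: Ku.
rewrite mulmxDl mul1mx -mulmxA [u^T *m J *m f]mx11_scalar mul_mx_scalar.
set d := (_ *m _) 0 0 => fud; have fu : full u.
  have d0 : d != 0.
    by rewrite -scalar11_eq0 /d -mx11_scalar.
  have : full (d^-1 *: (f + d *: u - f)).
    apply: (fullZ); apply: (fullD); last by rewrite -scaleN1r; apply: fullZ.
    exact: fud.
  by rewrite addrC addrA addNr add0r scalerA mulVf // scale1r.
by case/eqP: uf; apply: perpf.
Qed.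

End Sigma.
End Characteristic2.

(** * Borel subgroups of central quotients *)

Section CentralQuotient.
Variable k : closedFieldType.

Definition det_subgroup r (Q : k -> Prop) : set 'M[k]_r :=
  [set g | g \in unitmx /\ Q (\det g)].

(** The condition on lines makes the group rationally connected: it allows the
    determinant to be joined to 1. *)
Record det_condition (Q : k -> Prop) : Prop := DetCondition {
  det_condition1 : Q 1;
  det_conditionM : forall a b, Q a -> Q b -> Q (a * b);
  det_conditionV : forall a, Q a -> Q a^-1;
  det_condition_line : forall a s,
    Q a -> 1 + s * (a - 1) != 0 -> Q (1 + s * (a - 1)) }.

(** The common features of GL, SL and PGL as groups rho(H) with H in GL defined
    by a condition on the determinant. The boolean scal tells whether rho kills
    the scalars or is injective. By central_push and central_closed, rho is a
    closed map on H as far as saturated sets are concerned, and central_pull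
    expresses that the kernel is connected. *)
Record central_quotient r n (rho : 'M[k]_r -> 'M[k]_n) (Q : k -> Prop)
    (scal : bool) : Prop := CentralQuotient {
  central_det : det_condition Q;
  central_mult : multiplicative_on (GL k r) rho;
  central_ker : forall g h, g \in unitmx -> h \in unitmx ->
    rho g = rho h <-> exists c, [/\ c != 0, scal || (c == 1) & g = c *: h];
  central_regular : entrywise (regular (GL k r)) rho;
  central_push : forall Z : set 'M[k]_r, zclosed Z ->
    (forall g c, g \in unitmx -> c != 0 -> scal || (c == 1) ->
       Z g -> Z (c *: g)) ->
    exists2 Z', zclosed Z' & forall g, g \in unitmx -> Z' (rho g) <-> Z g;
  central_closed :
    exists2 Y, zclosed Y & rho @` det_subgroup Q = GL k n `&` Y;
  central_pull : forall B, B `<=` rho @` det_subgroup Q ->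
    zconnected B -> zconnected [set g | det_subgroup Q g /\ B (rho g)];
  central_diag : forall g, g \in unitmx -> is_diag_mx g -> is_diag_mx (rho g) }.

Lemma det_conj r (a g : 'M[k]_r) : a \in unitmx ->
  \det (a *m g *m invmx a) = \det g.
Proof.
by move=> Ua; rewrite !det_mulmx det_inv mulrC mulKf // -unitfE -unitmxE.
Qed.

Lemma zclosed_supported r (R : rel 'I_r) : zclosed (supported (k := k) R).
Proof.
have -> : supported (k := k) R =
    [set g | forall p, ~~ R p.1 p.2 -> g p.1 p.2 = 0].
  apply/seteqP; split=> g /= Rg.
    by move=> p nR; apply: supported0 nR.
  by move=> i j; apply: contraNT => nR; apply/eqP/(Rg (i, j)).
apply: zclosed_bigcap => p _.
by apply: (zclosed_zero (f := fun g => g p.1 p.2)); apply: polyfun_entry.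
Qed.

Lemma zclosed_pattern r (R : rel 'I_r) (a : 'M[k]_r) :
  zclosed [set g : 'M[k]_r | supported R (a *m g *m invmx a)].
Proof.
apply: (zclosed_preimage (F := fun g => a *m g *m invmx a)); last first.
  exact: zclosed_supported.
have P := polyfun_ring k r; apply: fring_mulmx => //; last exact: fring_cstmx.
by apply: fring_mulmx; [|exact: fring_cstmx|exact: polyfun_entry].
Qed.

Variables (r n : nat) (rho : 'M[k]_r -> 'M[k]_n) (Q : k -> Prop) (scal : bool).
Hypothesis rhoP : central_quotient rho Q scal.
Hypothesis r_gt0 : (0 < r)%N.
Local Notation H := (@det_subgroup r Q).
Implicit Types g h : 'M[k]_r.

Lemma det_subgroupP : subgroup H.
Proof.
have [Q1 QM QV _] := central_det rhoP.
split=> [g []||g h [Ug Qg] [Uh Qh]|g [Ug Qg]] //.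
- by split; [exact: unitmx1 | rewrite det1].
- by split; [rewrite unitmx_mul Ug | rewrite det_mulmx; apply: QM].
- by split; [rewrite unitmx_inv | rewrite det_inv; apply: QV].
Qed.

Lemma det_subgroup_unit g : H g -> g \in unitmx. Proof. by case. Qed.

Lemma det_subgroup_SL g : \det g = 1 -> H g.
Proof.
have [Q1 _ _ _] := central_det rhoP.
by move=> g1; split; [rewrite unitmxE g1 unitr1 | rewrite g1].
Qed.

Lemma det_subgroup_eqdet g h : g \in unitmx -> \det g = \det h -> H h -> H g.
Proof. by move=> Ug gh [_ Qh]; split; rewrite ?gh. Qed.

Lemma det_subgroupJ a g : a \in unitmx -> H g -> H (a *m g *m invmx a).
Proof.
move=> Ua Hg; have Ug := det_subgroup_unit Hg.
apply: det_subgroup_eqdet Hg; first by rewrite !unitmx_mul unitmx_inv Ua Ug.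
exact: det_conj.
Qed.

Lemma rhoZ c g : c != 0 -> scal || (c == 1) -> g \in unitmx ->
  rho (c *: g) = rho g.
Proof.
move=> c0 sc Ug; apply/(central_ker rhoP) => //; last by exists c.
by rewrite unitmxZ // unitfE.
Qed.

Lemma rho_mult : multiplicative_on H rho.
Proof. by apply: morph_sub (central_mult rhoP) => g []. Qed.

Lemma rhoM g h : g \in unitmx -> h \in unitmx -> rho (g *m h) = rho g *m rho h.
Proof. by have [_ _ rM] := central_mult rhoP; apply: rM. Qed.

Lemma rhoV g : g \in unitmx -> rho (invmx g) = invmx (rho g).
Proof. exact: (morphV (subgroup_GL k r) (central_mult rhoP)). Qed.

Lemma image_subgroup X : X `<=` H -> subgroup X -> subgroup (rho @` X).
Proof. by move=> XH sgX; apply: subgroup_image sgX (morph_sub XH rho_mult). Qed.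

(** Here Z cuts out the saturation of X under the kernel of rho. *)
Lemma closed_image X Z : X `<=` H -> subgroup X -> zclosed Z ->
  (forall g c, g \in unitmx -> c != 0 -> scal || (c == 1) ->
     Z g -> Z (c *: g)) ->
  X `<=` Z ->
  (forall g, H g -> Z g -> exists c, [/\ c != 0,
    scal || (c == 1) & X (c *: g)]) ->
  closed_subgroup (rho @` X).
Proof.
move=> XH sgX clZ satZ XZ ZX; split; first exact: image_subgroup.
have [Z' clZ' Z'E] := central_push rhoP clZ satZ.
have [Y clY YE] := central_closed rhoP.
exists (Y `&` Z'); first exact: zclosedI.
rewrite setIA -YE; apply/seteqP; split=> [_ [g Xg <-]|_ [[g Hg <-]]].
  have Hg := XH g Xg; split; first by exists g.
  by apply/Z'E; [apply: det_subgroup_unit | apply: XZ].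
have Ug := det_subgroup_unit Hg.
move=> /(Z'E g Ug)/(ZX g Hg)[c [c0 sc Xcg]].
by exists (c *: g); rewrite ?rhoZ.
Qed.

Definition pattern (R : rel 'I_r) (a : 'M[k]_r) : set 'M[k]_r :=
  [set g | H g /\ supported R (a *m g *m invmx a)].

Section Pattern.
Variables (R : rel 'I_r) (a : 'M[k]_r).
Hypotheses (Rr : reflexive R) (Rt : transitive R) (Ua : a \in unitmx).

Lemma pattern_sub : pattern R a `<=` H. Proof. by move=> g []. Qed.

Lemma pattern_subgroup : subgroup (pattern R a).
Proof.
have sgH := det_subgroupP; have [c1 cU cM] := conj_is_mult Ua.
split=> [g [/det_subgroup_unit //]||g h [Hg Rg] [Hh Rh]|g [Hg Rg]].
- by split; [apply: subgroup1 | rewrite c1; apply: supported1].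
- split; first exact: subgroupM.
  rewrite cM; do ?exact: det_subgroup_unit.
  by apply: supportedM Rg Rh => i j l; apply: Rt.
- split; first exact: subgroupV.
  have Ug := det_subgroup_unit Hg.
  rewrite (morphV (subgroup_GL k r) (conj_is_mult Ua)) //.
  by apply: supportedV => //; apply: cU.
Qed.

Lemma pattern_closed : closed_subgroup (rho @` pattern R a).
Proof.
apply: (closed_image pattern_sub pattern_subgroup (zclosed_pattern R a)).
- move=> g c _ _ _ /=; rewrite -scalemxAr -scalemxAl; exact: supportedZ.
- by move=> g [].
- by move=> g Hg Rg; exists 1; rewrite oner_eq0 eqxx orbT scale1r.
Qed.

(** The segment from 1 to a given element, with one column rescaled so that
    the determinant also runs through a segment. *)
Lemma pattern_connected : zconnected (rho @` pattern R a).
Proof.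
apply: (zconnected_curves (central_regular rhoP)) =>
  [g [/det_subgroup_unit]//|].
move=> x [[Ux Qx] Rx]; set y := a *m x *m invmx a in Rx.
pose i0 := Ordinal r_gt0.
pose w (s : 'M[k]_1) : 'M[k]_r := 1%:M + s 0 0 *: (y - 1%:M).
pose d (s : 'M[k]_1) : k := 1 + s 0 0 * (\det x - 1).
pose q s := d s / \det (w s).
pose D s : 'M[k]_r := diag_mx (\row_j (if j == i0 then q s else 1)).
have DE s i j : D s i j = (if i == i0 then q s else 1) *+ (i == j).
  by rewrite !mxE.
have detD s : \det (D s) = q s.
  rewrite det_diag (bigD1 i0) //= mxE eqxx big1 ?mulr1 // => j ji.
  by rewrite mxE (negPf ji).
pose e s := \det (w s) * d s.
pose c s := invmx a *m (w s *m D s) *m a.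
have PR := polyfun_ring k 1; have [Pc PD PM] := PR.
have pw : entrywise (@polyfun k 1) w.
  apply: fring_addmx; [by []|exact: fring_cstmx|].
  by apply: fring_scalemx; [|exact: polyfun_entry|exact: fring_cstmx].
have pd : polyfun d by apply: PD => //; apply: PM => //; apply: polyfun_entry.
have pdet : polyfun (fun s => \det (w s)) by apply: fring_det.
have y1 : \det y = \det x by apply: det_conj.
have detc s : e s != 0 -> \det (c s) = d s.
  rewrite mulf_eq0 negb_or => /andP[w0 d0].
  have := det_conj (w s *m D s) (_ : invmx a \in unitmx).
  by rewrite invmxK unitmx_inv => -> //; rewrite det_mulmx detD mulrC divfK.
have w0 : w 0 = 1%:M by rewrite /w mxE scale0r addr0.
have w1 : w 1 = y by rewrite /w mxE eqxx scale1r addrC subrK.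
have d0 : d 0 = 1 by rewrite /d mxE mul0r addr0.
have d1 : d 1 = \det x by rewrite /d mxE eqxx mul1r addrC subrK.
have D1 s : q s = 1 -> D s = 1%:M.
  by move=> qs; apply/matrixP => i j; rewrite DE qs if_same mxE.
exists e, c; split=> [|||].
- exact: (PM _ _ pdet pd).
- have R1 := regular_ring [set s | e s != 0]; have [Rc _ RM] := R1.
  have rw : entrywise (regular [set s | e s != 0]) w.
    by move=> i j; apply: regular_poly; apply: pw.
  have regq : regular [set s | e s != 0] q.
    apply: RM; first exact: regular_poly.
    apply: regular_inv; first exact: regular_poly.
    by move=> s /=; rewrite mulf_eq0 negb_or => /andP[].
  suff rD : entrywise (regular [set s | e s != 0]) D.
    by do 3!apply: fring_mulmx => //.
  move=> i j.
  rewrite (_ : (fun _ => _) = fun s =>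
    (if i == i0 then q s else 1) *+ (i == j));
    last by apply: funext => s; apply: DE.
  by case: (i == j); [case: (i == i0) => //; apply: Rc | apply: Rc].
- move=> s es; have ds := detc s es.
  have [ws0 ds0] : \det (w s) != 0 /\ d s != 0.
    by move: es; rewrite mulf_eq0 negb_or => /andP[].
  split; first split.
  + by rewrite unitmxE ds unitfE.
  + by rewrite ds; apply: det_condition_line => //; apply: central_det rhoP.
  have -> : a *m c s *m invmx a = w s *m D s.
    by rewrite /c !mulmxA mulmxV // mul1mx mulmxK.
  apply: (supportedM (S := R) (R := R)) => [i j l||]; first exact: Rt.
    apply: supportedD; first exact: supported1.
    by apply/supportedZ/supportedB => //; apply: supported1.
  move=> i j; rewrite DE; case: (eqVneq i j) => [->|_]; rewrite ?Rr //.
  by rewrite mulr0n eqxx.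
- split; rewrite /e ?w0 ?w1 ?d0 ?d1 ?det1 ?mul1r ?oner_eq0 //.
  + by rewrite y1 mulf_neq0 // -unitfE -unitmxE.
  + by rewrite /c w0 D1 ?mulmx1 ?mulVmx // /q w0 d0 det1 divr1.
  + rewrite /c w1 D1; last first.
      by rewrite /q w1 d1 y1 divff // -unitfE -unitmxE.
    by rewrite mulmx1 /y !mulmxA mulVmx // mul1mx mulmxKV.
Qed.

End Pattern.

Definition borel_of a := pattern (@lower r) a.

Lemma lower_refl : reflexive (@lower r). Proof. exact: below_refl. Qed.
Lemma lower_trans : transitive (@lower r). Proof. exact: below_trans. Qed.

(** The Lie-Kolchin theorem for the preimage K of B: modulo scalars K is B, so
    it is solvable, and it is connected by central_pull. *)
Lemma triangularization B : B `<=` rho @` H -> subgroup B -> zconnected B ->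
  solvable_subgroup B -> exists2 a, a \in unitmx &
    forall g, H g -> B (rho g) -> supported (@lower r) (a *m g *m invmx a).
Proof.
move=> BH sgB conB [d Bd].
pose K : set 'M[k]_r := [set g | H g /\ B (rho g)].
have sgK : subgroup K by apply: subgroup_preimage rho_mult sgB;
  apply: det_subgroupP.
have KH : K `<=` H by move=> g [].
have rK := morph_sub KH rho_mult.
have rhoK : rho @` K = B.
  apply/seteqP; split=> [_ [g [_ Bg] <-] //|x Bx].
  by have [g Hg gx] := BH x Bx; exists g => //; split; rewrite ?gx.
have solK : solvable_subgroup K.
  exists d.+1 => g Dg; have sgD := iter_derived_subgroup d sgK.
  have scalar x : iter d (@derived_subgroup k r) K x -> exists c : k, x = c%:M.
    move=> Dx; have Ux := subgroup_unit sgD Dx.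
    have : rho x = rho 1%:M.
      have [-> _ _] := central_mult rhoP; apply: Bd.
      by rewrite -rhoK (iter_derived_image d sgK rK); exists x.
    move/(central_ker rhoP Ux (unitmx1 _ _)) => [c [_ _ ->]]; exists c.
    by rewrite scalemx1.
  apply: (Dg [set 1%:M]).
    split=> [_ ->|//|_ _ -> ->|_ ->] /=.
    - exact: unitmx1.
    - by rewrite mulmx1.
    - by rewrite invmx1.
  move=> _ [x [y [Dx Dy ->]]] /=.
  have [c xc] := scalar x Dx;
    have [Ux Uy] := (subgroup_unit sgD Dx, subgroup_unit sgD Dy).
  by rewrite {1}xc -scalar_mxC -xc mulmxK // mulmxV.
have [a Ua aP] := lie_kolchin sgK (central_pull rhoP BH conB) solK.
by exists a => // g Hg Bg; apply/is_trigP/aP.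
Qed.

Lemma borel_of_solvable a : a \in unitmx -> solvable_subgroup (rho @` borel_of
  a).
Proof.
move=> Ua; have sgB := pattern_subgroup lower_refl lower_trans Ua.
apply: (solvable_image sgB (morph_sub (@pattern_sub _ a) rho_mult)).
have Ua' : invmx a \in unitmx by rewrite unitmx_inv.
pose L : set 'M[k]_r := [set g | g \in unitmx /\ supported (@lower r) g].
have sgL : subgroup L.
  split=> [g []||g h [Ug lg] [Uh lh]|g [Ug lg]] //.
  - by split; [exact: unitmx1 | apply: supported1 lower_refl].
  - split; first by rewrite unitmx_mul Ug.
    by apply: supportedM lg lh => i j l ij jl; apply: lower_trans ij jl.
  - split; first by rewrite unitmx_inv.
    exact: (supportedV lower_refl lower_trans).
have conjL : multiplicative_on L (fun g => invmx a *m g *m invmx (invmx a)).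
  by apply: morph_sub (conj_is_mult Ua') => g [].
apply: solvable_sub (solvable_image sgL conjL (lower_solvable k r)) =>
  g [Hg lg].
exists (a *m g *m invmx a); last first.
  by rewrite invmxK !mulmxA mulVmx // mul1mx mulmxKV.
by split=> //; rewrite !unitmx_mul Ua Ua' (det_subgroup_unit Hg).
Qed.

(** A connected solvable overgroup is triangular for some b by the Lie-Kolchin
    theorem. It contains the unitriangular group of a, so that the flags of a
    and b coincide by lower_selfconj. *)
Lemma borel_of_borel a : a \in unitmx -> borel (rho @` H) (rho @` borel_of a).
Proof.
move=> Ua; split; first split.
- exact: pattern_closed lower_refl lower_trans Ua.
- exact: pattern_connected lower_refl lower_trans Ua.
- exact: borel_of_solvable.
- by apply: image_subset; apply: pattern_sub.
move=> B [sgB _] conB solB BH aB; apply/seteqP; split=> //.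
have [b Ub bP] := triangularization BH sgB conB solB.
pose c := b *m invmx a.
have Uc : c \in unitmx by rewrite unitmx_mul Ub unitmx_inv.
have lowc : supported (@lower r) c.
  apply: lower_selfconj => // x y yx.
  pose t : 'M[k]_r := 1%:M + delta_mx x y.
  have lowt : supported (@lower r) t.
    apply: supportedD; first exact: supported1 lower_refl.
    move=> i j; rewrite mxE; case: (eqVneq i x) => [->|_]; last by rewrite eqxx.
    case: (eqVneq j y) => [->|_]; last by rewrite eqxx.
    by rewrite /lower /below ltnW.
  have dett : \det t = 1.
    rewrite det_trig; last exact/is_trigP.
    rewrite big1 // => i _; rewrite !mxE eqxx.
    case: (eqVneq i x) => [->|]; last by rewrite addr0.
    by rewrite -val_eqE (gtn_eqF yx) addr0.
  have Ht : H (invmx a *m t *m a).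
    have Ua' : invmx a \in unitmx by rewrite unitmx_inv.
    by have := det_subgroupJ Ua' (det_subgroup_SL dett); rewrite invmxK.
  have Bt : borel_of a (invmx a *m t *m a).
    by split=> //; rewrite !mulmxA mulmxV // mul1mx mulmxK.
  have := bP _ Ht (aB _ (ex_intro2 _ _ _ Bt erefl)).
  by rewrite /c invmxM ?unitmx_inv // invmxK !mulmxA.
move=> x Bx; have [g Hg gx] := BH x Bx; exists g => //; split=> //.
have -> : a *m g *m invmx a = invmx c *m (b *m g *m invmx b) *m c.
  rewrite /c invmxM ?unitmx_inv // invmxK !mulmxA mulmxKV //.
  by rewrite mulmxKV.
have comp i j l : lower i j -> lower j l -> @lower r i l.
  by move=> ij jl; apply: lower_trans ij jl.
apply: (supportedM comp _ lowc); apply: (supportedM comp).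
  exact: (supportedV lower_refl lower_trans).
by apply: bP => //; rewrite gx.
Qed.

Lemma borel_classification B : borel (rho @` H) B ->
  exists2 a, a \in unitmx & B = rho @` borel_of a.
Proof.
move=> [[[sgB clB] conB solB] BH maxB].
have [a Ua aP] := triangularization BH sgB conB solB.
exists a => //; apply/esym/maxB.
- exact: pattern_closed lower_refl lower_trans Ua.
- exact: pattern_connected lower_refl lower_trans Ua.
- exact: borel_of_solvable.
- by apply: image_subset; apply: pattern_sub.
move=> x Bx; have [g Hg gx] := BH x Bx; exists g => //; split=> //.
by apply: aP => //; rewrite gx.
Qed.

End CentralQuotient.

(** * Levi decomposition of block triangular groups *)

Section BlockDiagonal.
Variables (k : closedFieldType) (r : nat) (l : 'I_r -> nat).
Implicit Types g h x y : 'M[k]_r.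

Definition block_part g : 'M[k]_r :=
  \matrix_(i, j) if l i == l j then g i j else 0.

Lemma block_part_same g : supported (same l) (block_part g).
Proof. by move=> i j; rewrite mxE /same; case: (l i == l j); rewrite ?eqxx. Qed.

Lemma block_partE i j g : l i = l j -> block_part g i j = g i j.
Proof. by move=> ij; rewrite mxE ij eqxx. Qed.

Lemma block_part_id g : supported (same l) g -> block_part g = g.
Proof.
move=> sg; apply/matrixP => i j; rewrite mxE.
by case: ifP => // /negbT nij; rewrite (supported0 sg).
Qed.

Lemma block_partM g h : supported (below l) g -> supported (below l) h ->
  block_part (g *m h) = block_part g *m block_part h.
Proof.
move=> lg lh; apply/matrixP => i j; rewrite [LHS]mxE [RHS]mxE mxE.
have [ij|ij] := eqVneq (l i) (l j).
  apply: eq_bigr => m _; rewrite !mxE -ij [l m == _]eq_sym.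
  have [//|im] := eqVneq (l i) (l m); rewrite mul0r.
  have [->|/lg] := eqVneq (g i m) 0; first by rewrite mul0r.
  have [->|/lh] := eqVneq (h m j) 0; first by rewrite mulr0.
  by rewrite /below -ij => im' mi; case/eqP: im; apply/eqP;
    rewrite eqn_leq im' mi.
rewrite big1 // => m _; rewrite !mxE.
by have [<-|_] := eqVneq (l i) (l m); rewrite ?(negPf ij) ?mulr0 ?mul0r.
Qed.

Lemma block_part1 : block_part 1%:M = 1%:M.
Proof. exact/block_part_id/supported1/same_refl. Qed.

Lemma block_part_deeper g : supported (below l) g -> block_part g = 1%:M ->
  supported (deeper l 1) (g - 1%:M).
Proof.
move=> lg g1 i j nz; rewrite /deeper addn1 ltn_neqAle.
have -> : (l j <= l i)%N.
  have: supported (below l) (g - 1%:M).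
    by apply: supportedB lg (supported1 (below_refl l)).
  exact.
rewrite andbT; apply: contraNneq nz => ji.
by rewrite mxE [X in _ + X]mxE -g1 block_partE // subrr.
Qed.

Lemma block_part_congruence g : congruence l 1 g -> block_part g = 1%:M.
Proof.
case=> _ dg; apply/matrixP => i j; rewrite mxE.
case: eqVneq => [ij|ij]; last first.
  by rewrite mxE; case: (eqVneq i j) ij => [->|//]; rewrite eqxx.
apply/eqP; rewrite -subr_eq0.
have : (g - 1%:M) i j = 0.
  by apply: (supported0 dg); rewrite /deeper addn1 -ij ltnn.
by rewrite mxE [X in _ + X]mxE => ->.
Qed.

(** The block diagonal part is multiplicative on block triangular matrices, so
    that of g is invertible, and dividing by it leaves blocks equal to 1. *)
Lemma congruence_levi g : g \in unitmx -> supported (below l) g ->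
  block_part g \in unitmx /\ congruence l 1 (g *m invmx (block_part g)).
Proof.
move=> Ug lg; have lV := supportedV (below_refl l) (@below_trans _ l) Ug lg.
have DD : block_part g *m block_part (invmx g) = 1%:M.
  by rewrite -block_partM // mulmxV // block_part1.
have [UD _] := mulmx1_unit DD; split=> //.
have -> : invmx (block_part g) = block_part (invmx g).
  by apply: (can_inj (mulKmx UD)); rewrite mulmxV.
have lD : supported (below l) (block_part (invmx g)).
  by apply: (supported_sub (@same_below _ l)); apply: block_part_same.
split.
  by rewrite unitmx_mul Ug; have [_ ->] := mulmx1_unit DD.
apply: block_part_deeper.
  by apply: supportedM lg lD => a b c ab bc; apply: below_trans ab bc.
by rewrite block_partM // (block_part_id (@block_part_same _)).
Qed.

Lemma deeper_exp x m : supported (deeper l 1) x -> supported (deeper l m) (x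
  ^+ m).
Proof.
move=> dx; elim: m => [|m IHm].
  by apply/below_deeper/supported1/below_refl.
by rewrite exprS; apply: deeperM dx IHm; rewrite add1n.
Qed.

Lemma deeper_nilpotent x : supported (deeper l 1) x -> exists m, x ^+ m = 0.
Proof.
move=> dx; exists (\max_i l i).+1; apply/matrixP => i j; rewrite [RHS]mxE.
have dm := @deeper_exp x (\max_i l i).+1 dx.
apply: (supported0 dm); rewrite /deeper -ltnNge addnS ltnS.
by apply: leq_trans (leq_addl _ _); apply: leq_bigmax.
Qed.

Lemma exp_scalemx c x m : (c *: x) ^+ m = c ^+ m *: x ^+ m.
Proof.
elim: m => [|m IHm]; first by rewrite !expr0 scale1r.
rewrite !exprS IHm -[LHS]/((c *: x) *m (c ^+ m *: x ^+ m)).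
by rewrite -scalemxAl -scalemxAr scalerA.
Qed.

Lemma det_exp x m : \det (x ^+ m) = \det x ^+ m.
Proof. by elim: m => [|m IHm]; rewrite ?det1 // !exprS det_mulmx IHm. Qed.

Lemma congruence_normal g u : g \in unitmx -> supported (below l) g ->
  congruence l 1 u -> congruence l 1 (g *m u *m invmx g).
Proof.
move=> Ug lg [Uu du]; split; first by rewrite !unitmx_mul Ug Uu unitmx_inv.
have -> : g *m u *m invmx g - 1%:M = g *m (u - 1%:M) *m invmx g.
  by rewrite mulmxBr mulmxBl mulmx1 mulmxV.
apply: (deeperM (a := 1) (b := 0)) => //; last first.
  exact/below_deeper/(supportedV (below_refl l) (@below_trans _ l)).
by apply: (deeperM (a := 0) (b := 1)) => //; apply/below_deeper.
Qed.

Hypothesis char2 : 2%N \in [pchar k].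

Lemma congruence_det g : congruence l 1 g -> \det g = 1.
Proof.
case=> _ /deeper_nilpotent gm; have /(unipotent_exp2 char2)[m gm1] := gm.
by apply: (exp2_inj char2 (m := m)); rewrite -det_exp gm1 det1 expr1n.
Qed.

Lemma mxtrace_unipotent_scalar g m c : g ^+ (2 ^ m) = c%:M -> c != 0 ->
  exists2 c0, c0 != 0 & \tr g = c0 *+ r.
Proof.
move=> gm c0; have [d dm] := root_exists c (expn_gt0 2 m).
have d0 : d != 0.
  by apply: contraNneq c0 => d0; rewrite -dm d0 expr0n expn_eq0.
have : exists m', (d^-1 *: g - 1%:M) ^+ m' = 0.
  apply/(unipotent_exp2 char2); exists m.
  by rewrite exp_scalemx gm exprVn dm scale_scalar_mx mulVf.
case=> m' /mxtrace_nilpotent; rewrite linearB linearZ /= mxtrace1 => /eqP.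
rewrite subr_eq0 => /eqP tg; exists d => //.
by rewrite -[LHS](mulVKf d0) tg mulr_natr.
Qed.

(** The argument for the maximality of the unipotent radical. For a transvection
    x = 1 + w phi in one of the diagonal blocks, the trace of the commutator of
    g and x is r + (phi g^-1 w) (phi g w). As w can be scaled, the product
    vanishes if the commutator is unipotent up to scalars; so for w a basis
    vector e_j either g w or g^-1 w is, in the block, a multiple of e_j, and
    then both are. *)
Lemma commutators_unipotent_scalar g :
  g \in unitmx -> supported (below l) g ->
  (forall (w : 'cV[k]_r) (phi : 'rV[k]_r) a,
     (forall i, w i 0 != 0 -> l i = a) -> (forall i, phi 0 i != 0 -> l i = a) ->
     phi *m w = 0 ->
     let x := 1%:M + w *m phi in
     exists m c, c != 0 /\ (g *m x *m invmx g *m invmx x) ^+ (2 ^ m) = c%:M) ->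
  forall i j, i != j -> l i = l j -> g i j = 0.
Proof.
move=> Ug lg comm; set h := invmx g.
have prod0 (w : 'cV[k]_r) (phi : 'rV[k]_r) a :
    (forall i, w i 0 != 0 -> l i = a) -> (forall i, phi 0 i != 0 -> l i = a) ->
    phi *m w = 0 -> (phi *m h *m w) 0 0 * (phi *m g *m w) 0 0 = 0.
  move=> wa pa pw; set q := _ * _.
  have trq s : exists2 c0, c0 != 0 & r%:R + s ^+ 2 * q = c0 *+ r.
    have psw : phi *m (s *: w) = 0 by rewrite -scalemxAr pw scaler0.
    have [] := comm (s *: w) phi a _ pa psw => [i|m [c [c0 gm]]].
      by rewrite mxE mulf_eq0 negb_or => /andP[_ /wa].
    have [d d0 dE] := mxtrace_unipotent_scalar gm c0; exists d => //.
    rewrite -dE conj_transvection // transvectionV //.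
    have tr1 (v : 'cV[k]_r) (psi : 'rV[k]_r) : \tr (v *m psi) = (psi *m v) 0 0.
      by rewrite mxtrace_mulC /mxtrace big_ord1.
    have mul11 (x y : 'M[k]_1) : (x *m y) 0 0 = x 0 0 * y 0 0.
      by rewrite mxE big_ord1.
    rewrite mulmxDl mul1mx mulmxDr mulmx1 !linearD /= mxtrace1.
    have -> : \tr (s *: w *m phi) = 0 by rewrite tr1 psw mxE.
    have -> : \tr (g *m (s *: w) *m (phi *m invmx g)) = 0.
      by rewrite tr1 -mulmxA mulKmx // psw mxE.
    rewrite [_ *m (s *: w *m phi)]mulmxA tr1 addr0 add0r.
    have -> : phi *m (g *m (s *: w) *m (phi *m invmx g) *m (s *: w)) =
        (phi *m g *m (s *: w)) *m (phi *m h *m (s *: w)) by rewrite !mulmxA.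
    have pull (psi : 'rV[k]_r) : (psi *m (s *: w)) 0 0 = s * (psi *m w) 0 0.
      by rewrite -scalemxAr mxE.
    rewrite mul11 !pull /q.
    by congr (_ + _); ring.
  (* For s ^ 2 = r / q the trace is r + r = 0, so that r = 0 in k; then s = 1
     gives q = 0. *)
  apply/eqP/negPn/negP => q0; have [s s2] := root_exists (r%:R / q) (ltn0Sn 1).
  have [c c0] := trq s; rewrite s2 divfK // addxx // => /esym/eqP.
  rewrite -mulr_natr mulf_eq0 (negPf c0) /= => /eqP r0.
  have [d _] := trq 1; rewrite r0 add0r expr1n mul1r -mulr_natr r0 mulr0.
  by move/eqP; rewrite (negPf q0).
have lh : supported (below l) h.
  exact: (supportedV (below_refl l) (@below_trans _ l)).
have deltaE (x : 'M[k]_r) i j : delta_mx 0 i *m x *m delta_mx j 0 = (x i j)%:M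
  :> 'M_1.
  by rewrite -rowE -colE; apply/matrixP => a b; rewrite !ord1 !mxE mulr1n.
have delta_col j i : (delta_mx j 0 : 'cV[k]_r) i 0 != 0 -> l i = l j.
  by rewrite mxE; case: (eqVneq i j) => [->|]; rewrite ?eqxx.
have delta_row j i : (delta_mx 0 j : 'rV[k]_r) 0 i != 0 -> l i = l j.
  by rewrite mxE; case: (eqVneq i j) => [->|]; rewrite ?eqxx.
have deltad i j : i != j -> (delta_mx 0 i : 'rV[k]_r) *m (delta_mx j 0 :
  'cV_r) = 0.
  move=> ij; rewrite -[delta_mx 0 i]mulmx1 deltaE mxE (negPf ij).
  exact: raddf0.
have single i j : i != j -> l i = l j -> h i j * g i j = 0.
  move=> ij lij; have := prod0 (delta_mx j 0) (delta_mx 0 i) (l j).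
  move=> /(_ (delta_col j)); rewrite !deltaE !mxE !mulr1n; apply.
    by move=> m; rewrite -lij; apply: delta_row.
  exact: deltad.
have cross i i' j : i != j -> i' != j -> l i = l j -> l i' = l j ->
    (h i j + h i' j) * (g i j + g i' j) = 0.
  move=> ij i'j lij li'j.
  have dd (x : 'M[k]_r) : (((delta_mx 0 i + delta_mx 0 i') : 'rV_r) *m x *m
      (delta_mx j 0 : 'cV_r)) 0 0 = x i j + x i' j.
    by rewrite !mulmxDl !deltaE !mxE !mulr1n.
  rewrite -!dd; apply: (prod0 _ _ (l j)); first exact: delta_col.
    move=> m; apply: contra_neq_eq => lmj; rewrite mxE.
    have -> : (delta_mx 0 i : 'rV[k]_r) 0 m = 0.
      by apply/eqP; apply: contraNT lmj => /delta_row ->; apply/eqP.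
    have -> : (delta_mx 0 i' : 'rV[k]_r) 0 m = 0.
      by apply/eqP; apply: contraNT lmj => /delta_row ->; apply/eqP.
    by rewrite addr0.
  by rewrite mulmxDl !deltad // addr0.
move=> i j ij lij; have [//|gij] := eqVneq (g i j) 0.
have hij : h i j = 0.
  by have /eqP := single i j ij lij; rewrite mulf_eq0 (negPf gij) orbF => /eqP.
have hcol m : m != j -> l m = l j -> h m j = 0.
  move=> mj lmj; apply/eqP; apply: contraT => hmj.
  have /eqP := single m j mj lmj; rewrite mulf_eq0 (negPf hmj) => /= /eqP gmj.
  have /eqP := cross i m j ij mj lij lmj.
  by rewrite hij gmj add0r addr0 mulf_eq0 (negPf hmj) (negPf gij).
have ghE m : l m = l j -> (1%:M : 'M[k]_r) m j = g m j * h j j.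
  move=> lmj; rewrite -(mulmxV Ug) mxE (bigD1 j) //= big1 ?addr0 // => z zj.
  apply/eqP; rewrite mulf_eq0; apply: contraNT zj.
  rewrite negb_or => /andP[/lg zm hzj]; have jz : (l j <= l z)%N := lh _ _ hzj.
  apply: contraNT hzj => zj; apply/eqP/hcol => //; apply/eqP.
  by rewrite eqn_leq jz andbT -lmj.
have := ghE j erefl; rewrite mxE eqxx => /esym gh1.
have /esym/eqP := ghE i lij; rewrite mxE (negPf ij) mulf_eq0 => /orP[/eqP //|].
by move=> /eqP h0; move/eqP: gh1; rewrite h0 mulr0 eq_sym oner_eq0.
Qed.

End BlockDiagonal.

(** * Tori and parabolic subgroups of central quotients *)

Section Structure.
Variables (k : closedFieldType) (r n : nat) (rho : 'M[k]_r -> 'M[k]_n).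
Variables (Q : k -> Prop) (scal : bool).
Hypothesis rhoP : central_quotient rho Q scal.
Hypothesis r_gt0 : (0 < r)%N.
Hypothesis char2 : 2%N \in [pchar k].
Local Notation H := (det_subgroup (k := k) (r := r) Q).
Local Notation pattern1 R := (pattern Q R 1%:M).
Implicit Types g h : 'M[k]_r.

Lemma pattern1E (R : rel 'I_r) g : pattern1 R g <-> H g /\ supported R g.
Proof. by rewrite /pattern /= mul1mx invmx1 mulmx1. Qed.

Lemma image_pattern_supported (R : rel 'I_r) g :
  g \in unitmx -> (rho @` pattern1 R) (rho g) -> supported R g.
Proof.
move=> Ug [x /pattern1E[Hx Rx] /esym].
move/(central_ker rhoP Ug (det_subgroup_unit Hx)) => [c [_ _ ->]].
exact: supportedZ.
Qed.

(** Let t be diag (z, 1 / z) in the coordinates i, j. If g t = c t g and g has a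
    nonzero entry (i, j), then c = 1 / z^2, whereas c^r = 1 by comparison of the
    determinants; this is false for general z. *)
Lemma torus_selfcentralizing g : g \in unitmx ->
  (forall t, pattern1 (same val) t -> rho (g *m t) = rho (t *m g)) ->
  supported (same val) g.
Proof.
move=> Ug gt i j gij; apply: contraT => ij.
have nij : i != j by rewrite -val_eqE.
have [z] : exists z, ~~ root ('X * ('X^(2 * r) - 1) : {poly k}) z.
  apply/closed_nonrootP; rewrite mulf_neq0 ?polyX_eq0 //.
  by rewrite -size_poly_eq0 size_XnsubC // muln_gt0.
rewrite rootM rootX negb_or /root hornerD hornerN hornerC hornerXn subr_eq0.
move=> /andP[z0 z2r].
pose d l := if l == i then z else if l == j then z^-1 else 1.
pose t : 'M[k]_r := diag_mx (\row_l d l).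
have dett : \det t = 1.
  rewrite det_diag (bigD1 i) //= (bigD1 j) 1?eq_sym //= big1.
    by rewrite !mxE /d eqxx eq_sym (negPf nij) eqxx mulr1 mulfV.
  by move=> m /andP[mi mj]; rewrite mxE /d (negPf mi) (negPf mj).
have Ht : H t := det_subgroup_SL rhoP dett.
have Tt : pattern1 (same val) t.
  apply/pattern1E; split=> // a b; rewrite mxE /same.
  by case: (eqVneq a b) => [->|]; rewrite ?eqxx // mulr0n eqxx.
have Ut := det_subgroup_unit Ht.
have /(central_ker rhoP) := gt t Tt; rewrite !unitmx_mul Ug Ut.
move=> /(_ isT isT)[c [_ _ gtE]].
have cr : c ^+ r = 1.
  have := congr1 determinant gtE; rewrite detZ !det_mulmx dett mulr1 mul1r.
  move/eqP; rewrite -[X in X == _]mul1r => /eqP/(mulIf _) -> //.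
  by rewrite -unitfE -unitmxE.
have cz : z^-1 = c * z.
  have /(congr1 (fun x : 'M_r => x i j)) := gtE.
  rewrite mul_mx_diag mxE [in RHS]mxE mul_diag_mx !mxE /d eqxx.
  rewrite eq_sym (negPf nij) eqxx => /eqP; rewrite mulrA mulrC => /eqP.
  by move/(mulIf gij).
case/eqP: z2r; rewrite exprM; apply: (mulfI (_ : c ^+ r != 0)).
  by rewrite cr oner_eq0.
by rewrite mulr1 -exprMn expr2 mulrA -cz mulVf // expr1n cr.
Qed.

Lemma diagonal_maximal_torus :
  maximal_torus (rho @` H) (rho @` pattern1 (same val)).
Proof.
have [Rr Rt] : reflexive (same (val : 'I_r -> nat)) /\ transitive (same (val :
  'I_r -> nat)).
  by split; [exact: same_refl | exact: same_trans].
split.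
- split.
  + exact: (pattern_closed rhoP Rr Rt (unitmx1 _ _)).
  + exact: (pattern_connected rhoP r_gt0 Rr Rt (unitmx1 _ _)).
  + exists 1%:M; first exact: unitmx1.
    move=> _ [t /pattern1E[Ht Tt] <-]; rewrite mul1mx invmx1 mulmx1.
    apply: (central_diag rhoP (det_subgroup_unit Ht)).
    apply/is_diag_mxP => i j ij; apply: (supported0 Tt).
    by rewrite /same.
- by apply: image_subset => g [].
move=> S [[sgS _] _ [a Ua diagS]] SH TS; apply/seteqP; split=> // s Ss.
have [g Hg gs] := SH s Ss; have Ug := det_subgroup_unit Hg.
exists g => //; apply/pattern1E; split=> //;
  apply: torus_selfcentralizing => // t Tt.
have Ut : t \in unitmx by have [Ht _] := Tt; apply: det_subgroup_unit Ht.
rewrite !(rhoM rhoP) // gs.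
have St : S (rho t) by apply: TS; exists t.
have [_ _ cM] := conj_is_mult Ua.
have inj : injective (fun x : 'M[k]_n => a *m x *m invmx a).
  move=> x y xy; apply: (can_inj (mulKmx Ua));
    apply: (can_inj (mulmxK (_ : invmx a \in unitmx))) => //.
  by rewrite unitmx_inv.
apply: inj; rewrite /= !cM; do ?exact: (subgroup_unit sgS).
have /is_diag_mxP ds := diagS _ Ss; have /is_diag_mxP dt := diagS _ St.
have [[x ->] [y ->]] : (exists x, a *m s *m invmx a = diag_mx x) /\
    (exists y, a *m rho t *m invmx a = diag_mx y).
  by split; apply/diag_mxP/is_diag_mxP.
exact: diag_mxC.
Qed.

Section Levels.
Variable l : 'I_r -> nat.

Definition block_group := rho @` pattern1 (below l).
Definition block_levi := rho @` pattern1 (same l).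
Definition block_unipotent := rho @` congruence l 1.

Lemma congruence_det_subgroup g : congruence l 1 g -> H g.
Proof. by move/(congruence_det char2)/(det_subgroup_SL rhoP). Qed.

Local Notation i0 := (Ordinal r_gt0).

Lemma zclosed_congruence :
  zclosed [set g : 'M[k]_r | supported (deeper l 1) (g - 1%:M)].
Proof.
apply: (zclosed_preimage (F := fun g => g - 1%:M));
  last exact: zclosed_supported.
have P := polyfun_ring k r.
by apply: fring_addmx; [|exact: polyfun_entry|exact: fring_cstmx].
Qed.

Lemma zclosed_congruence_scalar :
  zclosed [set g : 'M[k]_r | supported (deeper l 1) (g - (g i0 i0)%:M)].
Proof.
apply: (zclosed_preimage (F := fun g : 'M[k]_r => g - (g i0 i0)%:M));
  last exact: zclosed_supported.
have P := polyfun_ring k r; have [Pc _ _] := P.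
apply: fring_addmx; [by []|exact: polyfun_entry|move=> i j].
under eq_fun do rewrite !mxE; apply: fring_opp => //.
case: (i == j); last by under eq_fun do rewrite mulr0n; apply: Pc.
by under eq_fun do rewrite mulr1n; apply: polyfun_entry.
Qed.

Lemma block_unipotent_closed : closed_subgroup block_unipotent.
Proof.
have sgU := congruence_subgroup k l 1.
(* If rho kills the scalars, the saturation of the unipotent group consists of
   its scalar multiples. *)
have [sc|nsc] := boolP scal; last first.
  apply: (closed_image rhoP congruence_det_subgroup sgU zclosed_congruence).
  - by move=> g c _ _; rewrite (negPf nsc) => /eqP->; rewrite scale1r.
  - by move=> g [].
  - move=> g [Ug _] dg; exists 1.
    by rewrite oner_eq0 eqxx orbT scale1r.
apply: (closed_image rhoP congruence_det_subgroup sgU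
  zclosed_congruence_scalar).
- move=> g c _ _ _ /=; rewrite mxE -scale_scalar_mx -scalerBr.
  exact: supportedZ.
- move=> g Ug /=; have /matrixP := block_part_congruence Ug.
  move/(_ i0 i0); rewrite block_partE // => ->.
  by rewrite mxE eqxx; case: Ug.
move=> g [Ug _] /=; set c := g _ _ => dg.
have lg : supported (below l) g.
  rewrite -(subrK c%:M g); apply: supportedD.
    exact: supported_sub (@deeper_below _ l 1) dg.
  rewrite -scalemx1; apply/supportedZ/supported1/below_refl.
have c0 : c != 0.
  apply: contraTneq Ug => c0; rewrite unitmxE unitfE negbK.
  have [] := deeper_nilpotent (l := l) (x := g); first by move: dg;
    rewrite c0 raddf0 subr0.
  have det00 : \det (0 : 'M[k]_r) = 0.
    by rewrite -(scale0r (1%:M : 'M[k]_r)) detZ expr0n eqn0Ngt r_gt0 mul0r.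
  move=> m gm; move: (det_exp g m); rewrite gm det00 => /esym/eqP.
  by rewrite expf_eq0 => /andP[].
exists c^-1; split; rewrite ?invr_eq0 ?sc //.
split; first by rewrite unitmxZ // unitfE invr_eq0.
have -> : c^-1 *: g - 1%:M = c^-1 *: (g - c%:M).
  by rewrite scalerBr scale_scalar_mx mulVf.
exact: supportedZ.
Qed.

Lemma block_unipotent_connected : zconnected block_unipotent.
Proof.
apply: (zconnected_curves (central_regular rhoP)) => [g []//|u [Uu du]].
have P1 := polyfun_ring k 1; have [Pc _ _] := P1.
exists (fun=> 1), (fun s : 'M[k]_1 => 1%:M + s 0 0 *: (u - 1%:M)).
have Us s : congruence l 1 (1%:M + s *: (u - 1%:M)).
  have ds : supported (deeper l 1) (1%:M + s *: (u - 1%:M) - 1%:M).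
    by rewrite addrC addrA addNr add0r; apply: supportedZ.
  split=> //.
  have [m] := deeper_nilpotent ds; move/(ex_intro (fun m => _ ^+ m = 0) m).
  move/(unipotent_exp2 char2) => [m' xm].
  rewrite unitmxE unitfE; apply: contraTneq (oner_neq0 k) => x0.
  by rewrite -(det1 k r) -xm det_exp x0 expr0n expn_eq0 eqxx.
split=> // [|].
- move=> i j; apply: regular_poly; apply: fring_addmx => //.
  by apply: fring_scalemx; [|exact: polyfun_entry|exact: fring_cstmx].
- rewrite oner_eq0; split=> //; first by rewrite mxE scale0r addr0.
  by rewrite mxE eqxx scale1r addrC subrK.
Qed.

Lemma unitmxX g e : g \in unitmx -> g ^+ e \in unitmx.
Proof.
move=> Ug; elim: e => [|e IHe]; first exact: unitmx1.
by rewrite exprS unitmx_mul Ug.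
Qed.

Lemma rhoX g e : g \in unitmx -> rho (g ^+ e) = rho g ^+ e.
Proof.
move=> Ug; elim: e => [|e IHe]; first by have [] := central_mult rhoP.
rewrite exprS (_ : g * g ^+ e = g *m g ^+ e) // (rhoM rhoP) ?unitmxX //.
by rewrite IHe exprS.
Qed.

(** In characteristic 2, being unipotent means that some power with exponent 2^m
    is 1, and this lifts along rho up to the kernel. *)
Lemma image_unipotent g : g \in unitmx ->
  (exists m, (rho g - 1%:M) ^+ m = 0) ->
  exists m c, [/\ c != 0, scal || (c == 1) & g ^+ (2 ^ m) = c%:M].
Proof.
move=> Ug /(unipotent_exp2 char2)[m gm]; exists m.
have [r1 _ _] := central_mult rhoP.
have : rho (g ^+ (2 ^ m)) = rho 1%:M by rewrite rhoX // gm r1.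
move/(central_ker rhoP (unitmxX _ Ug) (unitmx1 _ _)) => [c [c0 sc ->]];
  exists c.
by rewrite scalemx1.
Qed.

Lemma unipotent_image g m : g \in unitmx -> g ^+ (2 ^ m) = 1%:M ->
  exists m, (rho g - 1%:M) ^+ m = 0.
Proof.
move=> Ug gm; apply/(unipotent_exp2 char2); exists m.
have [r1 _ _] := central_mult rhoP.
by rewrite -rhoX // gm r1.
Qed.

(** For the maximality: if V is a normal unipotent subgroup, g an element above
    V and x a transvection in a diagonal block, then the commutator of g and x
    is above V, hence unipotent up to scalars. So inside the blocks g has only
    diagonal entries, and these are all equal, as roots of one scalar. *)
Lemma block_unipotent_radical : unipotent_radical block_group block_unipotent.
Proof.
split=> [|V].
  split.
  - exact: block_unipotent_closed.
  - exact: block_unipotent_connected.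
  - move=> _ [u [Uu /deeper_nilpotent/(unipotent_exp2 char2)[m um]] <-].
    exact: unipotent_image Uu um.
  - split.
      apply: image_subset => u Uu; apply/pattern1E; split.
        exact: congruence_det_subgroup.
      exact: congruence_below Uu.
    move=> _ _ [g /pattern1E[Hg lg] <-] [u Uu <-].
    have Ug := det_subgroup_unit Hg; have [Uu' _] := Uu.
    exists (g *m u *m invmx g); first exact: congruence_normal.
    by rewrite !(rhoM rhoP) ?(rhoV rhoP) // ?unitmx_mul ?unitmx_inv ?Ug.
move=> [[sgV _] _ unipV [VP normV]] v Vv.
have [g /pattern1E[Hg lg] gv] := VP v Vv; have Ug := det_subgroup_unit Hg.
have blocks i j : i != j -> l i = l j -> g i j = 0.
  apply: (commutators_unipotent_scalar char2 Ug lg) => w phi a wa pa pw x.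
  have Hx : H x by apply/(det_subgroup_SL rhoP)/(transvection_det char2).
  have Ux := det_subgroup_unit Hx.
  have lx : supported (below l) x.
    apply: supportedD; first exact/supported1/below_refl.
    move=> i' j'; rewrite mxE big_ord1 mulf_eq0 negb_or => /andP[/wa ia /pa ja].
    by rewrite /below ia ja.
  have Px : block_group (rho x) by exists x => //; apply/pattern1E.
  have Vx : V (rho (g *m x *m invmx g *m invmx x)).
    rewrite !(rhoM rhoP) ?(rhoV rhoP) ?unitmx_mul ?unitmx_inv ?Ug ?Ux //.
    rewrite gv -!mulmxA; apply: (subgroupM sgV) => //; rewrite mulmxA.
    by apply: normV => //; apply: subgroupV.
  have [||m [c [c0 _ cm]]] := image_unipotent (g := g *m x *m invmx g *m invmx
    x).
  - by rewrite !unitmx_mul !unitmx_inv Ug Ux.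
  - exact: unipV.
  - by exists m, c.
have anti : supported (fun i j => (i == j) || deeper l 1 i j) g.
  move=> i j gij; have [//|ij] := eqVneq i j.
  rewrite /= /deeper addn1 ltn_neqAle (lg _ _ gij : (l j <= l i)%N) andbT.
  by apply: contraNneq gij => ji; rewrite blocks.
pose R : rel 'I_r := fun i j => (i == j) || deeper l 1 i j.
have Ra : antisymmetric R.
  move=> i j /andP[/orP[/eqP //|ij] /orP[/eqP //|]].
  rewrite /deeper !addn1 => ji; move: ij; rewrite /deeper addn1 => ij.
  by have := ltn_trans ij ji; rewrite ltnn.
have Rc i j z : R i j -> R j z -> R i z.
  rewrite /R /deeper !addn1 => /predU1P[->//|ij] /predU1P[<-|jz].
    by rewrite ij orbT.
  by rewrite (ltn_trans jz ij) orbT.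
have Rexp e : supported R (g ^+ e).
  elim: e => [|e IHe]; first by apply: supported1 => i; rewrite /R eqxx.
  by rewrite exprS; apply: supportedM Rc anti IHe.
have diagX e i : (g ^+ e) i i = g i i ^+ e.
  elim: e => [|e IHe]; first by rewrite mxE eqxx.
  by rewrite !exprS -IHe; apply: supported_diagM Ra anti (Rexp e).
have [|m [c [c0 sc cm]]] := image_unipotent Ug; first by rewrite gv;
  apply: unipV.
have gdiag i : g i i ^+ (2 ^ m) = c by rewrite -diagX cm mxE eqxx.
pose d := g i0 i0; have gd i : g i i = d.
  by apply: (exp2_inj char2 (m := m)); rewrite !gdiag.
have d0 : d != 0.
  by apply: contraNneq c0 => d0; rewrite -(gdiag i0) -/d d0 expr0n expn_eq0.
have sd : scal || (d == 1).
  move: sc; have [//|_ /= /eqP c1] := boolP scal; apply/eqP.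
  by apply: (exp2_inj char2 (m := m)); rewrite gdiag c1 expr1n.
exists (d^-1 *: g); last first.
  have [dV0 sdV] : d^-1 != 0 /\ scal || (d^-1 == 1).
    by rewrite invr_eq0 invr_eq1.
  by rewrite (rhoZ rhoP dV0 sdV).
split; first by rewrite unitmxZ // unitfE invr_eq0.
move=> i j; apply: contraNT => nij;
  rewrite mxE [X in X + _]mxE [X in _ + X]mxE mxE.
have [->|ij] := eqVneq i j; first by rewrite gd mulVf // subrr.
by rewrite subr0 (supported0 anti) ?mulr0 // negb_or ij.
Qed.

Lemma block_group_levi : levi block_group block_levi.
Proof.
split.
- exact: (pattern_closed rhoP (same_refl l) (@same_trans _ l) (unitmx1 _ _)).
- apply: image_subset => g /pattern1E[Hg sg]; apply/pattern1E; split=> //.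
  exact: supported_sub (@same_below _ l) sg.
exists block_unipotent; split.
- exact: block_unipotent_radical.
- apply/seteqP; split; last first.
    have [r1 _ _] := central_mult rhoP.
    move=> _ ->; split; exists 1%:M => //.
      apply/pattern1E; split; first exact: subgroup1 (det_subgroupP rhoP).
      exact/supported1/same_refl.
    exact: subgroup1 (congruence_subgroup k l 1).
  move=> x [[g /pattern1E[Hg sg] gx] [u Uu ux]] /=.
  have [Uu' du] := Uu; have Ug := det_subgroup_unit Hg.
  have : rho u = rho g by rewrite gx ux.
  move/(central_ker rhoP Uu' Ug) => [c [c0 sc uE]].
  have su : supported (same l) u by rewrite uE; apply: supportedZ.
  have u1 := block_part_congruence Uu; rewrite block_part_id // in u1.
  by rewrite -ux u1; have [-> _ _] := central_mult rhoP.
apply/seteqP; split=> [_ [g /pattern1E[Hg lg] <-]|_ /= [_ [_ [[u Uu <-] [g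
  /pattern1E[Hg sg] <-] ->]]]].
  have Ug := det_subgroup_unit Hg.
  have [Ub Cg] := congruence_levi Ug lg.
  have gE : g = g *m invmx (block_part l g) *m block_part l g by rewrite
    mulmxKV.
  exists (rho (g *m invmx (block_part l g))), (rho (block_part l g)); split.
  - by exists (g *m invmx (block_part l g)).
  - exists (block_part l g) => //; apply/pattern1E; split;
    last exact: block_part_same.
    apply: det_subgroup_eqdet Hg => //.
    by rewrite [in RHS]gE det_mulmx (congruence_det char2 Cg) mul1r.
  - by rewrite -(rhoM rhoP) -?gE //; have [] := Cg.
have [Uu' _] := Uu; have Ug := det_subgroup_unit Hg.
exists (u *m g); last by rewrite (rhoM rhoP).
apply/pattern1E; split.
  by apply: (subgroupM (det_subgroupP rhoP)) => //;
    apply: congruence_det_subgroup.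
apply: supportedM (congruence_below Uu) (supported_sub (@same_below _ l) sg).
by move=> i j z ij jz; apply: below_trans ij jz.
Qed.

(** The permutation is the inverse of the rank for the lexicographic order given
    by the level and the position. It carries a full flag to one that refines
    the flag of the block triangular group. *)
Lemma sorting_permutation :
  exists s : 'S_r, forall i j : 'I_r, (i <= j)%N -> (l (s i) <= l (s j))%N.
Proof.
pose key (i : 'I_r) := (l i * r + i)%N.
have keyP (i j : 'I_r) : (l i < l j)%N -> (key i < key j)%N.
  move=> lij; rewrite /key; apply: (@leq_trans ((l i).+1 * r)).
    by rewrite mulSn addnC ltn_add2r.
  by apply: leq_trans (leq_addr _ _); rewrite leq_mul2r lij orbT.
have key_inj : injective key.
  move=> i j ij; case: (ltngtP (l i) (l j)) => [/keyP|/keyP|lij].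
  - by rewrite ij ltnn.
  - by rewrite ij ltnn.
  by apply: val_inj; move: ij; rewrite /key lij => /addnI.
pose below_set i := [set j | (key j < key i)%N]%SET.
have rk_lt i : (#|below_set i| < r)%N.
  rewrite -[X in (_ < X)%N](card_ord r) -cardsT; apply: proper_card.
  apply/properP; split; first exact: finset.subsetT.
  by exists i; rewrite ?inE // ltnn.
pose rk i := Ordinal (rk_lt i).
have rk_mono i j : (key i < key j)%N -> (rk i < rk j)%N.
  move=> ij; apply: proper_card; apply/properP; split.
    by apply/fintype.subsetP => m; rewrite !inE => /ltn_trans; apply.
  by exists i; rewrite !inE ?ltnn.
have rk_inj : injective rk.
  move=> i j ij; apply: key_inj; case: (ltngtP (key i) (key j)) => // /rk_mono.
    by rewrite ij ltnn.
  by rewrite ij ltnn.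
exists (perm rk_inj)^-1%g => i j; apply: contraTT;
  rewrite -!ltnNge => /keyP/rk_mono.
have rkE x : rk ((perm rk_inj)^-1%g x) = x.
  by rewrite -[RHS](permKV (perm rk_inj)) permE.
by rewrite !rkE.
Qed.

Lemma block_group_parabolic : parabolic (rho @` H) block_group.
Proof.
split.
- exact: (pattern_closed rhoP (below_refl l) (@below_trans _ l) (unitmx1 _ _)).
- by apply: image_subset => g [].
have [s sP] := sorting_permutation.
have Ua : (perm_mx s : 'M[k]_r) \in unitmx by apply: unitmx_perm.
exists (rho @` borel_of Q (perm_mx s));
  first exact: (borel_of_borel rhoP r_gt0 Ua).
apply: image_subset => g [Hg lg]; apply/pattern1E; split=> // i j gij.
have conjE a b : (perm_mx s *m g *m invmx (perm_mx s)) a b = g (s a) (s b).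
  have -> : invmx (perm_mx s) = perm_mx s^-1 :> 'M[k]_r.
    by apply: (can_inj (mulKmx Ua)); rewrite mulmxV // -perm_mxM mulgV perm_mx1.
  by rewrite -row_permE -col_permE !mxE.
have := lg (s^-1 i)%g (s^-1 j)%g; rewrite conjE !permKV => /(_ gij).
by move/sP; rewrite !permKV.
Qed.

Lemma block_group_proper i j : (l i < l j)%N -> block_group <> rho @` H.
Proof.
move=> ij PH; pose x : 'M[k]_r := 1%:M + delta_mx i 0 *m (delta_mx 0 j : 'rV_r).
have nij : i != j by apply: contraTneq ij => ->; rewrite ltnn.
have ortho : (delta_mx 0 j : 'rV[k]_r) *m (delta_mx i 0 : 'cV_r) = 0.
  by rewrite mul_delta_mx_0 // eq_sym.
have Hx : H x by apply/(det_subgroup_SL rhoP)/(transvection_det char2).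
have : block_group (rho x) by rewrite PH; exists x.
move/(image_pattern_supported (det_subgroup_unit Hx)) => sx.
have : x i j != 0.
  by rewrite /x mul_delta_mx !mxE (negPf nij) add0r !eqxx oner_eq0.
by move/sx; rewrite /below leqNgt ij.
Qed.

End Levels.
End Structure.

(** * Quasi-isolated elements of the coset of sigma *)

Section Extension.
Variables (k : closedFieldType) (r n : nat) (rho : 'M[k]_r -> 'M[k]_n).
Variables (Q : k -> Prop) (scal : bool).
Hypothesis rhoP : central_quotient rho Q scal.
Hypothesis r_gt0 : (0 < r)%N.
Hypothesis char2 : 2%N \in [pchar k].
Local Notation H := (det_subgroup (k := k) (r := r) Q).
Variable E : extension rho H.
Local Notation pattern1 R := (pattern Q R 1%:M).
Local Notation J := (sigmaJ k r).
Implicit Types g h : 'M[k]_r.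

Lemma det_subgroup_sigma g : H g -> H (sigma_aut g).
Proof.
move=> Hg; have [Ug Qg] := Hg; split.
  by have [_ sU _] := sigma_aut_mult char2 r; apply: sU.
rewrite sigma_aut_det //.
by apply: det_conditionV Qg; apply: central_det rhoP.
Qed.

Lemma incl_rhoM g h : H g -> H h ->
  Defs.incl E (rho (g *m h)) = (Defs.incl E (rho g) * Defs.incl E (rho h))%g.
Proof.
move=> Hg Hh; rewrite (rhoM rhoP (det_subgroup_unit Hg) (det_subgroup_unit Hh)).
by rewrite inclM.
Qed.

Lemma incl_rho_inj g h : H g -> H h ->
  Defs.incl E (rho g) = Defs.incl E (rho h) -> rho g = rho h.
Proof. by move=> Hg Hh; apply: (@Defs.incl_inj _ _ _ _ _ E); rewrite inE;
  [exists g | exists h]. Qed.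

Lemma incl1 : Defs.incl E 1%:M = 1%g.
Proof.
have [r1 _ _] := central_mult rhoP; have H1 := subgroup1 (det_subgroupP rhoP).
have := incl_rhoM H1 H1; rewrite mulmx1 r1 => /esym e.
by apply: (mulgI (Defs.incl E 1%:M)); rewrite e mulg1.
Qed.

Lemma sigma_incl g : H g ->
  (sigma E * Defs.incl E (rho g))%g = (Defs.incl E (rho (sigma_aut g)) * sigma
    E)%g.
Proof. by move=> Hg; rewrite -(sigmaE E Hg) mulgKV. Qed.

Lemma sigma_centralizerE g : H g ->
  centralizer (sigma E) (rho g) <-> rho (sigma_aut g) = rho g.
Proof.
move=> Hg; split=> [[_]|sg].
  rewrite sigma_incl // => /mulIg /esym eg.
  by apply: incl_rho_inj => //; apply: det_subgroup_sigma.
by split; [exists g | rewrite sigma_incl // sg].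
Qed.

Lemma stabilizes_image (X : set 'M[k]_r) : X `<=` H ->
  (forall g, X g -> X (sigma_aut g)) -> stabilizes (sigma E) (rho @` X).
Proof.
move=> XH sX; apply/seteqP; split=> _ [_ [g Xg <-] <-].
  by exists (rho (sigma_aut g)); [exists (sigma_aut g) => //;
    apply: sX | rewrite (sigmaE E (XH g Xg))].
have [Ug _] := XH g Xg; exists (rho (sigma_aut g)).
  by exists (sigma_aut g) => //; apply: sX.
by rewrite (sigmaE E (XH _ (sX g Xg))) sigma_autK.
Qed.

Lemma sigma_pattern (R : rel 'I_r) : reflexive R -> transitive R ->
  (forall i j, R (rev_ord j) (rev_ord i) -> R i j) ->
  stabilizes (sigma E) (rho @` pattern1 R).
Proof.
move=> Rr Rt Rrev; apply: stabilizes_image => [g []//|g].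
move=> /pattern1E[Hg Rg]; apply/pattern1E; split;
  first exact: det_subgroup_sigma.
move=> i j; rewrite sigma_autE // => gij; apply: Rrev.
exact: (supportedV Rr Rt (det_subgroup_unit Hg) Rg).
Qed.

Lemma sigma_quasi_semisimple : quasi_semisimple (sigma E).
Proof.
exists (rho @` pattern1 (same val)), (rho @` borel_of Q 1%:M); split.
- exact: (diagonal_maximal_torus rhoP).
- exact: (borel_of_borel rhoP r_gt0 (unitmx1 _ _)).
- apply: image_subset => g [Hg sg]; split=> //.
  exact: supported_sub (@same_below _ val) sg.
- apply: sigma_pattern; [exact: same_refl | exact: same_trans|].
  by move=> i j; rewrite /same !val_eqE (inj_eq rev_ord_inj) eq_sym.
- apply: sigma_pattern; [exact: lower_refl | exact: lower_trans|].
  move=> i j; rewrite /lower /below /= => /(leq_sub2l r).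
  by rewrite !subKn.
Qed.

(** A sigma-stable parabolic subgroup P over the centralizer of sigma is the
    whole group. It contains the transvections along a line f fixed by one of
    its Borel subgroups, and the transvections that preserve the form J; hence
    all of them by transvections_in, and so the image of SL. Its Borel subgroups
    contain elements of all the determinants that occur in H. *)
Lemma sigma_quasi_isolated : quasi_isolated (sigma E).
Proof.
move=> [P [L [[[sgP _] PG [B borelB BP]] PnG sP levPL [sL cenL]]]].
have [_ LP _] := levPL.
have [a Ua BE] := borel_classification rhoP r_gt0 borelB.
apply: PnG; pose K : set 'M[k]_r := [set g | H g /\ P (rho g)].
have sgH := det_subgroupP (r := r) rhoP.
have sgK : subgroup K by apply: subgroup_preimage sgH (rho_mult rhoP) sgP.
have sigK g : K g -> K (sigma_aut g).
  move=> [Hg Pg]; split; first exact: det_subgroup_sigma.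
  have : [set (sigma E * Defs.incl E x * (sigma E)^-1)%g | x in P]
      (Defs.incl E (rho (sigma_aut g))) by exists (rho g) => //; apply: sigmaE.
  rewrite sP => -[x Px]; have [h Hh hx] := PG x Px; rewrite -hx.
  move/(incl_rho_inj Hh (det_subgroup_sigma Hg)) => <-.
  by rewrite hx.
have KB g : borel_of Q a g -> K g.
  by move=> Bg; split; [case: Bg | apply: BP; rewrite BE; exists g].
pose m := rev_ord (Ordinal r_gt0).
pose f : 'cV[k]_r := invmx a *m delta_mx m 0.
have Ua' : invmx a \in unitmx by rewrite unitmx_inv.
have f0 : f != 0.
  apply/eqP => /(congr1 (mulmx a)); rewrite mulKVmx // mulmx0.
  by move/colP/(_ m)/eqP; rewrite !mxE !eqxx oner_eq0.
have Kf (phi : 'rV_r) : phi *m f = 0 -> K (1%:M + f *m phi).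
  move=> phif; apply: KB; split.
    exact/(det_subgroup_SL rhoP)/(transvection_det char2).
  rewrite conj_transvection // /f mulKVmx //.
  apply: supportedD; first exact/supported1/lower_refl.
  move=> i j; rewrite mxE big_ord1 mulf_eq0 negb_or mxE => /andP[im _].
  have -> : i = m by apply/eqP; move: im; case: (i == m); rewrite ?eqxx.
  rewrite /lower /below /= subn1 -ltnS prednK //.
have Ku (u : 'cV_r) : u^T *m J *m u = 0 -> K (1%:M + u *m (u^T *m J)).
  move=> uu; set t := 1%:M + _.
  have Ht : H t by apply/(det_subgroup_SL rhoP)/(transvection_det char2).
  split=> //; apply/LP/cenL/sigma_centralizerE => //; congr rho.
  apply/(sigma_aut_fixed char2 (det_subgroup_unit Ht)).
  pose M := J *m u *m (u^T *m J).
  have tTJ : t^T *m J = J + M.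
    rewrite /t linearD /= trmx1 !trmx_mul trmxK (trJ char2).
    by rewrite mulmxDl mul1mx /M !mulmxA.
  have Mu : M *m u = 0 by rewrite /M -!mulmxA (mulmxA u^T) uu !mulmx0.
  rewrite tTJ /t mulmxDr mulmx1 mulmxA [(J + M) *m u]mulmxDl Mu addr0 -/M.
  by rewrite -addrA (addmm char2) addr0.
have transv := transvections_in char2 sgK sigK f0 Kf Ku.
have KSL := transvections_generate (subgroupM sgK) transv.
apply/seteqP; split=> // _ [g Hg <-].
suff [] : K g by [].
pose d : 'M[k]_r := diag_mx (\row_i (if i == m then \det g else 1)).
have detd : \det d = \det g.
  rewrite det_diag (bigD1 m) //= mxE eqxx big1 ?mulr1 // => i im.
  by rewrite mxE (negPf im).
have detb : \det (invmx a *m d *m a) = \det g.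
  by have := det_conj d Ua'; rewrite invmxK detd.
have Ug := det_subgroup_unit Hg.
have Ub : invmx a *m d *m a \in unitmx by rewrite unitmxE detb -unitmxE.
rewrite -(mulmxKV Ub g); apply: (subgroupM sgK).
  by apply: KSL; rewrite det_mulmx det_inv detb mulfV // -unitfE -unitmxE.
apply: KB; split; first exact: det_subgroup_eqdet Hg.
rewrite !mulmxA mulmxV // mul1mx mulmxK //.
move=> i j; rewrite mxE; case: (eqVneq i j) => [->|]; rewrite ?mulr0n ?eqxx //.
by move=> _; apply: lower_refl.
Qed.

(** Applying t sigma twice: if g is fixed by t sigma up to a scalar c, then it
    is fixed by (t sigma)^2, where the scalars c and 1 / c cancel. *)
Lemma centralizer_commutes_square d g : H d -> H g ->
  rho (sigma_aut d) = rho d ->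
  centralizer (Defs.incl E (rho d) * sigma E)%g (rho g) ->
  g *m (d *m d) = d *m d *m g.
Proof.
move=> Hd Hg sd [_ cen].
have [Ud Ug] := (det_subgroup_unit Hd, det_subgroup_unit Hg).
have [s1 sU sM] := sigma_aut_mult char2 r.
have [Hsd Hsg] := (det_subgroup_sigma Hd, det_subgroup_sigma Hg).
have sgH := det_subgroupP (r := r) rhoP.
have [Usd Usg] := (det_subgroup_unit Hsd, det_subgroup_unit Hsg).
have : rho (g *m d) = rho (d *m sigma_aut g).
  apply: incl_rho_inj; [exact: (subgroupM sgH)|exact: (subgroupM sgH)|].
  rewrite (incl_rhoM Hg Hd) (incl_rhoM Hd Hsg); apply: (mulIg (sigma E)).
  by rewrite -!mulgA -sigma_incl // cen mulgA.
have [Ugd Udsg] : g *m d \in unitmx /\ d *m sigma_aut g \in unitmx.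
  by split; rewrite unitmx_mul; apply/andP.
move/(central_ker rhoP Ugd Udsg) => [c [c0 _ gd]].
have : rho d = rho (sigma_aut d) by [].
move/(central_ker rhoP Ud Usd) => [e [e0 _ de]].
have sZ x : x \in unitmx -> sigma_aut (c *: x) = c^-1 *: sigma_aut x.
  move=> Ux; rewrite /sigma_aut invmxZ ?unitmxZ ?unitfE //.
  by rewrite linearZ /= -scalemxAr -scalemxAl.
have := congr1 (@sigma_aut k r) gd;
  rewrite sZ // (sM g d) // (sM d (sigma_aut g)) // sigma_autK //.
have sdE : sigma_aut d = e^-1 *: d by rewrite [in RHS]de scalerA mulVf //
  scale1r.
rewrite sdE -scalemxAr -scalemxAl scalerA [c^-1 * _]mulrC -scalerA.
have eV0 : e^-1 != 0 by rewrite invr_eq0.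
move/(scalerI eV0) => sgd.
by rewrite mulmxA gd -!scalemxAl -mulmxA sgd -scalemxAr scalerA mulfV //
  scale1r mulmxA.
Qed.

(** Since sigma fixes rho d, the product of mirror entries of d is a constant 1
    / e. If mirror entries are always equal, then all the entries have the same
    square, and d is scalar. Otherwise let mu and mu' be distinct mirror
    entries, and divide the coordinates into those of entry mu, those of entry
    mu', and the rest. The Levi subgroup of this division is sigma-stable,
    because sigma exchanges the first two classes, and contains the centralizer
    of rho d sigma, because g commutes with d^2 and squaring is injective. *)
Lemma quasi_isolated_trivial d : H d -> is_diag_mx d ->
  rho (sigma_aut d) = rho d ->
  quasi_isolated (Defs.incl E (rho d) * sigma E)%g -> rho d = 1%:M.
Proof.
move=> Hd /is_diag_mxP diagd sd qi; have Ud := det_subgroup_unit Hd.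
have dE : d = diag_mx (\row_i d i i).
  apply/matrixP => i j; rewrite !mxE; case: (eqVneq i j) => [->//|ij].
  by rewrite mulr0n diagd.
have [r1 _ _] := central_mult rhoP.
have [e [e0 se]] : exists e, [/\ e != 0, scal || (e == 1) &
    forall i, e * (d i i * d (rev_ord i) (rev_ord i)) = 1].
  have Usd := det_subgroup_unit (det_subgroup_sigma Hd).
  move/(central_ker rhoP Usd Ud): sd => [e [e0 sc sE]]; exists e; split=> // i.
  have dV : (invmx d *m d) (rev_ord i) (rev_ord i) = 1.
    by rewrite mulVmx // mxE eqxx.
  move: dV; rewrite {2}dE mul_mx_diag !mxE -[X in invmx d X X]/(rev_ord i).
  rewrite -(sigma_autE char2) sE mxE => <-; ring.
move=> erev.
have dneq0 i : d i i != 0.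
  apply: contra_eq_neq (erev i) => ->.
  by rewrite mul0r mulr0 eq_sym oner_eq0.
have [[i di]|same_rev] :=
    pselect (exists i, d i i != d (rev_ord i) (rev_ord i)); last first.
  have drev i : d (rev_ord i) (rev_ord i) = d i i.
    by apply/eqP; rewrite eq_sym; apply/negPn/negP => nd; apply: same_rev;
      exists i.
  pose z := d (Ordinal r_gt0) (Ordinal r_gt0).
  have dz i : d i i = z.
    apply: (sqr_inj char2); rewrite !expr2; apply: (mulfI e0).
    by have := erev i; have := erev (Ordinal r_gt0); rewrite !drev => -> ->.
  have d_scalar : d = z *: 1%:M.
    apply/matrixP => i j; rewrite {1}dE !mxE dz.
    by case: (i == j); rewrite ?mulr1 ?mulr0n ?mulr0.
  have z0 : z != 0 by apply: dneq0.
  have [sc|nsc] := boolP scal.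
    by rewrite d_scalar (rhoZ rhoP) ?sc ?unitmx1 // r1.
  move: se erev; rewrite (negPf nsc) => /= /eqP-> erev.
  have z1 : z = 1.
    apply: (sqr_inj char2); rewrite expr1n expr2.
    by have := erev (Ordinal r_gt0); rewrite drev mul1r.
  by rewrite d_scalar z1 scale1r r1.
case: qi; set mu := d i i; set mu' := d (rev_ord i) (rev_ord i).
pose l j : nat := if d j j == mu then 0%N else if d j j == mu' then 2 else 1%N.
have mumu : e * (mu * mu') = 1 := erev i.
have rev_mu j : (d (rev_ord j) (rev_ord j) == mu') = (d j j == mu).
  apply/eqP/eqP => dj; have := erev j; rewrite -mumu => /(mulfI e0).
    by rewrite dj => /(mulIf (dneq0 _)).
  by rewrite dj => /(mulfI (dneq0 _)).
have rev_mu' j : (d (rev_ord j) (rev_ord j) == mu) = (d j j == mu').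
  by rewrite -(rev_mu (rev_ord j)) rev_ordK.
have lrev j : l (rev_ord j) = (2 - l j)%N.
  rewrite /l rev_mu rev_mu'; case: (eqVneq (d j j) mu) => [->|_].
    by rewrite (negPf di).
  by case: (d j j == mu').
have l2 j : (l j <= 2)%N by rewrite /l; case: ifP => // _; case: ifP.
exists (block_group rho Q l), (block_levi rho Q l); split.
- exact: (block_group_parabolic rhoP r_gt0).
- apply: (block_group_proper rhoP char2 (i := i) (j := rev_ord i)).
  by rewrite lrev /l eqxx.
- apply: sigma_pattern; [exact: below_refl | exact: below_trans|].
  by move=> a b; rewrite /below !lrev => /(leq_sub2l 2); rewrite !subKn.
- exact: (block_group_levi rhoP r_gt0 char2).
split.
  apply: sigma_pattern; [exact: same_refl | exact: same_trans|].
  move=> a b; rewrite /same !lrev => /eqP/(congr1 (subn 2)).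
  by rewrite !subKn // => ->.
move=> x cenx; have [[g Hg gx] _] := cenx; rewrite -gx in cenx *.
exists g => //; apply/pattern1E; split=> // a b gab.
have dd : d *m d = diag_mx (\row_j d j j ^+ 2).
  rewrite {1 2}dE; apply/matrixP => u v; rewrite mul_diag_mx !mxE.
  by case: (u == v); rewrite ?mulr1n ?expr2 // !mulr0n mulr0.
have := centralizer_commutes_square Hd Hg sd cenx.
rewrite dd mul_mx_diag mul_diag_mx => /matrixP/(_ a b).
rewrite !mxE mulrC => /(mulIf gab) /(sqr_inj char2) dab.
by rewrite /same /l dab.
Qed.

Theorem sigma_only_quasi_isolatedP : sigma_only_quasi_isolated E.
Proof.
have [r1 _ _] := central_mult rhoP.
move=> C; split=> [[t [tT _ _ -> qi]]|->].
  have [X [XT _ _ Xt]] := tT.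
  have [[d [Hd diagd] dt] cent] := XT t Xt; rewrite -dt in qi cent *.
  move/(sigma_centralizerE Hd) in cent.
  by rewrite (quasi_isolated_trivial Hd diagd cent qi) incl1 mul1g.
exists 1%:M; rewrite incl1 mul1g; split=> //.
- exists [set 1%:M]; split=> //; last exact: zconnected1.
  have H1 := subgroup1 (det_subgroupP (r := r) rhoP).
  move=> _ ->; split.
    by exists 1%:M => //; split=> //; apply/is_diag_mxP => i j ij;
      rewrite mxE -val_eqE (negPf ij).
  rewrite -r1; apply/sigma_centralizerE => //.
  by have [-> _ _] := sigma_aut_mult char2 r.
- exact: sigma_finite.
- exact: sigma_quasi_semisimple.
- exact: sigma_quasi_isolated.
Qed.

End Extension.

(** * The symplectic group as a centralizer *)

Section Isometries.
Variable k : closedFieldType.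
Hypothesis char2 : 2%N \in [pchar k].

Definition isometries r : set 'M[k]_r := [set g |
  g^T *m sigmaJ k r *m g = sigmaJ k r].

Lemma symplectic_formE m : symplectic_form k m = sigmaJ k m.
Proof.
apply/matrixP => i j; rewrite !mxE; case: eqP => // _.
by rewrite (oppr_pchar2 char2) !if_same.
Qed.

Lemma isometry_det r g : isometries (r := r) g -> \det g = 1.
Proof.
move/(congr1 determinant); rewrite !det_mulmx det_tr mulrAC.
have J0 : \det (sigmaJ k r) != 0 by rewrite -unitfE -unitmxE unitJ.
rewrite -[RHS]mul1r => /(mulIf J0) det2.
by apply: (sqr_inj char2); rewrite expr1n expr2.
Qed.

Lemma sum_alternating r (f : 'I_r -> k) :
  \sum_(a | rev_ord a != a) f a * f (rev_ord a) = 0.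
Proof.
pose P (a : 'I_r) := (a < rev_ord a)%N.
rewrite (bigID P) /= [X in _ + X](reindex_inj rev_ord_inj).
rewrite [X in _ + X](eq_big (fun a => (rev_ord a != a) && P a)
  (fun a => f a * f (rev_ord a))) ?addxx // => a.
  rewrite /P rev_ordK [a == _]eq_sym.
  have [//|/negPf ra] := eqVneq (rev_ord a) a.
  rewrite -leqNgt leq_eqVlt [X in X || _](_ : _ = false) //.
  by rewrite [LHS]eq_sym; apply: contraFF ra => /eqP/val_inj ->.
by rewrite rev_ordK mulrC.
Qed.

(** Sp_n embeds in the isometry group of dimension n + 1 as the pointwise
    stabilizer of the middle basis vector e. Conversely, in characteristic 2 the
    form x^T J x of odd dimension is the square of the middle coordinate, which
    every isometry therefore preserves. *)
Section Odd.
Variable n : nat.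
Hypothesis even_n : ~~ odd n.

Let c : 'I_n.+1 := inord n./2.
Let E : 'M[k]_(n, n.+1) := rowsub (lift c) 1%:M.
Let e : 'cV[k]_n.+1 := delta_mx c 0.
Local Notation J := (sigmaJ k n.+1).

Definition embed (g : 'M[k]_n) : 'M[k]_n.+1 := E^T *m g *m E + e *m e^T.

Lemma coord_mul_tr : E *m E^T = 1%:M.
Proof.
rewrite /E mul_rowsub_mx mul1mx; apply/matrixP => a b.
by rewrite !mxE (inj_eq lift_inj) eq_sym.
Qed.

Lemma coord_middle : E *m e = 0.
Proof.
rewrite /E mul_rowsub_mx mul1mx; apply/matrixP => a b.
by rewrite !mxE eq_sym (negPf (neq_lift _ _)).
Qed.

Lemma middle_dot : e^T *m e = 1%:M.
Proof.
rewrite /e trmx_delta mul_delta_mx; apply/matrixP => a b.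
by rewrite !ord1 !mxE.
Qed.

Lemma middle_coord : e^T *m E^T = 0. Proof. by rewrite -trmx_mul coord_middle
  trmx0. Qed.

Lemma coord_split : E^T *m E + e *m e^T = 1%:M.
Proof.
apply/matrixP => i j; rewrite mxE.
have -> : (e *m e^T) i j = ((i == c) && (j == c))%:R.
  by rewrite /e trmx_delta mul_delta_mx mxE.
have -> : (E^T *m E) i j = \sum_a ((lift c a == i) && (lift c a == j))%:R.
  by rewrite mxE; apply: eq_bigr => a _; rewrite !mxE -natrM mulnb.
case: (unliftP c i) => [b|] ->.
  rewrite (bigD1 b) //= eqxx big1 => [|a ab]; last first.
    by rewrite (inj_eq lift_inj) (negPf ab).
  by rewrite [lift c b == c]eq_sym (negPf (neq_lift _ _)) /= !addr0 mxE.
rewrite big1 => [|a _];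
  last by rewrite [lift c a == c]eq_sym (negPf (neq_lift _ _)).
by rewrite eqxx add0r mxE eq_sym.
Qed.

Lemma middle_double : (c + c)%N = n.
Proof.
have := odd_double_half n; rewrite (negPf even_n) add0n -addnn => nE.
by rewrite /c inordK // ltnS -[X in (_ <= X)%N]nE leq_addl.
Qed.

Lemma rev_middle : rev_ord c = c.
Proof. by apply: val_inj => /=; have := middle_double; lia. Qed.

Lemma rev_lift (a : 'I_n) : rev_ord (lift c a) = lift c (rev_ord a).
Proof.
apply: val_inj; rewrite /= /bump; have := middle_double; have := ltn_ord a; lia.
Qed.

Lemma J_middle : J *m e = e.
Proof.
by apply/matrixP => i j;
  rewrite mulJmx // !mxE -{1}rev_middle (inj_eq rev_ord_inj).
Qed.

Lemma coord_J : E *m J *m E^T = sigmaJ k n.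
Proof.
apply/matrixP => a b; rewrite /E mul_rowsub_mx mul1mx.
have -> : (rowsub (lift c) J *m (rowsub (lift c) 1%:M)^T) a b = J (lift c a)
  (lift c b).
  rewrite mxE (bigD1 (lift c b)) //= big1 => [|j jb].
    by rewrite !mxE eqxx mulr1 addr0.
  by rewrite !mxE [lift c b == j]eq_sym (negPf jb) mulr0.
by rewrite !sigmaJE // rev_lift (inj_eq lift_inj).
Qed.

Lemma embedM g h : embed g *m embed h = embed (g *m h).
Proof.
rewrite /embed mulmxDl !mulmxDr.
have -> : E^T *m g *m E *m (E^T *m h *m E) = E^T *m (g *m h) *m E.
  by rewrite -!mulmxA (mulmxA E) coord_mul_tr mul1mx.
have -> : E^T *m g *m E *m (e *m e^T) = 0.
  by rewrite -!mulmxA (mulmxA E) coord_middle mul0mx !mulmx0.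
have -> : e *m e^T *m (E^T *m h *m E) = 0.
  by rewrite -!mulmxA (mulmxA e^T) middle_coord mul0mx !mulmx0.
have -> : e *m e^T *m (e *m e^T) = e *m e^T.
  by rewrite -!mulmxA (mulmxA e^T) middle_dot mul1mx.
by rewrite addr0 add0r.
Qed.

Lemma embedK : cancel embed (fun h => E *m h *m E^T).
Proof.
move=> g; rewrite /embed mulmxDr mulmxDl.
have -> : E *m (e *m e^T) *m E^T = 0 by rewrite !mulmxA coord_middle !mul0mx.
by rewrite addr0 !mulmxA coord_mul_tr mul1mx -mulmxA coord_mul_tr mulmx1.
Qed.

Lemma embed_tr g : (embed g)^T = embed g^T.
Proof. by rewrite /embed linearD /= !trmx_mul !trmxK !mulmxA. Qed.

Lemma embed_fixing h : h *m e = e -> e^T *m h = e^T -> embed (E *m h *m E^T) =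
  h.
Proof.
move=> he eh; have EtE : E^T *m E = 1%:M - e *m e^T by rewrite -coord_split
  addrK.
rewrite /embed (_ : _ *m E = E^T *m E *m h *m (E^T *m E));
  last by rewrite !mulmxA.
rewrite EtE mulmxBl mul1mx -(mulmxA e) eh mulmxBr mulmx1 mulmxBl.
rewrite (mulmxA h) he -(mulmxA e) (mulmxA e^T) middle_dot mul1mx.
by rewrite subrr subr0 subrK.
Qed.

Lemma embed_J : embed (sigmaJ k n) = J.
Proof. by rewrite -coord_J embed_fixing ?J_middle // -{1}trJ // -trmx_mul
  J_middle. Qed.

Lemma isometry_fixing h : isometries h -> h *m e = e /\ e^T *m h = e^T.
Proof.
move=> hJh; have eh : e^T *m h = e^T.
  apply/matrixP => i j; rewrite !ord1 /e trmx_delta -rowE !mxE eqxx /=.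
  apply: (sqr_inj char2).
  have rev_fix a : (rev_ord a == a) = (a == c).
    by apply/eqP/eqP => [/(congr1 val) /= ra|->]; [apply: val_inj;
      have := middle_double; have := ltn_ord a; rewrite /=;
        lia | exact: rev_middle].
  have sum0 : \sum_(a | a != c) h a j * h (rev_ord a) j = 0.
    rewrite -[RHS](sum_alternating (fun a => h a j)).
    by apply: eq_bigl => a; rewrite rev_fix.
  have /matrixP/(_ j j) := hJh; rewrite -mulmxA mxE.
  have -> : \sum_a h^T j a * (J *m h) a j = \sum_a h a j * h (rev_ord a) j.
    by apply: eq_bigr => a _; rewrite mxE mulJmx.
  rewrite (bigD1 c) //= sum0 addr0 rev_middle sigmaJE // eq_sym rev_fix expr2
    => ->.
  by case: (j == c); rewrite ?expr1n // expr0n.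
split=> //; have hV : h *m (J *m h^T *m J) = 1%:M.
  by apply: mulmx1C; rewrite -!mulmxA (mulmxA h^T) hJh mulJJ.
have <- : (J *m h^T *m J) *m e = e.
  by rewrite -!mulmxA J_middle -[h^T *m e]trmxK trmx_mul trmxK eh trmxK
    J_middle.
by rewrite mulmxA hV mul1mx -!mulmxA J_middle -[h^T *m e]trmxK trmx_mul trmxK
  eh trmxK J_middle.
Qed.

Lemma embed_bij : set_bij (Sp k n) (isometries (r := n.+1)) embed.
Proof.
split.
- move=> g; rewrite /Sp /isometries /= symplectic_formE => gJ.
  by rewrite -embed_J embed_tr !embedM gJ.
- by move=> g h _ _ /(can_inj embedK).
- move=> h hJh; have [he eh] := isometry_fixing hJh.
  exists (E *m h *m E^T); last exact: embed_fixing.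
  rewrite /Sp /= symplectic_formE; apply: (can_inj embedK).
  by rewrite -!embedM -embed_tr embed_J embed_fixing.
Qed.

End Odd.

End Isometries.

Section CentralizerIsomorphism.
Variables (k : closedFieldType) (r n : nat) (rho : 'M[k]_r -> 'M[k]_n).
Variables (Q : k -> Prop) (scal : bool).
Hypothesis rhoP : central_quotient rho Q scal.
Hypothesis r_gt0 : (0 < r)%N.
Hypothesis char2 : 2%N \in [pchar k].
Variable E : extension rho (det_subgroup (k := k) (r := r) Q).

Lemma isometry_subgroup g : isometries (k := k) (r := r) g -> det_subgroup Q g.
Proof. by move/(isometry_det char2)/(det_subgroup_SL rhoP). Qed.

(** An element fixed by sigma up to a scalar c becomes an isometry when it is
    multiplied by a square root of c. *)
Lemma sigma_centralizer_image :
  centralizer (sigma E) = rho @` isometries (k := k) (r := r).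
Proof.
apply/seteqP; split=> [x cx|_ [g Og <-]].
  have [[g Hg gx] _] := cx; have Ug := det_subgroup_unit Hg.
  move: cx; rewrite -gx => /(sigma_centralizerE rhoP char2 E Hg).
  have Usg := det_subgroup_unit (det_subgroup_sigma rhoP char2 Hg).
  move/(central_ker rhoP Usg Ug) => [c [c0 sc sg]].
  have [a ac] := root_exists c (ltn0Sn 1).
  have a0 : a != 0 by apply: contraNneq c0 => a0; rewrite -ac a0 expr0n.
  have sa : scal || (a == 1).
    move: sc; have [//|_ /= /eqP c1] := boolP scal; apply/eqP.
    by apply: (sqr_inj char2); rewrite ac c1 expr1n.
  have Uag : a *: g \in unitmx by rewrite unitmxZ // unitfE.
  exists (a *: g); last by rewrite (rhoZ rhoP).
  apply/(sigma_aut_fixed char2 Uag); rewrite /sigma_aut invmxZ //.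
  rewrite linearZ /= -scalemxAr -scalemxAl -/(sigma_aut g) sg scalerA -ac expr2.
  by rewrite mulrA mulVf // mul1r.
have Hg := isometry_subgroup Og.
apply/(sigma_centralizerE rhoP char2 E Hg); congr rho.
exact/(sigma_aut_fixed char2 (det_subgroup_unit Hg)).
Qed.

Lemma rho_isometries_inj g h : isometries g -> isometries h ->
  rho g = rho h -> g = h.
Proof.
move=> Og Oh; have Ug := det_subgroup_unit (isometry_subgroup Og).
have Uh := det_subgroup_unit (isometry_subgroup Oh).
move/(central_ker rhoP Ug Uh) => [c [_ _ gh]].
suff c1 : c = 1 by rewrite gh c1 scale1r.
apply: (sqr_inj char2); rewrite expr1n.
have : isometries (c *: h) by rewrite -gh.
rewrite /isometries /= [(c *: h)^T]linearZ /= -!scalemxAl -scalemxAr scalerA Oh.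
pose i0 := Ordinal r_gt0; move/matrixP/(_ i0 (rev_ord i0)).
by rewrite mxE sigmaJE // eqxx mulr1 expr2.
Qed.

Theorem sigma_centralizer_symplecticP : sigma_centralizer_symplectic E.
Proof.
rewrite /sigma_centralizer_symplectic sigma_centralizer_image.
have [f [f_fun f_inj f_surj] fM] : exists2 f : 'M[k]_(if odd r then r.-1 else
  r) -> 'M[k]_r,
    set_bij (Sp k _) (isometries (k := k) (r := r)) f & forall g h,
      f (g *m h) = f g *m f h.
  case: ifPn => odd_r.
    case: (r) odd_r => // m odd_m; exists (@embed k m).
      by apply: embed_bij => //; move: odd_m; rewrite /= => ->.
    by move=> g h; rewrite embedM.
  exists id => //; split=> [g|g h _ _|g Og] //.
    by rewrite /Sp /= symplectic_formE.
  by exists g => //; rewrite /Sp /= symplectic_formE.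
have SpO g : Sp k (if odd r then r.-1 else r) g -> isometries (f g) by apply:
  f_fun.
exists (rho \o f); first split.
- by move=> g /SpO Og; exists (f g).
- move=> g h; rewrite !inE => Sg Sh /(rho_isometries_inj (SpO g Sg) (SpO h Sh)).
  by apply: f_inj; rewrite inE.
- by move=> _ [g /f_surj[x Sx <-] <-]; exists x.
move=> g h /SpO/isometry_subgroup[Ug _] /SpO/isometry_subgroup[Uh _].
by rewrite /= fM (rhoM rhoP).
Qed.

End CentralizerIsomorphism.

(** * GL, SL and PGL *)

Section Instances.
Variable k : closedFieldType.

Lemma inclusion_central_quotient r (Q : k -> Prop) :
  det_condition Q ->
  (exists2 Y, zclosed Y & det_subgroup (r := r) Q = GL k r `&` Y) ->
  central_quotient (fun g : 'M[k]_r => g) Q false.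
Proof.
move=> Qdet [Y clY YE]; split=> //.
- move=> g h _ _; split=> [->|[c [_ /= /eqP-> ->]]]; last exact: scale1r.
  by exists 1; rewrite oner_eq0 eqxx scale1r.
- by move=> i j; apply: regular_entry.
- by move=> Z clZ _; exists Z.
- by exists Y; rewrite ?image_id.
- move=> B; rewrite image_id => BH conB.
  rewrite (_ : [set g | _] = B) //; apply/seteqP; split=> [g []//|g Bg].
  by split=> //; apply: BH.
Qed.

Lemma GL_condition : det_condition (fun _ : k => True). Proof. by []. Qed.

Lemma SL_condition : det_condition (fun c : k => c = 1).
Proof.
split=> // [a b -> ->|a ->|a s -> _]; first exact: mulr1.
  exact: invr1.
by rewrite subrr mulr0 addr0.
Qed.

Lemma GL_det_subgroup r : GL k r = det_subgroup (fun _ : k => True).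
Proof. by apply/seteqP; split=> g //= []. Qed.

Lemma SL_det_subgroup r : SL k r = det_subgroup (fun c : k => c = 1).
Proof.
apply/seteqP; split=> g /= => [g1|[]//].
by split=> //; rewrite unitmxE g1 unitr1.
Qed.

Lemma GL_central_quotient r :
  central_quotient (fun g : 'M[k]_r => g) (fun _ : k => True) false.
Proof.
apply: inclusion_central_quotient GL_condition _.
exists setT; last by rewrite setIT GL_det_subgroup.
by exists set0; apply/seteqP; split=> // A _ q.
Qed.

Lemma SL_central_quotient r :
  central_quotient (fun g : 'M[k]_r => g) (fun c : k => c = 1) false.
Proof.
apply: inclusion_central_quotient SL_condition _.
exists [set g | \det g - 1 = 0].
  have [Pc PD _] := polyfun_ring k r;
    apply: (zclosed_zero (f := fun g => \det g - 1)).
  apply: PD => //; apply: fring_det (polyfun_ring k r) _ _ _.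
  exact: polyfun_entry.
apply/seteqP; split=> g /= [Ug g1]; split=> //; first by rewrite g1 subrr.
by apply/eqP; rewrite -subr_eq0 g1.
Qed.

Section Adjoint.
Variable r : nat.
Hypothesis r_gt0 : (0 < r)%N.
Implicit Types g h X : 'M[k]_r.

Lemma mul_Ad X g : mxvec X *m Ad g = mxvec (invmx g *m X *m g).
Proof. exact: (mul_vec_lin (mulmxr g \o mulmx (invmx g))). Qed.

Lemma mxvec_ext (A B : 'M[k]_(r * r)) :
  (forall X, mxvec X *m A = mxvec X *m B) -> A = B.
Proof.
move=> AB; apply/row_matrixP => i; rewrite !rowE.
by have := AB (vec_mx (delta_mx 0 i)); rewrite vec_mxK.
Qed.

Lemma Ad_entry g i j u v :
  Ad g (mxvec_index i j) (mxvec_index u v) = invmx g u i * g j v.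
Proof.
have := congr1 (fun x : 'rV_(r * r) =>
  x 0 (mxvec_index u v)) (mul_Ad (delta_mx i j) g).
rewrite mxvec_delta -rowE mxE => ->; rewrite mxvecE mxE (bigD1 j) //= big1.
  rewrite addr0 mxE (bigD1 i) //= big1; last first.
    by move=> a ai; rewrite mxE (negPf ai) mulr0.
  by rewrite mxE !eqxx mulr1 addr0.
move=> b bj; rewrite mxE big1 ?mul0r // => a _.
by rewrite mxE (negPf bj) andbF mulr0.
Qed.

Lemma Ad_mult : multiplicative_on (GL k r) (@Ad k r).
Proof.
have Ad1 : Ad (1%:M : 'M[k]_r) = 1%:M.
  by apply: mxvec_ext => X; rewrite mul_Ad invmx1 mul1mx !mulmx1.
have AdM g h : g \in unitmx -> h \in unitmx -> Ad (g *m h) = Ad g *m Ad h.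
  move=> Ug Uh; apply: mxvec_ext => X.
  by rewrite mulmxA !mul_Ad invmxM // !mulmxA.
split=> // g Ug; have Ug' : invmx g \in unitmx by rewrite unitmx_inv.
by have /mulmx1_unit[] : Ad g *m Ad (invmx g) = 1%:M by rewrite -AdM // mulmxV.
Qed.

Lemma central_scalar (y : 'M[k]_r) : (forall X, y *m X = X *m y) ->
  y = y (Ordinal r_gt0) (Ordinal r_gt0) *: 1%:M.
Proof.
move=> yX; set i0 := Ordinal r_gt0.
have swap a i j : y a i = y j j *+ (a == i).
  have /matrixP/(_ a j) := yX (delta_mx i j).
  rewrite mxE (bigD1 i) //= big1 => [|b bi]; last first.
    by rewrite mxE (negPf bi) mulr0.
  rewrite mxE !eqxx mulr1 addr0 => ->;
    rewrite mxE (bigD1 j) //= big1 => [|b bj].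
    by rewrite mxE eqxx andbT addr0 mulr_natl.
  by rewrite mxE (negPf bj) andbF mul0r.
by apply/matrixP => a i; rewrite (swap a i i0) !mxE mulr_natr.
Qed.

Lemma Ad_ker g h : g \in unitmx -> h \in unitmx ->
  Ad g = Ad h <-> exists c, [/\ c != 0, true || (c == 1) & g = c *: h].
Proof.
move=> Ug Uh; split=> [gh|[c [c0 _ ->]]]; last first.
  apply: mxvec_ext => X; rewrite !mul_Ad invmxZ ?unitmxZ ?unitfE //.
  by rewrite -!scalemxAl -scalemxAr scalerA mulVf // scale1r.
have Uh' : invmx h \in unitmx by rewrite unitmx_inv.
have cent X : (g *m invmx h) *m X = X *m (g *m invmx h).
  have := mul_Ad X g; rewrite gh mul_Ad => /(can_inj mxvecK) e.
  have := congr1 (fun x => g *m x *m invmx h) e.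
  by rewrite !mulmxA mulmxK // mulmxV // mul1mx.
have [c gc] : exists c, g *m invmx h = c *: 1%:M.
  by eexists; apply: central_scalar cent.
have gE : g = c *: h.
  by rewrite -[LHS](mulmxKV Uh) gc -scalemxAl mul1mx.
exists c; split=> //; apply: contraTneq Ug => c0; rewrite gE c0 scale0r.
by rewrite unitmxE unitfE -(scale0r (1%:M : 'M[k]_r)) detZ expr0n eqn0Ngt
  r_gt0 mul0r eqxx.
Qed.

Lemma Ad_regular : entrywise (regular (GL k r)) (@Ad k r).
Proof.
move=> s t; case/mxvec_indexP: s => i j; case/mxvec_indexP: t => u v.
rewrite (_ : (fun _ => _) = fun g => invmx g u i * g j v);
  last by apply: funext => g; apply: Ad_entry.
have [_ _ RM] := regular_ring (GL k r); apply: RM; last exact: regular_entry.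
exact: (regular_inverse (subgroup_GL k r)).
Qed.

Lemma Ad_diag g : g \in unitmx -> is_diag_mx g -> is_diag_mx (Ad g).
Proof.
move=> Ug /is_diag_mxP dg.
have sg : supported (same val) g.
  by move=> i j; apply: contraNT => ij; apply/eqP/dg.
have sV := supportedV (same_refl val) (@same_trans _ val) Ug sg.
apply/is_diag_mxP => s t; case/mxvec_indexP: s => i j;
  case/mxvec_indexP: t => u v.
rewrite Ad_entry => ij_uv; apply/eqP; rewrite mulf_eq0; apply: contraNT ij_uv.
by rewrite negb_or => /andP[/sV/eqP/val_inj -> /sg/eqP/val_inj ->].
Qed.

(** The entries of Ad g are the products of an entry of g^-1 and one of g. With
    the former fixed they form a scalar multiple of g, which lets one test a
    condition on g that is insensitive to scalars. *)
Definition slice (u i : 'I_r) (A : 'M[k]_(r * r)) : 'M[k]_r :=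
  \matrix_(j, v) A (mxvec_index i j) (mxvec_index u v).

Lemma slice_Ad u i g : slice u i (Ad g) = invmx g u i *: g.
Proof. by apply/matrixP => j v; rewrite [LHS]mxE Ad_entry [RHS]mxE. Qed.

Lemma Ad_push (Z : set 'M[k]_r) : zclosed Z ->
  (forall g c, g \in unitmx -> c != 0 -> true || (c == 1) -> Z g -> Z (c *:
    g)) ->
  exists2 Z', zclosed Z' & forall g, g \in unitmx -> Z' (Ad g) <-> Z g.
Proof.
move=> /zclosedP[S Spoly ->] satZ.
exists [set A | forall p : ('M[k]_r -> k) * ('I_r * 'I_r) * ('I_r * 'I_r),
    S p.1.1 -> p.1.1 (slice p.1.2.1 p.1.2.2 A) *
      slice p.1.2.1 p.1.2.2 A p.2.1 p.2.2 = 0].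
  apply: zclosed_bigcap => -[[f [u i]] [j v]] /= Sf.
  have pS : entrywise (@polyfun k (r * r)) (slice u i).
    move=> a b; under eq_fun do rewrite mxE; exact: polyfun_entry.
  apply: (zclosed_zero (f := fun A => f (slice u i A) * slice u i A j v)).
  have [_ _ PM] := polyfun_ring k (r * r); apply: PM => //.
  exact/polyfun_comp/Spoly.
move=> g Ug; have Ug' : invmx g \in unitmx by rewrite unitmx_inv.
split=> /= Zg; last first.
  move=> [[f [u i]] [j v]] /= Sf; rewrite slice_Ad mxE.
  have [->|c0] := eqVneq (invmx g u i) 0; first by rewrite mul0r mulr0.
  by rewrite (satZ g _ Ug c0 isT Zg f Sf) mul0r.
have nz (x : 'M[k]_r) : x \in unitmx -> exists i j, x i j != 0.
  move=> Ux; apply: contrapT => /forallNP x0; move: Ux.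
  rewrite unitmxE unitfE (_ : x = 0 *: 1%:M).
    by rewrite detZ expr0n eqn0Ngt r_gt0 mul0r eqxx.
  apply/matrixP => i j; rewrite scale0r [RHS]mxE; apply/eqP/negPn/negP => xij.
  by apply: (x0 i); exists j.
have [u [i c0]] := nz _ Ug'; have [j [v gjv]] := nz _ Ug.
have := satZ (invmx g u i *: g) (invmx g u i)^-1.
rewrite scalerA mulVf // scale1r; apply=> //.
- by rewrite unitmxZ // unitfE.
- by rewrite invr_eq0.
move=> f Sf; have := Zg (f, (u, i), (j, v)) Sf; rewrite /= slice_Ad mxE.
by move/eqP; rewrite !mulf_eq0 (negPf c0) (negPf gjv) !orbF => /eqP.
Qed.

(** By the Skolem-Noether theorem the image of Ad is defined by the condition
    that the linear map phi it acts by be multiplicative. If the row u phi(E_00)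
    is not zero, the matrix h of rows u phi(E_0i) satisfies h phi(X) = X h, so
    that its kernel is trivial and phi = Ad h. *)
Lemma Ad_image : exists2 Y, zclosed Y &
  @Ad k r @` det_subgroup (fun _ => True) = GL k (r * r) `&` Y.
Proof.
pose phi (A : 'M[k]_(r * r)) X : 'M[k]_r := vec_mx (mxvec X *m A).
exists [set A | forall p : 'M[k]_r * 'M[k]_r * ('I_r * 'I_r), setT p ->
    (phi A (p.1.1 *m p.1.2) - phi A p.1.1 *m phi A p.1.2) p.2.1 p.2.2 = 0].
  apply: zclosed_bigcap => -[[X Y] [i j]] _ /=;
    have P := polyfun_ring k (r * r).
  have pphi Z : entrywise (@polyfun k (r * r)) (fun A => phi A Z).
    move=> a b; rewrite /phi; under eq_fun do rewrite mxE.
    by apply: fring_mulmx => //; [exact: fring_cstmx | exact: polyfun_entry].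
  apply: (zclosed_zero (f := fun A =>
    (phi A (X *m Y) - phi A X *m phi A Y) i j)).
  under eq_fun do rewrite mxE [X in _ + X]mxE.
  have [_ PD _] := P; apply: PD; first exact: pphi.
  apply: fring_opp => //; exact: (fring_mulmx P (pphi X) (pphi Y)).
have [_ AdU _] := Ad_mult.
have phiAd g X : phi (Ad g) X = invmx g *m X *m g by rewrite /phi mul_Ad mxvecK.
apply/seteqP; split=> [_ [g [Ug _] <-]|A [UA /= mulA]].
  split; first exact: AdU.
  move=> -[[X Y] [i j]] _ /=; rewrite !phiAd.
  by rewrite !mulmxA mulmxK // subrr mxE.
have phiM X Y : phi A (X *m Y) = phi A X *m phi A Y.
  apply/eqP; rewrite -subr_eq0; apply/eqP/matrixP => i j.
  by rewrite (mulA (X, Y, (i, j))) // mxE.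
pose i0 := Ordinal r_gt0.
have phi0 : phi A (delta_mx i0 i0) != 0.
  apply/eqP => /(congr1 mxvec); rewrite vec_mxK linear0 => eA.
  have : mxvec (delta_mx i0 i0 : 'M[k]_r) = 0.
    by apply: (can_inj (mulmxK UA)); rewrite eA mul0mx.
  move/(congr1 vec_mx); rewrite mxvecK linear0 => /matrixP/(_ i0 i0)/eqP.
  by rewrite !mxE !eqxx oner_eq0.
have [u u0] : exists u : 'rV[k]_r, u *m phi A (delta_mx i0 i0) != 0.
  apply: contrapT => /forallNP u0; case/eqP: phi0; apply/row_matrixP => a.
  rewrite row0 rowE; apply/eqP/negPn/negP; exact: u0.
pose h : 'M[k]_r := \matrix_i (u *m phi A (delta_mx i0 i)).
have hphi X : h *m phi A X = X *m h.
  apply/row_matrixP => i; rewrite !row_mul rowK -mulmxA -phiM.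
  have -> : delta_mx i0 i *m X = \sum_j X i j *: delta_mx i0 j.
    apply/matrixP => a b; rewrite mxE (bigD1 i) //= big1 => [|m mi]; last first.
      by rewrite mxE (negPf mi) andbF mul0r.
    rewrite summxE (bigD1 b) //= big1 => [|m mb]; last first.
      by rewrite !mxE [b == m]eq_sym (negPf mb) andbF mulr0.
    by rewrite !mxE !eqxx !andbT !addr0 mulrC.
  rewrite [RHS]mulmx_sum_row /phi linear_sum mulmx_suml linear_sum mulmx_sumr.
  apply: eq_bigr => j _.
  by rewrite linearZ /= -scalemxAl linearZ /= -scalemxAr mxE rowK.
have Uh : h \in unitmx.
  rewrite -row_free_unit -kermx_eq0; apply: contraNT u0 => ker0.
  have [b wb] : exists b, nz_row (kermx h) 0 b != 0.
    apply: contrapT => /forallNP w0; case/negP: ker0; rewrite -nz_row_eq0.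
    apply/eqP/rowP => b; rewrite [RHS]mxE; apply/eqP/negPn/negP; exact: w0.
  have wh : nz_row (kermx h) *m h = 0 by apply/sub_kermxP/nz_row_sub.
  have : nz_row (kermx h) *m (delta_mx b i0 *m h) = 0.
    by rewrite -hphi mulmxA wh mul0mx.
  rewrite mulmxA; have -> : nz_row (kermx h) *m delta_mx b i0 =
      nz_row (kermx h) 0 b *: delta_mx 0 i0.
    apply/rowP => a; rewrite mxE (bigD1 b) //= big1 => [|m mb]; last first.
      by rewrite mxE (negPf mb) mulr0.
    by rewrite !mxE !eqxx addr0.
  rewrite -scalemxAl -rowE rowK => /eqP; rewrite scaler_eq0 (negPf wb) /=.
  exact.
exists h => //; apply: mxvec_ext => X; rewrite mul_Ad -mulmxA -hphi mulKmx //.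
exact: vec_mxK.
Qed.

(** The fibres of Ad are punctured lines through the origin, which are
    connected. So each part of a disconnection of the preimage is a union of
    fibres, and by Ad_push it comes from a closed set. *)
Lemma Ad_pull B : B `<=` @Ad k r @` det_subgroup (fun _ => True) ->
  zconnected B -> zconnected [set g | det_subgroup (fun _ =>
    True) g /\ B (Ad g)].
Proof.
move=> BH conB X Y clX clY KXY KXY0; set K := [set g | _] in KXY KXY0 *.
have KZ g c : K g -> c != 0 -> K (c *: g).
  move=> [[Ug _] Bg] c0;
    have Ucg : c *: g \in unitmx by rewrite unitmxZ // unitfE.
  by split=> //; rewrite (_ : Ad (c *: g) = Ad g) //; apply/Ad_ker => //;
    exists c.
pose cone (Z : set 'M[k]_r) := [set g | forall c, c != 0 -> Z (c *: g)].
have clcone Z : zclosed Z -> zclosed (cone Z).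
  move=> clZ; apply: zclosed_bigcap => c _.
  apply: (zclosed_preimage (F := fun g => c *: g)) => //.
  have P := polyfun_ring k r; have [Pc _ _] := P.
  by apply: fring_scalemx => //; apply: polyfun_entry.
have coneZ Z g c : g \in unitmx -> c != 0 -> true || (c == 1) -> cone Z g ->
  cone Z (c *: g).
  move=> _ c0 _ Zg d d0; rewrite scalerA; apply: Zg; exact: mulf_neq0.
have lines Z Z' g : zclosed Z -> zclosed Z' -> K `<=` Z `|` Z' ->
    K `&` (Z `&` Z') = set0 -> K g -> Z g -> cone Z g.
  move=> clZ clZ' KZZ' KZZ'0 Kg Zg c c0.
  pose F (s : 'M[k]_1) : 'M[k]_r := s 0 0 *: g.
  have Fl : F @` [set s : 'M[k]_1 | s 0 0 != 0] `<=` K by move=> _ [s s0 <-];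
    apply: KZ.
  have conF : zconnected (F @` [set s : 'M[k]_1 | s 0 0 != 0]).
    apply: zconnected_image; last exact/zconnected_line/polyfun_entry.
    have R := regular_ring [set s : 'M[k]_1 | s 0 0 != 0].
    by apply: fring_scalemx => //; [exact: regular_entry | exact: fring_cstmx].
  have [||FZ|FZ'] := conF Z Z' clZ clZ'.
  - by move=> x /Fl/KZZ'.
  - by rewrite -subset0 -KZZ'0; apply: setSI.
  - by apply: FZ; exists c%:M; rewrite /F /= mxE mulr1n.
  - have : (K `&` (Z `&` Z')) g; last by rewrite KZZ'0.
    split=> //; split=> //; apply: FZ'; exists 1;
      rewrite /F /= mxE mulr1n ?oner_eq0 //.
    by rewrite scale1r.
have [X' clX' X'E] := Ad_push (clcone X clX) (@coneZ X).
have [Y' clY' Y'E] := Ad_push (clcone Y clY) (@coneZ Y).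
have coneX Z g : cone Z g -> Z g.
  by move=> /(_ 1 (oner_neq0 _)); rewrite scale1r.
have KYX : K `<=` Y `|` X by rewrite setUC.
have KYX0 : K `&` (Y `&` X) = set0 by rewrite [Y `&` X]setIC.
have [||BX|BY] := conB X' Y' clX' clY'.
- move=> x Bx; have [g [Ug _] gx] := BH x Bx; rewrite -gx in Bx *.
  have Kg : K g by [].
  have [Xg|Yg] := KXY g Kg; [left; apply/X'E => //|right; apply/Y'E => //].
    exact: (lines X Y).
  exact: (lines Y X).
- apply/seteqP; split=> // x [Bx]; have [g [Ug _] gx] := BH x Bx.
  rewrite -gx in Bx * => -[/(X'E g Ug)/coneX Xg /(Y'E g Ug)/coneX Yg].
  have : (K `&` (X `&` Y)) g by split.
  by rewrite KXY0.
- by left=> g [[Ug _] Bg]; apply: coneX; apply/(X'E g Ug); apply: BX.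
- by right=> g [[Ug _] Bg]; apply: coneX; apply/(Y'E g Ug); apply: BY.
Qed.

Lemma PGL_central_quotient :
  central_quotient (fun g : 'M[k]_r => Ad g) (fun _ : k => True) true.
Proof.
split=> //.
- exact: Ad_mult.
- exact: Ad_ker.
- exact: Ad_regular.
- exact: Ad_push.
- exact: Ad_image.
- exact: Ad_pull.
- exact: Ad_diag.
Qed.

End Adjoint.
End Instances.
(** * Quasi-isolated classes in characteristic 2 *)

Theorem proposition4p1 (k : closedFieldType) (char2 : 2%N \in [pchar k])
    (r : nat) (r_gt0 : (0 < r)%N) :
  [/\ forall E : extension (fun g : 'M[k]_r => g) (GL k r),
        sigma_only_quasi_isolated E /\ sigma_centralizer_symplectic E,
      forall E : extension (fun g : 'M[k]_r => g) (SL k r),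
        sigma_only_quasi_isolated E /\ sigma_centralizer_symplectic E
    & forall E : extension (fun g : 'M[k]_r => Ad g) (GL k r),
        sigma_only_quasi_isolated E /\ sigma_centralizer_symplectic E].
Proof.
have main n (rho : 'M[k]_r -> 'M[k]_n) Q scal (H : set 'M[k]_r) :
    central_quotient rho Q scal -> H = det_subgroup Q ->
    forall E : extension rho H,
    sigma_only_quasi_isolated E /\ sigma_centralizer_symplectic E.
  move=> rhoP -> E; split.
    exact: (sigma_only_quasi_isolatedP rhoP).
  exact: (sigma_centralizer_symplecticP rhoP).
split; apply: main.
- exact: GL_central_quotient.
- exact: GL_det_subgroup.
- exact: SL_central_quotient.
- exact: SL_det_subgroup.
- exact: PGL_central_quotient.
- exact: GL_det_subgroup.
Qed.
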